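(* Suppose $C$ is a progressively measurable process with $C^{1-R}\in\mathbb{SO}_+$. Then there exist a unique CRRA-order solution, a unique extremal solution and a unique proper solution associated to $C$, and these three solutions coincide.
   Context: Work on a filtered probability space $(\Omega,\mathcal F,(\mathcal F_t)_{t\ge0},\mathbb P)$ whose filtration is complete and continuous, with $\mathcal F_0$ trivial; processes are identified up to indistinguishability. $\mathscr P_+$ (resp. $\mathscr P_{++}$) denotes nonnegative (resp. strictly positive) progressively measurable processes. Parameters $R,S\in(0,1)\cup(1,\infty)$ satisfy $\theta:=\frac{1-R}{1-S}>1$; $\rho:=\frac{\theta-1}{\theta}$. The Epstein--Zin aggregator is $f_{EZ}(c,v)=\frac{c^{1-S}}{1-S}((1-R)v)^{\rho}$ for $c\ge0$, $v\in(1-R)[0,\infty)$. Given $C\in\mathscr P_+$, a solution associated to $C$ is a càdlàg progressively measurable process $V$ with values in $(1-R)[0,\infty)$ such that $\mathbb E\int_0^\infty|f_{EZ}(C_s,V_s)|\,ds<\infty$ and $V_t=\mathbb E[\int_t^\infty f_{EZ}(C_s,V_s)\,ds\mid\mathcal F_t]$ for all $t\ge0$. For $X\in\mathscr P_+$ let $J^X_t=\mathbb E[\int_t^\infty X_s\,ds\mid\mathcal F_t]$. A solution $V$ is: proper if for every $t\ge0$, up to null sets, $(1-R)V_t>0$ on $\{J^{C^{1-R}}_t>0\}$; extremal if $(1-R)V\ge(1-R)Y$ for every solution $Y$ associated to $C$; a CRRA-order solution if there are constants $0<k\le K<\infty$ with $kJ^{C^{1-R}}\le(1-R)V\le KJ^{C^{1-R}}$.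 $\mathbb{SO}$ is the set of $X\in\mathscr P_{++}$ with $\mathbb E\int_0^\infty X_t\,dt<\infty$ such that $kJ^X\le X\le KJ^X$ for some constants $0<k\le K<\infty$; $\mathbb{SO}_\nu$ ($\nu\ge0$) is the set of $X\in\mathbb{SO}$ with $(e^{\nu t}X_t)_{t\ge0}\in\mathbb{SO}$, and $\mathbb{SO}_+=\bigcup_{\nu>0}\mathbb{SO}_\nu$. *)

(* Defs.v *)
From HB Require Import structures.
From mathcomp Require Import all_boot all_order all_algebra.
From mathcomp Require Import all_classical all_reals all_analysis measurable_realfun.
Set Implicit Arguments. Unset Strict Implicit. Unset Printing Implicit Defensive.
Import Order.TTheory GRing.Theory Num.Theory.
Import numFieldNormedType.Exports.
Local Open Scope classical_set_scope.
Local Open Scope ring_scope.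

(* A stochastic process indexed by time t in R (only t >= 0 is relevant). *)
Definition process (Omega : Type) (R : realType) := R -> Omega -> R.

Section EZ.
Context {d : measure_display} {Omega : measurableType d} {R : realType}.
Variable (P : probability Omega R).

Definition is_filtration (F : R -> set (set Omega)) : Prop :=
  (forall t, 0 <= t -> sigma_algebra setT (F t)) /\
  (forall t, 0 <= t -> F t `<=` measurable) /\
  (forall s t, 0 <= s -> s <= t -> F s `<=` F t).

Definition filtration_complete (F : R -> set (set Omega)) : Prop :=
  forall N : set Omega,
    (exists A, measurable A /\ N `<=` A /\ P A = 0%E) -> F 0 N.

Definition filtration_continuous (F : R -> set (set Omega)) : Prop :=
  (forall t, 0 <= t -> F t = \bigcap_(s in [set s | t < s]) F s) /\
  (forall t, 0 < t -> F t = <<s setT, \bigcup_(s in [set s | 0 <= s < t]) F s >>).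

Definition filtration_trivial0 (F : R -> set (set Omega)) : Prop :=
  forall A, F 0 A -> P A = 0%E \/ P A = 1%E.

Definition standing_filtration (F : R -> set (set Omega)) : Prop :=
  [/\ is_filtration F, filtration_complete F, filtration_continuous F
    & filtration_trivial0 F].

Definition G_measurable (G : set (set Omega)) (Y : Omega -> \bar R) : Prop :=
  forall B : set (\bar R), measurable B -> G (Y @^-1` B).

(* progressive measurability: for each t >= 0, (s, w) |-> X s w restricted to
   [0,t] x Omega is B([0,t]) (x) F_t -measurable *)
Definition progressive (F : R -> set (set Omega)) (X : process Omega R) : Prop :=
  forall t, 0 <= t ->
    forall B : set R, measurable B ->
      <<s [set s : R | 0 <= s <= t] `*` setT,
          [set Z : set (R * Omega) | exists (A : set R) (G : set Omega),
             [/\ measurable A, A `<=` [set s : R | 0 <= s <= t], F t G & Z = A `*` G]] >>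
        [set p : R * Omega | 0 <= p.1 <= t /\ B (X p.1 p.2)].

Definition cadlag (X : process Omega R) : Prop :=
  forall w : Omega,
    (forall t, 0 <= t -> (X ^~ w) @ t^'+ --> X t w) /\
    (forall t, 0 < t -> cvg ((X ^~ w) @ t^'-)).

(* Y is a version of E[Z | G]: G-measurable and with the same integrals over
   every A in G; either Z and Y are integrable, or both are nonnegative
   (generalized conditional expectation of a nonnegative variable). *)
Definition cexp_version (G : set (set Omega)) (Z Y : Omega -> \bar R) : Prop :=
  [/\ G_measurable G Y,
      (P.-integrable setT Z /\ P.-integrable setT Y) \/
      ((forall w, (0 <= Z w)%E) /\ (forall w, (0 <= Y w)%E))
    & forall A, G A -> (\int[P]_(w in A) Y w = \int[P]_(w in A) Z w)%E].

Definition tail_int (X : process Omega R) (t : R) : Omega -> \bar R :=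
  fun w => (\int[@lebesgue_measure R]_(s in [set s : R | (t <= s)%R]) (X s w)%:E)%E.

Definition is_J (F : R -> set (set Omega)) (X J : process Omega R) : Prop :=
  cadlag J /\
  forall t, 0 <= t -> cexp_version (F t) (tail_int X t) (fun w => (J t w)%:E).

Definition P_plus (F : R -> set (set Omega)) (X : process Omega R) : Prop :=
  progressive F X /\ forall t w, 0 <= t -> 0 <= X t w.

Definition P_plusplus (F : R -> set (set Omega)) (X : process Omega R) : Prop :=
  progressive F X /\ forall t w, 0 <= t -> 0 < X t w.

Definition SO (F : R -> set (set Omega)) (X : process Omega R) : Prop :=
  [/\ P_plusplus F X,
      (\int[P]_w (\int[@lebesgue_measure R]_(s in [set s : R | (0 <= s)%R]) (X s w)%:E) < +oo)%E
    & exists k K : R, [/\ 0 < k, k <= K &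
        exists J, is_J F X J /\
          {ae P, forall w, forall t, 0 <= t -> k * J t w <= X t w <= K * J t w}]].

Definition SO_nu (F : R -> set (set Omega)) (nu : R) (X : process Omega R) : Prop :=
  SO F X /\ SO F (fun t w => expR (nu * t) * X t w).

Definition SO_plus (F : R -> set (set Omega)) (X : process Omega R) : Prop :=
  exists nu : R, 0 < nu /\ SO_nu F nu X.

Variables (Ra Sa : R).

Definition ez_theta : R := (1 - Ra) / (1 - Sa).
Definition ez_rho : R := (ez_theta - 1) / ez_theta.

Definition f_EZ (c v : R) : R :=
  (c `^ (1 - Sa)) / (1 - Sa) * (((1 - Ra) * v) `^ ez_rho).

Definition powC (C : process Omega R) : process Omega R :=
  fun t w => C t w `^ (1 - Ra).

Definition ez_proc (C V : process Omega R) : process Omega R :=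
  fun t w => f_EZ (C t w) (V t w).

Definition is_solution (F : R -> set (set Omega)) (C V : process Omega R) : Prop :=
  [/\ cadlag V, progressive F V,
      (forall t w, 0 <= t -> 0 <= (1 - Ra) * V t w),
      (\int[P]_w (\int[@lebesgue_measure R]_(s in [set s : R | (0 <= s)%R])
                     `|ez_proc C V s w|%:E) < +oo)%E
    & forall t, 0 <= t ->
        cexp_version (F t) (tail_int (ez_proc C V) t) (fun w => (V t w)%:E)].

Definition is_proper (F : R -> set (set Omega)) (C V : process Omega R) : Prop :=
  is_solution F C V /\
  forall t, 0 <= t -> forall Jt : Omega -> \bar R,
    cexp_version (F t) (tail_int (powC C) t) Jt ->
    {ae P, forall w, (0 < Jt w)%E -> 0 < (1 - Ra) * V t w}.

Definition is_extremal (F : R -> set (set Omega)) (C V : process Omega R) : Prop :=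
  is_solution F C V /\
  forall Y, is_solution F C Y ->
    {ae P, forall w, forall t, 0 <= t -> (1 - Ra) * Y t w <= (1 - Ra) * V t w}.

Definition is_CRRA_order (F : R -> set (set Omega)) (C V : process Omega R) : Prop :=
  is_solution F C V /\
  exists k K : R, [/\ 0 < k, k <= K &
    exists J, is_J F (powC C) J /\
      {ae P, forall w, forall t, 0 <= t ->
         k * J t w <= (1 - Ra) * V t w <= K * J t w}].

End EZ.

Definition indistinguishable {d : measure_display} {Omega : measurableType d}
  {R : realType} (P : probability Omega R) (X Y : process Omega R) : Prop :=
  {ae P, forall w, forall t, 0 <= t -> X t w = Y t w}.

(* Main.v *)
(* For a solution V put W = (1-R)V, so that W_t = E[int_t^oo th X^(1/th) W^rho ds | F_t]
   with X = C^(1-R). If Y and W are two such processes and W > 0, then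
   n(y, v) = ((y^(1/th) - v^(1/th))_+)^th is convex and 1-homogeneous, and its gradient
   annihilates the pair of drifts (Y^rho, W^rho); hence n(Y, W) is a submartingale. It is
   dominated by Y, whose expectation tends to 0, so it vanishes and Y <= W. Thus every
   solution lies below every positive one: a positive solution is unique and extremal, and
   each of the three classes contains only positive solutions or maximal ones. A positive
   solution is the limit of a monotone iteration between two multiples of J, which are
   fixed by the comparability of X and J; its cadlag version exists by counting
   upcrossings along dyadic times, the filtration being right-continuous and complete. *)
Require Import Defs.
From HB Require Import structures.
From mathcomp Require Import all_boot all_order all_algebra.
From mathcomp Require Import all_classical all_reals all_analysis measurable_realfun.
From mathcomp Require Import ring lra.
Set Implicit Arguments. Unset Strict Implicit. Unset Printing Implicit Defensive.
Import Order.TTheory GRing.Theory Num.Theory.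
Import numFieldNormedType.Exports.
Local Open Scope classical_set_scope.
Local Open Scope ring_scope.

(** * Conditional expectation *)

(** The roots in n come from the case without noise: there W' = - th X^(1/th) W^rho, and rho = 1 -
    1/th makes the derivative of W^(1/th) equal to - X^(1/th), whatever W > 0 is. Two positive
    solutions then have roots at constant distance; convexity of n takes care of the noise. Since
    rho > 0, the zero process is always a solution, so the upper process of a comparison has to be
    positive; this is also where the gradient of n is continuous. No stochastic calculus is used.
    The submartingale inequality is first written between neighbouring points of a time grid, with
    the gradient frozen at the left point, and then the mesh tends to 0. The limit is taken by
    Fatou's lemma, so the inequality is arranged with nonnegative terms: the derivative a of n in y
    satisfies 0 <= a <= 1, and the drifts enter with weights 1 - a and b instead of a and - b. Most
    relations hold almost surely at each single time first; they pass to all times by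
    right-continuity and to time integrals by Tonelli. *)

Section condexp.
Context {d : measure_display} {T : measurableType d} {R : realType}.
Local Open Scope ereal_scope.

Lemma density_measure (mu : {measure set T -> \bar R}) (Z : T -> \bar R) :
  measurable_fun setT Z -> (forall x, 0 <= Z x) -> \int[mu]_x Z x < +oo ->
  exists nu : {finite_measure set T -> \bar R},
    forall A, nu A = \int[mu]_(x in A) Z x.
Proof.
move=> mZ Z0 Zoo; pose nu A := \int[mu]_(x in A) Z x.
have nu0 : nu set0 = 0 by rewrite /nu integral_set0.
have nu_ge0 A : 0 <= nu A by exact: integral_ge0.
have nusa : semi_sigma_additive nu.
  move=> F mF tF mUF.
  rewrite /nu ge0_integral_bigcup//; last exact: measurable_funTS.
  by apply: is_cvg_nneseries => n _ _; exact: nu_ge0.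
have nufin : fin_num_fun nu.
  move=> A mA; rewrite ge0_fin_numE//; apply: le_lt_trans Zoo.
  exact: ge0_subset_integral.
pose m1 := isMeasure.Build _ _ _ nu nu0 nu_ge0 nusa.
pose m2 : {measure set T -> \bar R} := HB.pack nu m1.
pose m3 := @Measure_isFinite.Build _ _ _ m2 nufin.
pose m4 : {finite_measure set T -> \bar R} := HB.pack nu m2 m3.
by exists m4.
Qed.

Variable G : set (set T).
Hypothesis sG : sigma_algebra setT G.
Hypothesis GM : G `<=` measurable.

(** The carrier of [T] with the sigma-algebra generated by [G], which is [G] itself by [sG]:
    measurability for [G] becomes ordinary measurability, and a function can be read on either
    type. *)
Let GT := g_sigma_algebraType G.

Lemma sub_measurableE (A : set GT) : measurable A = G A.
Proof. by rewrite measurable_g_measurableTypeE. Qed.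

Lemma sub_measurable_id : measurable_fun setT (id : T -> GT).
Proof. by move=> _ A; rewrite setTI => mA; apply: GM; rewrite -sub_measurableE. Qed.

Lemma sub_measurable_fun d' (T' : measurableType d') (f : GT -> T') :
  measurable_fun setT f -> measurable_fun setT (f : T -> T').
Proof. by move=> mf; apply: (measurableT_comp mf sub_measurable_id). Qed.

(** The trace of [nu] on [G] is its pushforward by the identity [T -> GT]; the change of variables
    formula identifies the integrals. *)
Lemma trace_measure (nu : {finite_measure set T -> \bar R}) :
  exists nu' : {finite_measure set GT -> \bar R},
    (forall A, nu' A = nu A) /\
    (forall (A : set GT) (f : GT -> \bar R), measurable A ->
       measurable_fun A f -> (forall x, 0 <= f x) ->
      \int[nu']_(x in A) f x = \int[nu]_(x in A) f x).
Proof.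
pose m : {mfun T >-> GT} := HB.pack (id : T -> GT)
  (@isMeasurableFun.Build _ _ _ _ (id : T -> GT) sub_measurable_id).
pose m2 : measure GT R :=
  measure_function_pushforward__canonical__measure_function_Measure nu
    (sub_measurable_id : measurable_fun setT m).
have pfin : fin_num_fun m2.
  move=> A mA; apply: fin_num_measure.
  by apply: GM; rewrite -sub_measurableE.
pose m3 := @Measure_isFinite.Build _ _ _ m2 pfin.
pose m4 : {finite_measure set GT -> \bar R} := HB.pack (m2 : set GT -> \bar R) m2 m3.
exists m4; split => // A f mA mf f0.
by rewrite (@ge0_integral_pushforward _ _ _ _ _ m sub_measurable_id nu A f).
Qed.

Variable mu : {finite_measure set T -> \bar R}.

(** [Y] is the Radon-Nikodym derivative, on [GT], of the trace of the measure with density [Z] with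
    respect to the trace of [mu]. The last clause takes a nonnegative [G]-measurable weight out; it
    comes from the change of variables for this derivative. *)
Lemma condexp_exists (Z : T -> \bar R) :
  measurable_fun setT Z -> (forall x, 0 <= Z x) -> \int[mu]_x Z x < +oo ->
  exists Y : T -> R,
    [/\ measurable_fun setT (Y : GT -> R), (forall x, (0 <= Y x)%R),
      (forall A, G A -> \int[mu]_(x in A) (Y x)%:E = \int[mu]_(x in A) Z x) &
      forall H : GT -> R, measurable_fun setT H -> (forall x, (0 <= H x)%R) ->
        \int[mu]_x ((H x)%:E * (Y x)%:E) = \int[mu]_x ((H x)%:E * Z x)].
Proof.
move=> mZ Z0 Zoo.
have [nu nuE] := density_measure mZ Z0 Zoo.
have [mu' [mu'E imu']] := trace_measure mu.
have [nu' [nu'E inu']] := trace_measure nu.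
have dom' : nu' `<< mu'.
  apply/null_content_dominatesP => A mA; rewrite nu'E => A0.
  move: A0; have := mu'E A; rewrite /= => ->. move=> A0.
  have mA' : measurable (A : set T) by apply: GM; rewrite -sub_measurableE.
  by rewrite nuE; apply: null_set_integral => //; exact: measurable_funTS.
have dom : nu `<< mu.
  apply/null_content_dominatesP => A mA A0.
  by rewrite nuE; apply: null_set_integral => //; exact: measurable_funTS.
(* [f] is the derivative on the sub-sigma-algebra, [g] the one on all of [T]; [g] equals [Z] almost
   everywhere and leads back from [nu] to [Z] in the weighted identity. *)
pose f := Radon_Nikodym_SigmaFinite.f nu' mu'.
pose g := Radon_Nikodym_SigmaFinite.f nu mu.
have f0 := Radon_Nikodym_SigmaFinite.f_ge0 dom'.
have ffin := Radon_Nikodym_SigmaFinite.f_fin_num dom'.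
have mf : measurable_fun setT f.
  exact: measurable_int (Radon_Nikodym_SigmaFinite.f_integrable dom').
have g0 := Radon_Nikodym_SigmaFinite.f_ge0 dom.
have mg : measurable_fun setT g.
  exact: measurable_int (Radon_Nikodym_SigmaFinite.f_integrable dom).
have fE x : (fine (f x))%:E = f x by rewrite fineK// ffin.
exists (fun x => fine (f x)); split.
- exact: measurableT_comp.
- by move=> x; apply: fine_ge0; exact: f0.
- move=> A GA; under eq_integral do rewrite fE.
  have mA : measurable (A : set GT) by rewrite sub_measurableE.
  have -> : \int[mu]_(x in A) f x = \int[mu']_(x in A) f x.
    by rewrite imu'//; exact: measurable_funTS.
  by rewrite -(Radon_Nikodym_SigmaFinite.f_integral dom')// nu'E nuE.
move=> H mH H0.
have mEH : measurable_fun setT (fun x : GT => (H x)%:E) by exact/measurable_EFinP.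
under eq_integral do rewrite fE.
have -> : \int[mu]_x ((H x)%:E * f x) = \int[mu']_x ((H x)%:E * f x).
  rewrite imu'//; first by apply: emeasurable_funM.
  by move=> x; apply: mule_ge0; rewrite ?lee_fin//; exact: f0.
rewrite Radon_Nikodym_SigmaFinite.change_of_variables//.
rewrite inu'//.
have mHT : measurable_fun setT (fun x : T => (H x)%:E).
  exact: sub_measurable_fun mEH.
rewrite -(Radon_Nikodym_SigmaFinite.change_of_variables dom)//.
have gZ : ae_eq mu setT g Z.
  apply: integral_ae_eq => //.
    exact: Radon_Nikodym_SigmaFinite.f_integrable.
  by move=> E _ mE; rewrite -(Radon_Nikodym_SigmaFinite.f_integral dom)// nuE.
apply: ge0_ae_eq_integral => //.
- by apply: emeasurable_funM => //; exact: sub_measurable_fun.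
- by apply: emeasurable_funM => //; exact: sub_measurable_fun.
- by move=> x _; apply: mule_ge0; rewrite ?lee_fin//; exact: g0.
- by move=> x _; apply: mule_ge0; rewrite ?lee_fin.
- by apply: filterS gZ => x /(_ I) h _; rewrite -h.
Qed.

(** The set where [Y' < Y] lies in [G]; the integral over it of the positive difference is at most
    0, so the set is null. *)
Lemma condexp_le (Y Y' : GT -> R) : measurable_fun setT Y -> measurable_fun setT Y' ->
  (forall x, (0 <= Y x)%R) -> (forall x, (0 <= Y' x)%R) ->
  \int[mu]_x (Y x)%:E < +oo -> \int[mu]_x (Y' x)%:E < +oo ->
  (forall A, G A -> \int[mu]_(x in A) (Y x)%:E <= \int[mu]_(x in A) (Y' x)%:E) ->
  {ae mu, forall x, (Y x <= Y' x)%R}.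
Proof.
move=> mY mY' Y0 Y'0 Yoo Y'oo le.
pose A : set T := [set x | (Y' x < Y x)%R].
have mA' : measurable (A : set GT).
  by rewrite -[A](@setTI GT); apply: measurable_fun_ltr.
have GA : G A by rewrite -sub_measurableE.
have mA : measurable (A : set T) by exact: GM.
have mYT := sub_measurable_fun mY; have mY'T := sub_measurable_fun mY'.
have iY : mu.-integrable A (fun x => (Y x)%:E).
  apply/integrableP; split; first exact/measurable_EFinP/measurable_funTS.
  under eq_integral do rewrite gee0_abs ?lee_fin//.
  apply: le_lt_trans Yoo; apply: ge0_subset_integral => //.
    exact/measurable_EFinP.
  by move=> x _; rewrite lee_fin.
have iY' : mu.-integrable A (fun x => (Y' x)%:E).
  apply/integrableP; split; first exact/measurable_EFinP/measurable_funTS.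
  under eq_integral do rewrite gee0_abs ?lee_fin//.
  apply: le_lt_trans Y'oo; apply: ge0_subset_integral => //.
    exact/measurable_EFinP.
  by move=> x _; rewrite lee_fin.
pose D (x : T) := ((Y x)%:E - (Y' x)%:E).
have IE : \int[mu]_(x in A) D x =
    \int[mu]_(x in A) (Y x)%:E - \int[mu]_(x in A) (Y' x)%:E.
  exact: integralB.
have Dge0 x : A x -> 0 <= D x.
  by move=> Ax; rewrite /D -EFinB lee_fin subr_ge0 ltW.
have D0 : \int[mu]_(x in A) `|D x| = 0.
  have -> : \int[mu]_(x in A) `|D x| = \int[mu]_(x in A) D x.
    by apply: eq_integral => x /set_mem Ax; rewrite (gee0_abs (Dge0 _ Ax)).
  apply: le_anti; apply/andP; split; last exact: integral_ge0.
  rewrite IE.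
  rewrite leeBlDr; last by apply: integrable_fin_num.
  by rewrite add0e; exact: le.
have mD : measurable_fun A D.
  apply: emeasurable_funB; exact/measurable_EFinP/measurable_funTS.
have /(ae_eq_integral_abs mu mA mD)[N [mN N0 sN]] := D0.
exists N; split => // x /= /negP; rewrite -ltNge => Ax; apply: sN => /= /(_ Ax).
by rewrite /D -EFinB => -[/eqP]; rewrite subr_eq0 => /eqP h; move: Ax; rewrite /A/= h ltxx.
Qed.

End condexp.

(** * Doob's upcrossing inequality *)

Section crossings.
Context {R : realType}.
Implicit Types (a b : R) (x : nat -> R).

(* Buying at or below [a], selling at or above [b], starting with the asset in
   hand; [hold a b x n] is the position held from time [n.-1] to time [n]. *)
Fixpoint hold a b x (n : nat) : bool :=
  if n is m.+1 then (if hold a b x m then x m < b else x m <= a) else true.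

Fixpoint crossings a b x (n : nat) : nat :=
  if n is m.+1 then (crossings a b x m + (hold a b x m && ~~ hold a b x m.+1))%N
  else 0%N.

(** Every sale is booked at exactly [b] and every purchase at exactly [a], so a round trip earns
    [b - a]; the position is the one after trading at time [n]. *)
Definition wealth a b x n : R :=
  (b - a) * (crossings a b x n.+1)%:R + (if hold a b x n.+1 then x n else a).

Lemma wealth0 a b x : wealth a b x 0 <= x 0%N.
Proof.
rewrite /wealth /=; case: ltP => h /=; first by rewrite mulr0 add0r.
by rewrite mulr1 subrK.
Qed.

(** On the left the position is the one after trading at time [n.+1], on the right the one before.
    Selling at or above [b] and buying at or below [a], while booking only [b] and [a], can only
    lose. *)
Lemma wealthS a b x n : wealth a b x n.+1 <=
  (b - a) * (crossings a b x n.+1)%:R + (if hold a b x n.+1 then x n.+1 else a).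
Proof.
have -> : wealth a b x n.+1 = (b - a) * (crossings a b x n.+1 +
    (hold a b x n.+1 && ~~ hold a b x n.+2))%:R +
    (if hold a b x n.+2 then x n.+1 else a) by [].
have -> : hold a b x n.+2 = if hold a b x n.+1 then x n.+1 < b else x n.+1 <= a.
  by [].
move: (crossings a b x n.+1) => c.
case: (hold a b x n.+1) => /=; last by rewrite addn0 lerD2l; case: ifP.
case: ltP => h /=; first by rewrite addn0.
by rewrite natrD mulrDr mulr1 -addrA subrK lerD2l.
Qed.

Lemma crossings_le_wealth a b x n : 0 <= a -> (forall i, 0 <= x i) ->
  (b - a) * (crossings a b x n.+1)%:R <= wealth a b x n.
Proof. by move=> a0 x0; rewrite /wealth lerDl; case: ifP. Qed.

(** The boolean term records the sale that must have taken place after [i] if the asset is no longer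
    held at [i + k]. *)
Lemma crossings_hold a b x i k : hold a b x i ->
  (crossings a b x i + ~~ hold a b x (i + k) <= crossings a b x (i + k))%N.
Proof.
move=> hi; elim: k => [|k IH]; first by rewrite addn0 hi addn0.
rewrite addnS [crossings a b x (i + k).+1]/= -/(hold a b x (i + k).+1).
move: IH; case: (hold a b x (i + k)) => /= IH.
  by rewrite leq_add2r; rewrite addn0 in IH.
rewrite addn0; apply: leq_trans IH; rewrite leq_add2l.
by case: (~~ _).
Qed.

Lemma leq_crossings a b x i j : (i <= j)%N ->
  (crossings a b x i <= crossings a b x j)%N.
Proof.
move=> /subnKC <-; elim: (j - i)%N => [|k IH]; first by rewrite addn0.
by rewrite addnS /=; apply: leq_trans IH (leq_addr _ _).
Qed.

Lemma crossings_up a b x i j : a < b -> (i < j)%N -> x i <= a -> b <= x j ->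
  (crossings a b x i.+1 < crossings a b x j.+1)%N.
Proof.
move=> ab ij xi xj.
have hi : hold a b x i.+1 by rewrite /=; case: ifP => // _; exact: le_lt_trans ab.
have hj : hold a b x j.+1 = false.
  rewrite /=; case: ifP => _; first by rewrite ltNge xj.
  by rewrite leNgt (lt_le_trans ab xj).
have := crossings_hold (j - i) hi.
by rewrite addSn subnKC ?(ltnW ij)// hj addn1.
Qed.

(** As [hold] starts with [true], a visit above [b] counts without an earlier visit below [a].
    Thereby the upcrossing inequality also serves as a maximal inequality. *)
Lemma crossings_exceed a b x j : a < b -> b <= x j -> (0 < crossings a b x j.+1)%N.
Proof.
move=> ab xj.
have hj : hold a b x j.+1 = false.
  rewrite /=; case: ifP => _; first by rewrite ltNge xj.
  by rewrite leNgt (lt_le_trans ab xj).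
by have := @crossings_hold a b x 0 j.+1 isT; rewrite add0n hj /= add0n.
Qed.

End crossings.

Section upcrossing.
Context {d : measure_display} {T : measurableType d} {R : realType}.
Variables (mu : {finite_measure set T -> \bar R}) (G : nat -> set (set T)).
Hypotheses (sG : forall n, sigma_algebra setT (G n))
  (GM : forall n, G n `<=` measurable) (GS : forall n, G n `<=` G n.+1).
Variable M : nat -> T -> R.
Hypothesis mM : forall n, measurable_fun setT (M n : g_sigma_algebraType (G n) -> R).
Hypothesis M0 : forall n x, 0 <= M n x.
Hypothesis Msup : forall n A, G n A ->
  (\int[mu]_(x in A) (M n.+1 x)%:E <= \int[mu]_(x in A) (M n x)%:E)%E.
Variables a b : R.
Hypotheses (a0 : 0 <= a) (ab : a <= b).

Lemma hold_measurable n : measurable_fun setT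
  ((fun x => hold a b (M ^~ x) n.+1) : g_sigma_algebraType (G n) -> bool).
Proof.
elim: n => [|n IH].
  rewrite /=.
  by apply: measurable_fun_ltr => //; exact: mM.
have IH' : measurable_fun setT
    ((fun x => hold a b (M ^~ x) n.+1) : g_sigma_algebraType (G n.+1) -> bool).
  move=> _ B mB; have := IH measurableT B mB.
  by rewrite !sub_measurableE//; exact: GS.
rewrite (_ : (fun _ => _) = fun x : g_sigma_algebraType (G n.+1) =>
    if hold a b (M ^~ x) n.+1 then M n.+1 x < b else M n.+1 x <= a)//.
apply: (@measurable_fun_ifT _ _ (g_sigma_algebraType (G n.+1)) bool
  (fun x => M n.+1 x < b) (fun x => M n.+1 x <= a)) => //.
- by apply: measurable_fun_ltr => //; exact: mM.
- by apply: measurable_fun_ler => //; exact: mM.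
Qed.

Lemma hold_sub_measurable n : G n [set x | hold a b (M ^~ x) n.+1].
Proof.
have := hold_measurable (n := n) measurableT (Y := [set true]) I.
by rewrite setTI sub_measurableE.
Qed.

Lemma hold_measurableT n : measurable_fun setT (fun x => hold a b (M ^~ x) n).
Proof.
case: n => [|n]; first exact: measurable_cst.
by apply: (sub_measurable_fun (sG n) (@GM n)); exact: hold_measurable.
Qed.

Lemma crossings_measurable n :
  measurable_fun setT (fun x => (crossings a b (M ^~ x) n)%:R : R).
Proof.
elim: n => [|n IH]; first exact: measurable_cst.
rewrite (_ : (fun _ => _) = fun x => (crossings a b (M ^~ x) n)%:R +
    (if hold a b (M ^~ x) n && ~~ hold a b (M ^~ x) n.+1 then 1 else 0)).
  apply: measurable_funD => //; apply: measurable_fun_ifT => //.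
  apply: measurable_and; first exact: hold_measurableT.
  by apply/measurable_neg; exact: hold_measurableT.
by apply/funext => x /=; rewrite natrD; case: (_ && _).
Qed.

Let MT n : measurable_fun setT (M n).
Proof. by apply: (sub_measurable_fun (sG n) (@GM n)); exact: mM. Qed.

(** The split isolates the only term that contains the price, an integral over a set of [G n], to
    which the supermartingale hypothesis applies. *)
Lemma integral_bet n m : (\int[mu]_x ((b - a) * (crossings a b (M ^~ x) n.+1)%:R +
     (if hold a b (M ^~ x) n.+1 then M m x else a))%:E =
   \int[mu]_x ((b - a) * (crossings a b (M ^~ x) n.+1)%:R)%:E +
   (\int[mu]_(x in [set x | hold a b (M ^~ x) n.+1]) (M m x)%:E +
    \int[mu]_(x in ~` [set x | hold a b (M ^~ x) n.+1]) a%:E))%E.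
Proof.
set H := [set x | _].
have mH : measurable H by apply: GM; exact: hold_sub_measurable.
have mf : measurable_fun setT (fun x => if hold a b (M ^~ x) n.+1 then M m x else a).
  by apply: measurable_fun_ifT => //; exact: hold_measurableT.
under eq_integral do rewrite EFinD.
rewrite ge0_integralD//.
- congr (_ + _)%E; rewrite -(setUv H) ge0_integral_setU//.
  + congr (_ + _)%E; apply: eq_integral => x; rewrite inE /H /=.
      by move=> ->.
    by move=> /negP/negbTE ->.
  + exact: measurableC.
  + by rewrite setUv; exact/measurable_EFinP.
  + by move=> x _; rewrite lee_fin; case: ifP.
  + by apply/disj_setPCl.
- by move=> x _; rewrite lee_fin mulr_ge0// subr_ge0.
- apply/measurable_EFinP; apply: measurable_funM => //.
  exact: crossings_measurable.
- by move=> x _; rewrite lee_fin; case: ifP.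
- exact/measurable_EFinP.
Qed.

Lemma wealth_ge0 n x : 0 <= wealth a b (M ^~ x) n.
Proof.
apply: le_trans (crossings_le_wealth b n a0 (fun i => M0 i x)).
by rewrite mulr_ge0// subr_ge0.
Qed.

Lemma wealth_measurable n : measurable_fun setT (fun x => wealth a b (M ^~ x) n).
Proof.
apply: measurable_funD.
  by apply: measurable_funM => //; exact: crossings_measurable.
by apply: measurable_fun_ifT => //; exact: hold_measurableT.
Qed.

(** Expected wealth decreases: trading loses by [wealthS], and a position fixed at time [n] loses by
    the supermartingale property. Wealth starts below [M 0] and dominates the booked profit because
    prices are nonnegative. *)
Lemma upcrossing n :
  (\int[mu]_x ((b - a) * (crossings a b (M ^~ x) n.+1)%:R)%:E <= \int[mu]_x (M 0%N x)%:E)%E.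
Proof.
apply: (@le_trans _ _ (\int[mu]_x (wealth a b (M ^~ x) n)%:E)%E).
  apply: ge0_le_integral => //.
  - by move=> x _; rewrite lee_fin mulr_ge0// subr_ge0.
  - apply/measurable_EFinP; apply: measurable_funM => //.
    exact: crossings_measurable.
  - exact/measurable_EFinP/wealth_measurable.
  - by move=> x _; rewrite lee_fin crossings_le_wealth.
elim: n => [|n IH].
  apply: ge0_le_integral => //.
  - by move=> x _; rewrite lee_fin wealth_ge0.
  - exact/measurable_EFinP/wealth_measurable.
  - exact/measurable_EFinP.
  - by move=> x _; rewrite lee_fin wealth0.
apply: le_trans IH.
apply: (@le_trans _ _ (\int[mu]_x ((b - a) * (crossings a b (M ^~ x) n.+1)%:R +
     (if hold a b (M ^~ x) n.+1 then M n.+1 x else a))%:E)%E).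
  apply: ge0_le_integral => //.
  - by move=> x _; rewrite lee_fin wealth_ge0.
  - exact/measurable_EFinP/wealth_measurable.
  - apply/measurable_EFinP; apply: measurable_funD.
      by apply: measurable_funM => //; exact: crossings_measurable.
    by apply: measurable_fun_ifT => //; exact: hold_measurableT.
  - by move=> x _; rewrite lee_fin wealthS.
rewrite /wealth !integral_bet leeD2l// leeD2r//.
exact/Msup/hold_sub_measurable.
Qed.

End upcrossing.

(** * Regularization of paths along the dyadic numbers *)

Section dyadic_paths.
Context {R : realType}.
Implicit Types (f : R -> R) (a b r t : R).

Definition dyadic r := exists n i, r = i%:R / 2 ^+ n.

(** The next point of the grid of mesh [2^-n], strictly to the right of [t >= 0] even when [t] is on
    the grid: these points test right limits at [t]. *)
Definition dyadic_above n t : R := (Num.truncn (t * 2 ^+ n)).+1%:R / 2 ^+ n.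

Lemma exp2_gt0 n : 0 < 2 ^+ n :> R. Proof. by rewrite exprn_gt0. Qed.

Lemma dyadic_dyadic_above n t : dyadic (dyadic_above n t).
Proof. by exists n, (Num.truncn (t * 2 ^+ n)).+1. Qed.

Lemma dyadic_ge0 r : dyadic r -> 0 <= r.
Proof. by move=> [n [i ->]]; rewrite divr_ge0// ltW// exp2_gt0. Qed.

Lemma dyadic_above_itv n t : 0 <= t -> t < dyadic_above n t <= t + (2 ^+ n)^-1.
Proof.
move=> t0; have t20 : 0 <= t * 2 ^+ n by rewrite mulr_ge0// ltW// exp2_gt0.
have /andP[h1 h2] := truncn_itv t20.
rewrite /dyadic_above ltr_pdivlMr ?exp2_gt0// h2/=.
have -> : t + (2 ^+ n)^-1 = (t * 2 ^+ n + 1) / 2 ^+ n.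
  by rewrite mulrDl mulfK ?lt0r_neq0 ?exp2_gt0// div1r.
by rewrite ler_pM2r ?invr_gt0 ?exp2_gt0// -natr1 lerD2r.
Qed.

Lemma near_exp2V (e : R) : 0 < e -> \forall n \near \oo, (2 ^+ n)^-1 < e.
Proof.
by move=> e0; near=> n; rewrite -div1r; near: n;
  exact: (near_infty_natSinv_expn_lt (PosNum e0)).
Unshelve. all: by end_near. Qed.

Lemma dyadic_dense a b : 0 <= a -> a < b -> exists r, [/\ dyadic r, a < r & r < b].
Proof.
move=> a0 ab; have ba0 : 0 < b - a by rewrite subr_gt0.
have [n /= hn] := filter_ex (near_exp2V ba0).
exists (dyadic_above n a); have /andP[h1 h2] := dyadic_above_itv n a0.
split => //; first exact: dyadic_dyadic_above.
by apply: le_lt_trans h2 _; rewrite -ltrBrDl.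
Qed.

Definition dyadic_right t := within dyadic t^'+.
Definition dyadic_left t := within dyadic t^'-.

Lemma dyadic_rightP t (A : set R) : dyadic_right t A <->
  exists2 e, 0 < e & forall r, dyadic r -> t < r -> r < t + e -> A r.
Proof.
split.
  move=> /= [e /= e0 h]; exists e => // r dr tr re; apply: h => //=.
  by rewrite ltr_norml; apply/andP; split; lra.
move=> [e e0 h]; exists e => //= r; rewrite /ball_ /= ltr_norml => /andP[h1 h2] tr dr.
by apply: h => //; lra.
Qed.

Lemma dyadic_leftP t (A : set R) : dyadic_left t A <->
  exists2 e, 0 < e & forall r, dyadic r -> t - e < r -> r < t -> A r.
Proof.
split.
  move=> /= [e /= e0 h]; exists e => // r dr tr re; apply: h => //=.
  by rewrite ltr_norml; apply/andP; split; lra.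
move=> [e e0 h]; exists e => //= r; rewrite /ball_ /= ltr_norml => /andP[h1 h2] tr dr.
by apply: h => //; lra.
Qed.

Lemma dyadic_right_proper t : 0 <= t -> ProperFilter (dyadic_right t).
Proof.
move=> t0; apply: Build_ProperFilter_ex.
move=> A /dyadic_rightP[e e0 h].
have [r [dr tr re]] := @dyadic_dense t (t + e) t0 ltac:(lra).
by exists r; apply: h.
Qed.

Lemma dyadic_left_proper t : 0 < t -> ProperFilter (dyadic_left t).
Proof.
move=> t0; apply: Build_ProperFilter_ex.
move=> A /dyadic_leftP[e e0 h].
have [r [dr tr re]] : exists r, [/\ dyadic r, Num.max 0 (t - e) < r & r < t].
  by apply: dyadic_dense; rewrite ?le_max ?lexx// gt_max t0/=; lra.
exists r; apply: h => //; apply: le_lt_trans tr.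
by rewrite le_max lexx orbT.
Qed.

Lemma dyadic_above_right t (A : set R) : 0 <= t -> dyadic_right t A ->
  \forall n \near \oo, A (dyadic_above n t).
Proof.
move=> t0 /dyadic_rightP[e e0 h]; near=> n.
have /andP[h1 h2] := dyadic_above_itv n t0.
apply: h => //; first exact: dyadic_dyadic_above.
by apply: le_lt_trans h2 _; rewrite ltrD2l; near: n; exact: near_exp2V.
Unshelve. all: by end_near. Qed.

Definition dyadic_crossings f a b n t : nat :=
  crossings a b (fun i => f (i%:R / 2 ^+ n)) (Num.truncn (t * 2 ^+ n)).+1.

(** The grid of mesh [2^-n] is run up to time [2^n]: fineness and horizon grow together, so that
    each dyadic time is eventually covered. *)
Definition grid_crossings f a b n : nat :=
  crossings a b (fun i => f (i%:R / 2 ^+ n)) (4 ^ n).+1.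

Lemma dyadic_truncn r : dyadic r ->
  \forall n \near \oo, (Num.truncn (r * 2 ^+ n))%:R / 2 ^+ n = r.
Proof.
move=> [N [i ->]]; near=> n.
have Nn : (N <= n)%N by near: n; exact: nbhs_infty_ge.
have -> : i%:R / 2 ^+ N * 2 ^+ n = (i * 2 ^ (n - N))%:R :> R.
  rewrite -[in LHS](subnKC Nn) exprD mulrA divfK ?lt0r_neq0 ?exp2_gt0//.
  by rewrite natrM natrX.
rewrite natrK natrM natrX -[in X in _ / X](subnKC Nn) exprD.
by rewrite -mulf_div divff ?lt0r_neq0 ?exp2_gt0// mulr1.
Unshelve. all: by end_near. Qed.

Lemma dyadic_crossings_le f a b n r t : r <= t ->
  (dyadic_crossings f a b n r <= dyadic_crossings f a b n t)%N.
Proof.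
move=> rt; apply: leq_crossings; rewrite ltnS; apply: le_truncn.
by rewrite ler_pM2r ?exp2_gt0.
Qed.

Lemma dyadic_crossings_grid f a b t :
  \forall n \near \oo, (dyadic_crossings f a b n t <= grid_crossings f a b n)%N.
Proof.
near=> n; apply: leq_crossings; rewrite ltnS.
have h : t * 2 ^+ n <= (4 ^ n)%:R.
  rewrite natrX (_ : 4%:R = 2 * 2); last by rewrite -natrM.
  rewrite exprMn ler_pM2r ?exp2_gt0//.
  apply: (@le_trans _ _ n%:R).
    by near: n; exact: nbhs_infty_ger.
  by rewrite -natrX ler_nat ltnW// ltn_expl.
by have := le_truncn h; rewrite natrK.
Unshelve. all: by end_near. Qed.

Lemma dyadic_crossings_up f a b r t : a < b -> dyadic r -> dyadic t -> r < t ->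
  f r <= a -> b <= f t ->
  \forall n \near \oo, (dyadic_crossings f a b n r < dyadic_crossings f a b n t)%N.
Proof.
move=> ab dr dt rt fr ft; near=> n.
have hr : (Num.truncn (r * 2 ^+ n))%:R / 2 ^+ n = r by near: n; exact: dyadic_truncn.
have ht : (Num.truncn (t * 2 ^+ n))%:R / 2 ^+ n = t by near: n; exact: dyadic_truncn.
apply: crossings_up => //; rewrite ?hr ?ht//.
by rewrite -(ltr_nat R) -(@ltr_pM2r _ (2 ^+ n)^-1) ?invr_gt0 ?exp2_gt0// hr ht.
Unshelve. all: by end_near. Qed.

Lemma dyadic_crossings_exceed f a b t : a < b -> dyadic t -> b <= f t ->
  \forall n \near \oo, (0 < grid_crossings f a b n)%N.
Proof.
move=> ab dt ft; near=> n.
have ht : (Num.truncn (t * 2 ^+ n))%:R / 2 ^+ n = t by near: n; exact: dyadic_truncn.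
apply: (@leq_trans (dyadic_crossings f a b n t)).
  by apply: crossings_exceed => //; rewrite ht.
by near: n; exact: dyadic_crossings_grid.
Unshelve. all: by end_near. Qed.

Definition frequently (F : set_system R) (A : set R) :=
  forall B, F B -> exists x, B x /\ A x.

(** A bound along infinitely many grids is what a finite lower limit of the counts provides, and it
    already excludes counts that eventually exceed every bound. *)
Definition finite_crossings f a b :=
  exists k, forall n0, exists2 n, (n0 <= n)%N & (grid_crossings f a b n <= k)%N.

Lemma finite_crossings_contra f a b (t : R) : finite_crossings f a b ->
  ~ (forall k, exists t, \forall n \near \oo, (k <= dyadic_crossings f a b n t)%N).
Proof.
move=> [k hk] /(_ k.+1)[s hs].
have : \forall n \near \oo, (k < grid_crossings f a b n)%N.
  near=> n; apply: (@leq_trans (dyadic_crossings f a b n s)).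
    by near: n.
  by near: n; exact: dyadic_crossings_grid.
move=> [N _ hN]; have [n Nn] := hk N.
by rewrite leqNgt hN.
Unshelve. all: by end_near. Qed.

(** Values above [b] and below [a] are picked alternately while approaching [t] from the right. Each
    pair, read in the order of time, is an upcrossing visible on all fine grids, so the counts are
    unbounded. *)
Lemma no_oscillation_right f a b t : a < b -> 0 <= t -> finite_crossings f a b ->
  ~ (frequently (dyadic_right t) [set r | f r <= a] /\
     frequently (dyadic_right t) [set r | b <= f r]).
Proof.
move=> ab t0 fc [fa fb]; apply: (finite_crossings_contra t fc).
have nb s : t < s -> dyadic_right t [set r | dyadic r /\ t < r < s].
  move=> ts; apply/dyadic_rightP; exists (s - t); first by rewrite subr_gt0.
  by move=> r dr tr; rewrite addrC subrK => rs; split => //; rewrite tr rs.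
(* [p] lies between [t] and all the pairs chosen so far, and [k] upcrossings separate it from [s];
   the next pairs are sought to its left. *)
suff H k : forall s, t < s -> exists p, [/\ dyadic p, t < p &
    \forall n \near \oo, (dyadic_crossings f a b n p + k <= dyadic_crossings f a b n s)%N].
  move=> k; exists (t + 1).
  have [p [_ _ hp]] := H k (t + 1) ltac:(lra).
  by apply: filterS hp => n; apply: leq_trans; rewrite leq_addl.
elim: k => [|k IH] s ts.
  have [p [[dp /andP[tp ps]] _]] := fa _ (nb _ ts).
  exists p; split => //; near=> n.
  by rewrite addn0 dyadic_crossings_le// ltW.
have [j [[dj /andP[tj js]] fj]] := fb _ (nb _ ts).
have [i [[di /andP[ti ij]] fi]] := fa _ (nb _ tj).
have [p [dp tp hp]] := IH _ ti.
exists p; split => //; near=> n.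
rewrite addnS; apply: (@leq_ltn_trans (dyadic_crossings f a b n i)).
  by near: n.
apply: (@leq_trans (dyadic_crossings f a b n j)).
  by near: n; exact: dyadic_crossings_up.
by apply: dyadic_crossings_le; exact: ltW.
Unshelve. all: by end_near. Qed.

(** From the left the pairs are chosen forward in time, so it is enough to count the crossings up to
    the current point. *)
Lemma no_oscillation_left f a b t : a < b -> 0 < t -> finite_crossings f a b ->
  ~ (frequently (dyadic_left t) [set r | f r <= a] /\
     frequently (dyadic_left t) [set r | b <= f r]).
Proof.
move=> ab t0 fc [fa fb]; apply: (finite_crossings_contra t fc).
have nb s : s < t -> dyadic_left t [set r | dyadic r /\ s < r < t].
  move=> st; apply/dyadic_leftP; exists (t - s); first by rewrite subr_gt0.
  by move=> r dr; rewrite subKr => sr rt; split => //; rewrite sr rt.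
suff H k : exists p, [/\ dyadic p, p < t &
    \forall n \near \oo, (k <= dyadic_crossings f a b n p)%N].
  by move=> k; have [p [_ _ hp]] := H k; exists p.
elim: k => [|k [p [dp pt hp]]].
  have [p [[dp /andP[sp pt]] _]] := fa _ (nb (t - 1) ltac:(lra)).
  by exists p; split => //; near=> n.
have [i [[di /andP[pi it]] fi]] := fa _ (nb _ pt).
have [j [[dj /andP[ij jt]] fj]] := fb _ (nb _ it).
exists j; split => //; near=> n.
apply: (@leq_ltn_trans (dyadic_crossings f a b n i)).
  apply: (@leq_trans (dyadic_crossings f a b n p)); first by near: n.
  by apply: dyadic_crossings_le; exact: ltW.
by near: n; exact: dyadic_crossings_up.
Unshelve. all: by end_near. Qed.

(** Boundedness gives a cluster point. Two distinct ones would be separated by two rationals,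
    between which the values would oscillate; a unique cluster point in a compact set is a limit. *)
Lemma cvg_no_oscillation (F : set_system R) f (u : R) : ProperFilter F ->
  F [set x | 0 <= f x <= u] ->
  (forall p q : rat, 0 <= ratr p :> R -> ratr p < ratr q :> R ->
    ~ (frequently F [set x | f x <= ratr p] /\
       frequently F [set x | ratr q <= f x])) ->
  cvg (f @ F).
Proof.
move=> PF Fu osc.
have FfF : ProperFilter (f @ F) by exact: fmap_proper_filter.
have FV : (f @ F) `[0, u]%classic.
  apply: (@filterS _ F _ _ _ _ Fu) => x h.
  by rewrite /preimage /= in_itv /=.
have [l [lV cl]] := @segment_compact R 0 u _ FfF FV.
have ord p q : cluster (f @ F) p -> cluster (f @ F) q -> p < q -> False.
  move=> cp cq pq.
  have [y] := rat_in_itvoo pq; rewrite in_itv /= => /andP[py yq].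
  have [x] := rat_in_itvoo py; rewrite in_itv /= => /andP[px xy].
  have fx : frequently F [set r | f r <= ratr x].
    move=> B FB; have FB' : (f @ F) (f @` B).
      by apply: (@filterS _ F _ _ _ _ FB) => r Br; exists r.
    have nx : nbhs p [set z : R | z < ratr x] by exact: lt_nbhsl.
    have [z [[r Br <-] /= zx]] := cp _ _ FB' nx.
    by exists r; split => //; exact: ltW.
  have fy : frequently F [set r | ratr y <= f r].
    move=> B FB; have FB' : (f @ F) (f @` B).
      by apply: (@filterS _ F _ _ _ _ FB) => r Br; exists r.
    have nx : nbhs q [set z : R | ratr y < z] by exact: lt_nbhsr.
    have [z [[r Br <-] /= zx]] := cq _ _ FB' nx.
    by exists r; split => //; exact: ltW.
  apply: (osc x y _ xy) => //.
  by have [r [/= /andP[r0 _] rx]] := fx _ Fu; exact: le_trans rx.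
apply/cvg_ex; exists l.
(* The segment is enlarged to be a neighbourhood of [l], which may be an end point of [[0, u]]. *)
apply: (@compact_cluster_set1 _ _ _ `[0 - 1, u + 1]%classic) => //.
- exact: segment_compact.
- move: lV; rewrite /= in_itv /= => /andP[l0 lu].
  have : nbhs l `]0 - 1, u + 1[%classic.
    by apply: near_in_itvoo; rewrite in_itv/=; apply/andP; split; lra.
  by apply: filterS; apply: subset_itv; rewrite bnd_simp.
- apply: (@filterS _ F _ _ _ _ FV) => x; rewrite /preimage /= !in_itv /=.
  by move=> /andP[? ?]; apply/andP; split; lra.
- apply/seteqP; split => [q cq|q -> //].
  by apply/eqP/negPn/negP => /lt_total/orP[]; [exact: ord|exact: ord].
Qed.

(** Only rational levels occur, so that countably many almost sure properties make a path
    regular. *)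
Definition regular_path f :=
  (forall p q : rat, 0 <= ratr p :> R -> ratr p < ratr q :> R ->
     finite_crossings f (ratr p) (ratr q)) /\
  (exists u, forall r, dyadic r -> 0 <= f r <= u).

Definition right_regularization f t : R := lim (f @ dyadic_right t).

Section regular.
Variable f : R -> R.
Hypothesis rf : regular_path f.

Let bounded_right t : 0 <= t -> exists u, dyadic_right t [set x | 0 <= f x <= u].
Proof.
move=> t0; have [_ [u hu]] := rf; exists u; apply/dyadic_rightP; exists 1 => //.
by move=> r dr _ _; exact: hu.
Qed.

Lemma cvg_dyadic_right t : 0 <= t -> f @ dyadic_right t --> right_regularization f t.
Proof.
move=> t0; have [u hu] := bounded_right t0.
have PF := dyadic_right_proper t0.
apply: (cvg_no_oscillation PF hu) => p q p0 pq.
by apply: no_oscillation_right => //; exact: rf.1.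
Qed.

Lemma cvg_dyadic_left t : 0 < t -> cvg (f @ dyadic_left t).
Proof.
move=> t0; have [u hu] : exists u, dyadic_left t [set x | 0 <= f x <= u].
  have [_ [u hu]] := rf; exists u; apply/dyadic_leftP; exists 1 => //.
  by move=> r dr _ _; exact: hu.
have PF := dyadic_left_proper t0.
apply: (cvg_no_oscillation PF hu) => p q p0 pq.
by apply: no_oscillation_left => //; exact: rf.1.
Qed.

Lemma cvg_dyadic_above t : 0 <= t ->
  f (dyadic_above n t) @[n --> \oo] --> right_regularization f t.
Proof.
move=> t0 A nA; exact: (dyadic_above_right t0 (cvg_dyadic_right t0 nA)).
Qed.

(** The dyadic limit at [t] sees only points of []t, s[], and the distance to [l] is continuous.
    Both the right-continuity and the left limits of the regularization come from this estimate. *)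
Lemma right_regularization_dist t l (e : R) s : 0 <= t -> t < s ->
  (forall r, dyadic r -> t < r -> r < s -> `|l - f r| <= e) ->
  `|l - right_regularization f t| <= e.
Proof.
move=> t0 ts h.
have PF := dyadic_right_proper t0.
have c : `|l - f r| @[r --> dyadic_right t] --> `|l - right_regularization f t|.
  by apply: cvg_norm; apply: cvgB; [exact: cvg_cst|exact: cvg_dyadic_right].
apply: (@closed_cvg _ _ _ PF (fun r => `|l - f r|) [set x | x <= e] _ _ _ c).
  exact: closed_le.
apply/dyadic_rightP; exists (s - t); first by rewrite subr_gt0.
by move=> r dr tr rs; apply: h => //; lra.
Qed.

Lemma right_regularization_right t : 0 <= t ->
  right_regularization f @ t^'+ --> right_regularization f t.
Proof.
move=> t0; apply/cvgrPdist_le => e e0.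
have /cvgrPdist_le/(_ _ e0)/dyadic_rightP[d d0 h] := cvg_dyadic_right t0.
near=> s.
have ts : t < s by near: s; exact: nbhs_right_gt.
have sd : s < t + d by near: s; apply: nbhs_right_lt; lra.
apply: (@right_regularization_dist s _ _ (t + d)) => //; first lra.
by move=> r dr sr rd; apply: h => //; lra.
Unshelve. all: by end_near. Qed.

Lemma right_regularization_left t : 0 < t ->
  cvg (right_regularization f @ t^'-).
Proof.
move=> t0; have /cvg_ex[l cl] := cvg_dyadic_left t0.
apply/cvg_ex; exists l; apply/cvgrPdist_le => e e0.
have /cvgrPdist_le/(_ _ e0)/dyadic_leftP[d d0 h] := cl.
near=> s.
have ts : s < t by near: s; exact: nbhs_left_lt.
have sd : t - d < s by near: s; apply: nbhs_left_gt; lra.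
have s0 : 0 < s by near: s; exact: nbhs_left_gt.
apply: (@right_regularization_dist s _ _ t) => //; first lra.
by move=> r dr sr rd; apply: h => //; lra.
Unshelve. all: by end_near. Qed.

End regular.
End dyadic_paths.

(** * Countable families of almost sure properties, and lower limits *)

Section almost_everywhere.
Context {d : measure_display} {T : measurableType d} {R : realType}.

Lemma ae_forall_countable (mu : {measure set T -> \bar R}) (I : countType)
  (Q : I -> T -> Prop) : (forall i, {ae mu, forall x, Q i x}) ->
  {ae mu, forall x, forall i, Q i x}.
Proof.
move=> h.
have : {ae mu, forall x, forall n, if @unpickle I n is Some i then Q i x else True}.
  by apply: ae_foralln => n; case: unpickle => [i|]; [exact: h|exact: aeW].
by apply: filterS => x hx i; have := hx (pickle i); rewrite pickleK.
Qed.

Lemma limn_einf_ge (u : (\bar R)^nat) (c : \bar R) :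
  (\forall n \near \oo, (c <= u n)%E) -> (c <= limn_einf u)%E.
Proof.
move=> [N _ hN]; rewrite limn_einf_lim; apply: lime_ge; first exact: is_cvg_einfs.
exists N => // n /= Nn; apply: le_ereal_inf_tmp => _ [m /= nm <-].
by apply: hN => /=; exact: leq_trans nm.
Qed.

Lemma measurable_fun_limn_einf (D : set T) (f : (T -> \bar R)^nat) :
  (forall n, measurable_fun D (f n)) ->
  measurable_fun D (fun x => limn_einf (f ^~ x)).
Proof.
move=> mf; rewrite (_ : (fun _ => _) =
    fun x => (- limn_esup (fun n => - f n x))%E).
  apply: measurableT_comp => //; apply: measurable_fun_limn_esup => n.
  exact: measurableT_comp.
by apply/funext => x; rewrite -limn_einfN; congr limn_einf; apply/funext => n /=;
  rewrite oppeK.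
Qed.

End almost_everywhere.

(** * Cadlag versions of the conditional expectations of a decreasing family *)

Section regularization.
Context {d : measure_display} {Omega : measurableType d} {R : realType}.
Variables (P : probability Omega R) (F : R -> set (set Omega)).
Hypothesis sF : standing_filtration P F.

Let FT t := g_sigma_algebraType (F t).

Lemma filtration_sigma t : 0 <= t -> sigma_algebra setT (F t).
Proof. by case: sF => -[h _] _ _ _ /h. Qed.

Lemma filtration_sub t : 0 <= t -> F t `<=` measurable.
Proof. by case: sF => -[_ [h _]] _ _ _ /h. Qed.

Lemma filtration_le s t : 0 <= s -> s <= t -> F s `<=` F t.
Proof. by case: sF => -[_ [_ h]] _ _ _; exact: h. Qed.

Lemma filtration_null t (N : set Omega) : 0 <= t -> P.-negligible N -> F t N.
Proof.
move=> t0 [A [mA A0 NA]]; case: sF => _ h _ _.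
by apply: (filtration_le (lexx 0) t0); apply: h; exists A.
Qed.

Lemma filtrationC t (A : set Omega) : 0 <= t -> F t A -> F t (~` A).
Proof. by move=> t0 FA; rewrite -setTD; have [_ + _] := filtration_sigma t0; exact. Qed.

Lemma filtration_ae t (A : set Omega) : 0 <= t -> {ae P, forall w, A w} -> F t A.
Proof.
by move=> t0 h; rewrite -(setCK A); apply: filtrationC => //; exact: filtration_null.
Qed.

Lemma filtration_right t (A : set Omega) : 0 <= t ->
  (forall s, t < s -> F s A) -> F t A.
Proof. by move=> t0 h; case: sF => _ _ [hr _] _; rewrite hr// => s /=; exact: h. Qed.

Definition adapted (X : process Omega R) :=
  forall t, 0 <= t -> measurable_fun setT (X t : FT t -> R).

Lemma measurable_fun_filtration_le s t (f : Omega -> R) : 0 <= s -> s <= t ->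
  measurable_fun setT (f : FT s -> R) -> measurable_fun setT (f : FT t -> R).
Proof.
move=> s0 st mf _ B mB; have := mf measurableT B mB.
rewrite !sub_measurableE; try exact: filtration_sigma (le_trans s0 st).
  exact: filtration_le.
exact: filtration_sigma.
Qed.

Lemma measurable_fun_filtration t (f : Omega -> R) : 0 <= t ->
  measurable_fun setT (f : FT t -> R) -> measurable_fun setT f.
Proof.
by move=> t0; apply: sub_measurable_fun; [exact: filtration_sigma|exact: filtration_sub].
Qed.

Variable tau : R -> Omega -> \bar R.
Local Open Scope ereal_scope.
Hypothesis mtau : forall t, (0 <= t)%R -> measurable_fun setT (tau t).
Hypothesis tau0 : forall t w, 0 <= tau t w.
Hypothesis tau_le : forall s t w, (0 <= s)%R -> (s <= t)%R -> tau t w <= tau s w.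
Hypothesis tau_fin : \int[P]_w tau 0%R w < +oo.
Hypothesis tau_cvg : forall t w, (0 <= t)%R ->
  tau (dyadic_above n t) w @[n --> \oo] --> tau t w.

(** Conditional expectations of [tau t] given [F t], with no regularity in [t]. [tau] abstracts the
    tail integral of a nonnegative process; since it decreases in [t], [M] is a supermartingale. *)
Definition versions (M : process Omega R) :=
  [/\ adapted M, (forall t w, 0 <= M t w)%R &
    forall t A, (0 <= t)%R -> F t A ->
      \int[P]_(w in A) (M t w)%:E = \int[P]_(w in A) tau t w].

Lemma versions_exist : exists M, versions M.
Proof.
have h t : exists Y : Omega -> R, (forall w, 0 <= Y w)%R /\ ((0 <= t)%R ->
    measurable_fun setT (Y : FT t -> R) /\ forall A, F t A ->
      \int[P]_(w in A) (Y w)%:E = \int[P]_(w in A) tau t w).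
  (* Only nonnegativity is asked at negative times, where the value is 0. *)
  have [t0|t0] := leP 0%R t; last first.
    by exists (fun=> 0%R); split.
  have [|Y [mY Y0 YE _]] := condexp_exists (filtration_sigma t0) (@filtration_sub _ t0) (mu := P)
    (mtau t0) (tau0 t).
    apply: le_lt_trans tau_fin; apply: ge0_le_integral => //; try exact: mtau.
    by move=> w _; exact: tau_le.
  by exists Y.
have [M hM] := choice h.
exists M; split => [t t0|t w|t A t0 FA].
- exact: ((hM t).2 t0).1.
- exact: (hM t).1.
- exact: ((hM t).2 t0).2.
Qed.

Section path_regularity.
Variable M : process Omega R.
Hypothesis hM : versions M.

Let mM t : (0 <= t)%R -> measurable_fun setT (M t).
Proof. by move=> t0; apply: (measurable_fun_filtration t0); case: hM => h _ _; exact: h. Qed.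

Let pos_grid n i : (0 <= i%:R / 2 ^+ n :> R)%R.
Proof. by rewrite divr_ge0// ltW// exp2_gt0. Qed.

Let grid_le n i : (i%:R / 2 ^+ n <= i.+1%:R / 2 ^+ n :> R)%R.
Proof. by rewrite ler_pM2r ?invr_gt0 ?exp2_gt0// ler_nat. Qed.

Lemma grid_crossings_measurable a b n : (0 <= a)%R -> (a <= b)%R ->
  measurable_fun setT (fun w => (grid_crossings (M ^~ w) a b n)%:R : R).
Proof.
move=> a0 ab; have [aM M0 _] := hM.
apply: (@crossings_measurable _ _ _ (fun i => F (i%:R / 2 ^+ n)%R) _ _ _
  (fun i => M (i%:R / 2 ^+ n))%R).
- by move=> i; exact: filtration_sigma.
- by move=> i; exact: filtration_sub.
- by move=> i; exact: filtration_le.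
- by move=> i; exact: aM.
Qed.

Lemma grid_upcrossing a b n : (0 <= a)%R -> (a <= b)%R ->
  \int[P]_w ((b - a) * (grid_crossings (M ^~ w) a b n)%:R)%:E <= \int[P]_w tau 0%R w.
Proof.
move=> a0 ab; have [aM M0 eM] := hM.
rewrite -(eM 0%R setT)//; last exact: (filtration_ae (lexx 0%R) (aeW P (fun=> I))).
have -> : M 0%R = M (0%:R / 2 ^+ n)%R by rewrite mul0r.
apply: (@upcrossing _ _ _ P (fun i => F (i%:R / 2 ^+ n)%R) _ _ _
  (fun i => M (i%:R / 2 ^+ n))%R) => //.
- by move=> i; exact: filtration_sigma.
- by move=> i; exact: filtration_sub.
- by move=> i; exact: filtration_le.
- by move=> i; exact: aM.
- move=> i A FA; rewrite !eM//; last exact: filtration_le FA.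
  have mA : measurable A by exact: filtration_sub FA.
  apply: ge0_le_integral => //; try exact/measurable_funTS/mtau.
  by move=> w _; exact: tau_le.
Qed.

(** The lower limit, along the grids, of the booked profit; by Fatou its expectation is at most that
    of [tau 0]. *)
Let L a b w := limn_einf (fun n => ((b - a) * (grid_crossings (M ^~ w) a b n)%:R)%:E).

Let Lge0 a b w : (a <= b)%R -> 0 <= L a b w.
Proof.
move=> ab; apply: limn_einf_ge; near=> n.
by rewrite lee_fin mulr_ge0// subr_ge0.
Unshelve. all: by end_near. Qed.

Let mL a b : (0 <= a)%R -> (a <= b)%R -> measurable_fun setT (L a b).
Proof.
move=> a0 ab; apply: measurable_fun_limn_einf => n.
apply/measurable_EFinP; apply: measurable_funM => //.
exact: grid_crossings_measurable.
Qed.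

Let iL a b : (0 <= a)%R -> (a <= b)%R -> \int[P]_w L a b w <= \int[P]_w tau 0%R w.
Proof.
move=> a0 ab; apply: le_trans.
  apply: fatou => //.
  - move=> n; apply/measurable_EFinP; apply: measurable_funM => //.
    exact: grid_crossings_measurable.
  - by move=> n w _; rewrite lee_fin mulr_ge0// subr_ge0.
rewrite limn_einf_lim; apply: lime_le; first exact: is_cvg_einfs.
near=> n; apply: (@le_trans _ _ (\int[P]_w ((b - a) * (grid_crossings (M ^~ w) a b n)%:R)%:E)).
  by apply: ereal_inf_lbound; exists n => /=.
exact: grid_upcrossing.
Unshelve. all: by end_near. Qed.

(** [L a b] is integrable, hence finite almost surely; on a path without [finite_crossings] the
    counts tend to infinity and [L a b] is infinite. *)
Lemma ae_finite_crossings a b : (0 <= a)%R -> (a < b)%R ->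
  {ae P, forall w, finite_crossings (M ^~ w) a b}.
Proof.
move=> a0 ab.
have iLab : P.-integrable setT (L a b).
  apply/integrableP; split; first exact: mL (ltW ab).
  under eq_integral do rewrite gee0_abs ?Lge0 ?(ltW ab)//.
  by apply: le_lt_trans tau_fin; apply: iL => //; exact: ltW.
have := integrable_ae measurableT iLab.
apply: filterS => w /(_ I) Lfin; apply: contrapT => nfc.
suff : L a b w = +oo by move=> h; rewrite h in Lfin.
apply/eqyP => A A0.
have ba0 : (0 < b - a)%R by rewrite subr_gt0.
pose k := Num.truncn (A / (b - a))%R.
have [n0 hn0] : exists n0, forall n, (n0 <= n)%N -> (k < grid_crossings (M ^~ w) a b n)%N.
  apply: contrapT => h; apply: nfc; exists k => n0; apply: contrapT => h2.
  apply: h; exists n0 => n n0n; rewrite ltnNge; apply/negP => h3.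
  by apply: h2; exists n.
apply: limn_einf_ge; exists n0 => // n /= n0n; rewrite lee_fin mulrC -ler_pdivrMr//.
apply: (@le_trans _ _ k.+1%:R)%R; last by rewrite ler_nat hn0.
have A1 : (0 <= A / (b - a))%R by rewrite divr_ge0// ltW.
by have /andP[_ /ltW] := truncn_itv A1.
Qed.

(** The levels are 0 and [m]: a path that reaches [m] at a dyadic time has a crossing on all fine
    grids, so [L 0 m >= m] there. By Markov's inequality the probability of this is at most the
    expectation of [tau 0] divided by [m], and an unbounded path has the property for every [m]. *)
Lemma ae_bounded : {ae P, forall w, exists u, forall r, dyadic r -> (0 <= M r w <= u)%R}.
Proof.
have [aM M0 eM] := hM.
pose B m := [set w | m%:R%:E <= L 0 m%:R w].
have mB m : measurable (B m).
  rewrite -[B m]setTI; apply: emeasurable_fun_c_infty => //.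
  by apply: mL.
have PB m : m%:R%:E * P (B m) <= \int[P]_w tau 0%R w.
  rewrite -integral_cst//.
  apply: (@le_trans _ _ (\int[P]_(w in B m) L 0 m%:R w)).
    apply: ge0_le_integral => //.
    - by move=> w _; rewrite lee_fin.
    - by apply: measurable_funTS; exact: mL.
  apply: le_trans (iL (lexx 0%R) (ler0n R m)).
  apply: ge0_subset_integral => //; first exact: mL.
  by move=> w _; exact: Lge0.
exists (\bigcap_m B m); split; first exact: bigcapT_measurable.
  apply/eqP; rewrite eq_le measure_ge0 andbT.
  have Pfin : P (\bigcap_m B m) \is a fin_num.
    by apply: fin_num_measure; exact: bigcapT_measurable.
  have Kfin : \int[P]_w tau 0%R w \is a fin_num.
    by rewrite ge0_fin_numE//; exact: integral_ge0.
  rewrite -(fineK Pfin) lee_fin leNgt; apply/negP => p0.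
  set p := fine _ in p0.
  pose K := fine (\int[P]_w tau 0%R w).
  have K0 : (0 <= K)%R by apply: fine_ge0; exact: integral_ge0.
  (* If [p > 0], an integer above [K / p] contradicts the Markov bound. *)
  have /(_ (Num.truncn (K / p)).+1) := PB.
  rewrite leNgt => /negP; apply.
  rewrite -(fineK Kfin) -/K.
  apply: (@lt_le_trans _ _ ((Num.truncn (K / p)).+1%:R * p)%:E).
    rewrite lte_fin -ltr_pdivrMr//.
    have Kp : (0 <= K / p)%R by rewrite divr_ge0// ltW.
    by have /andP[_] := truncn_itv Kp.
  rewrite EFinM; apply: lee_wpmul2l; first by rewrite lee_fin.
  rewrite /p fineK//; apply: le_measure; rewrite ?inE//.
    exact: bigcapT_measurable.
  exact: bigcap_inf.
move=> w /= nb m _; rewrite /B/=.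
case: m => [|m]; first exact: Lge0.
have [r [dr hr]] : exists r, dyadic r /\ (m.+1%:R <= M r w)%R.
  apply: contrapT => h; apply: nb; exists m.+1%:R => r dr; rewrite M0/=.
  by rewrite leNgt; apply/negP => h2; apply: h; exists r; split => //; exact: ltW.
have m0 : (0 < m.+1%:R :> R)%R by rewrite ltr0n.
apply: limn_einf_ge; near=> n.
rewrite lee_fin subr0 ler_peMr// ler1n.
by near: n; exact: (dyadic_crossings_exceed m0 dr hr).
Unshelve. all: by end_near. Qed.

Lemma ae_regular : {ae P, forall w, regular_path (M ^~ w)}.
Proof.
have h1 : {ae P, forall w, forall pq : rat * rat, (0 <= ratr pq.1 :> R)%R ->
    (ratr pq.1 < ratr pq.2 :> R)%R -> finite_crossings (M ^~ w) (ratr pq.1) (ratr pq.2)}.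
  apply: ae_forall_countable => -[p q] /=.
  have [p0|p0] := boolP (0 <= ratr p :> R)%R; last exact: aeW.
  have [pq|pq] := boolP (ratr p < ratr q :> R)%R; last exact: aeW.
  by apply: filterS (ae_finite_crossings p0 pq) => w h _ _.
apply: filterS2 h1 ae_bounded => w h1 h2; split => // p q p0 pq.
exact: (h1 (p, q)).
Qed.

End path_regularity.

(** By completeness the set [O] of regular paths lies in every [F t] with [t >= 0], so setting [M]
    to 0 off [O] keeps it an adapted version. Then every path of [V], not just almost every one, is
    cadlag. *)
Lemma regular_versions : exists N V : process Omega R,
  [/\ versions N, cadlag V, (forall t w, (0 <= V t w)%R) &
    forall t w, (0 <= t)%R -> N (dyadic_above n t) w @[n --> \oo] --> V t w].
Proof.
have [M hM] := versions_exist; have [aM M0 eM] := hM.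
pose O := [set w | regular_path (M ^~ w)].
have FO t : (0 <= t)%R -> F t O.
  by move=> t0; apply: filtration_ae => //; exact: ae_regular.
have mO : measurable O by apply: (filtration_sub (lexx 0%R)); exact: FO.
pose N t w := if `[<O w>] then M t w else 0%R.
pose V t w := if `[<0 <= t>]%R && `[<O w>] then right_regularization (M ^~ w) t else 0%R.
have N0 t w : (0 <= N t w)%R by rewrite /N; case: ifP.
have NV t w : (0 <= t)%R -> N (dyadic_above n t) w @[n --> \oo] --> V t w.
  move=> t0; rewrite /N /V (asboolT t0) andTb.
  have [Ow|Ow] := pselect (O w); last by rewrite (asboolF Ow); exact: cvg_cst.
  by rewrite (asboolT Ow); exact: cvg_dyadic_above.
exists N, V; split => //.
- split => // [t t0|t A t0 FA].
    have sFt := filtration_sigma t0.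
    apply: measurable_fun_ifT => //; last exact: aM.
    apply: (measurable_fun_bool true) => //.
    rewrite setTI (_ : _ @^-1` _ = O); first by rewrite sub_measurableE//; exact: FO.
    by apply/seteqP; split => w /= /asboolP.
  rewrite -eM//; have mA : measurable A by apply: filtration_sub FA.
  have mMt : measurable_fun setT (M t) by apply: (measurable_fun_filtration t0); exact: aM.
  apply: ge0_ae_eq_integral => //.
  + apply/measurable_EFinP/measurable_funTS; apply: measurable_fun_ifT => //.
    apply: (measurable_fun_bool true) => //.
    rewrite setTI (_ : _ @^-1` _ = O)//.
    by apply/seteqP; split => w /= /asboolP.
  + exact/measurable_EFinP/measurable_funTS.
  + by move=> w _; rewrite lee_fin.
  + by move=> w _; rewrite lee_fin.
  + by apply: filterS (ae_regular hM) => w Ow _; rewrite /N asboolT.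
- move=> w; have [Ow|Ow] := pselect (O w); last first.
    have V00 t : V t w = 0%R by rewrite /V [X in _ && X]asboolF// andbF.
    have -> : V ^~ w = fun=> 0%R by exact/funext.
    by split => t _; [rewrite V00; exact: cvg_cst|exact: is_cvg_cst].
  have VE t : (0 <= t)%R -> V t w = right_regularization (M ^~ w) t.
    by move=> t0; rewrite /V !asboolT.
  split => t t0.
    rewrite VE//; apply: cvg_trans (right_regularization_right Ow t0).
    apply: near_eq_cvg; near=> s; rewrite VE//.
    by apply: (le_trans t0); apply: ltW; near: s; exact: nbhs_right_gt.
  have /cvg_ex[l cl] := right_regularization_left Ow t0.
  apply/cvg_ex; exists l; apply: cvg_trans cl.
  apply: near_eq_cvg; near=> s; rewrite VE//.
  by apply: ltW; near: s; exact: nbhs_left_gt.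
- move=> t w; have [t0|t0] := leP 0%R t; last first.
    by rewrite /V asboolF//; apply/negP; rewrite -ltNge.
  apply: (@closed_cvg _ _ _ _ (fun n => N (dyadic_above n t) w) [set x | 0 <= x]%R _ _ _ (NV t w t0)).
    exact: closed_ge.
  by near=> n; exact: N0.
Unshelve. all: by end_near. Qed.

(** [V t] is a limit of variables that are eventually [F s]-measurable, for each [s > t], and
    right-continuity of the filtration makes it [F t]-measurable. For its integrals one inequality
    is Fatou's; the other goes through truncation, as no common bound for the approximations is at
    hand. *)
Lemma regularization : exists V : process Omega R,
  [/\ versions V & cadlag V].
Proof.
have [N [V [hN cV V0 NV]]] := regular_versions; have [aN N0 eN] := hN.
have da0 n t : (0 <= t)%R -> (0 <= dyadic_above n t :> R)%R.
  by move=> _; exact/dyadic_ge0/dyadic_dyadic_above.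
have da_gt n t : (0 <= t)%R -> (t < dyadic_above n t :> R)%R.
  by move=> t0; have /andP[] := dyadic_above_itv n t0.
have aV : adapted V.
  move=> t t0 _ B mB; rewrite sub_measurableE; last exact: filtration_sigma.
  apply: filtration_right => // s ts.
  have s0 : (0 <= s)%R by exact: le_trans (ltW ts).
  suff : measurable_fun setT (V t : FT s -> R).
    by move=> /(_ measurableT B mB); rewrite sub_measurableE//; exact: filtration_sigma.
  (* Terms sampled after [s], which need not be [F s]-measurable, are replaced by 0; they concern
     finitely many [n] only. *)
  apply: (@measurable_fun_cvg _ _ _ _
    (fun n (w : FT s) => if (dyadic_above n t <= s)%R then N (dyadic_above n t) w else 0%R)).
    move=> n; case: leP => // h.
    by apply: (measurable_fun_filtration_le (da0 n t t0) h); exact: aN (da0 n t t0).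
  move=> w _; apply: cvg_trans (NV t w t0); apply: near_eq_cvg; near=> n.
  rewrite ifT//; have /andP[_ h] := dyadic_above_itv n t0.
  apply: (le_trans h); rewrite -lerBrDl; apply: ltW; near: n.
  by apply: near_exp2V; rewrite subr_gt0.
exists V; split => //; split => // t A t0 FA.
have mA : measurable A by apply: filtration_sub FA.
have mV : measurable_fun setT (V t) by apply: (measurable_fun_filtration t0); exact: aV.
have mN n : measurable_fun setT (N (dyadic_above n t)).
  by apply: (measurable_fun_filtration (da0 n t t0)); exact: aN (da0 n t t0).
have FAn n : F (dyadic_above n t) A.
  by apply: (filtration_le t0 (ltW (da_gt n t t0))).
(* First the upper bound: Fatou along the dyadic times, then the monotonicity of [tau]. *)
apply: le_anti; apply/andP; split.
  have -> : \int[P]_(w in A) (V t w)%:E =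
      \int[P]_(w in A) limn_einf (fun n => (N (dyadic_above n t) w)%:E).
    apply: eq_integral => w _.
    have c : (N (dyadic_above n t) w)%:E @[n --> \oo] --> (V t w)%:E.
      by apply: cvg_EFin; [near=> n|exact: NV].
    by rewrite (cvg_limn_einf_sup c).1.
  apply: le_trans.
    apply: fatou => //.
    - by move=> n; exact/measurable_EFinP/measurable_funTS.
    - by move=> n w _; rewrite lee_fin.
  rewrite limn_einf_lim; apply: lime_le; first exact: is_cvg_einfs.
  near=> n; apply: (@le_trans _ _ (\int[P]_(w in A) (N (dyadic_above n t) w)%:E)).
    by apply: ereal_inf_lbound; exists n => /=.
  rewrite eN//; last exact: da0.
  apply: ge0_le_integral => //; try (apply: measurable_funTS; apply: mtau => //; exact: da0).
  by move=> w _; apply: tau_le => //; exact/ltW/da_gt.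
have mtaun n : measurable_fun setT (tau (dyadic_above n t)) by apply/mtau/da0.
have min_fin (x : \bar R) (k : nat) : 0 <= x -> Order.min x k%:R%:E \is a fin_num.
  move=> x0; rewrite ge0_fin_numE; first by rewrite gt_min ltry orbT.
  by rewrite le_min x0 lee_fin ler0n.
have icst (k : nat) : P.-integrable A (fun=> k%:R%:E).
  exact: finite_measure_integrable_cst.
have min_bd (x : \bar R) (k : nat) : 0 <= x -> `|Order.min x k%:R%:E| <= k%:R%:E.
  move=> x0; rewrite gee0_abs; first by rewrite ge_min lexx orbT.
  by rewrite le_min x0 lee_fin ler0n.
have min_cvg (u : (\bar R)^nat) (l : \bar R) (k : nat) : u n @[n --> \oo] --> l ->
    Order.min (u n) k%:R%:E @[n --> \oo] --> Order.min l k%:R%:E.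
  move=> ul; apply: (@continuous2_cvg _ _ _ _ _ _ _ _ Order.min) => //.
    exact: (@min_continuous _ (\bar R) (l, k%:R%:E)).
  exact: cvg_cst.
(* Conditional Jensen inequality for the concave truncation at [k], by hand: on [H], a set of [F r],
   the right side is the integral of [N r]; off [H] it is that of the constant [k]. *)
have trunc_le (n k : nat) :
    \int[P]_(w in A) Order.min (tau (dyadic_above n t) w) k%:R%:E <=
    \int[P]_(w in A) Order.min (N (dyadic_above n t) w)%:E k%:R%:E.
  pose r := dyadic_above n t; have r0 : (0 <= r)%R by exact: da0.
  pose H := [set w | (N r w < k%:R)%R].
  have FH : F r H.
    have : measurable (H : set (FT r)).
      rewrite -[H](@setTI (FT r)); apply: measurable_fun_ltr => //; exact: aN.
    by rewrite sub_measurableE//; exact: filtration_sigma.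
  have FAH B : F r B -> F r (A `&` B).
    move=> FB; have /= sr := sub_measurableE (filtration_sigma r0).
    rewrite -sr; apply: measurableI; rewrite sr//; exact: FAn.
  have mH : measurable H by apply: filtration_sub FH.
  have mmin (f : Omega -> \bar R) D : measurable_fun setT f ->
      measurable_fun D (fun w => Order.min (f w) k%:R%:E).
    by move=> mf; apply: measurable_mine; [exact: measurable_funTS|].
  have split_int (f : Omega -> \bar R) : measurable_fun setT f -> (forall w, 0 <= f w) ->
      \int[P]_(w in A) Order.min (f w) k%:R%:E =
      \int[P]_(w in A `&` H) Order.min (f w) k%:R%:E +
      \int[P]_(w in A `&` ~` H) Order.min (f w) k%:R%:E.
    move=> mf f0; rewrite -[in LHS](setIT A) -(setUv H) setIUr ge0_integral_setU//.
    - exact: measurableI.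
    - by apply: measurableI => //; exact: measurableC.
    - exact: mmin.
    - by move=> w _; rewrite le_min f0 lee_fin ler0n.
    - by apply/disj_setPS; rewrite setIACA setICr setI0.
  rewrite (split_int _ (mtaun n) (tau0 _)).
  rewrite (split_int (fun w => (N r w)%:E)); last 2 first.
  - by apply/measurable_EFinP; exact: mN.
  - by move=> w; rewrite lee_fin.
  apply: leeD.
    have -> : \int[P]_(w in A `&` H) Order.min (N r w)%:E k%:R%:E =
        \int[P]_(w in A `&` H) (N r w)%:E.
      by apply: eq_integral => w /set_mem[_ /= h]; rewrite min_l// lee_fin ltW.
    rewrite eN//; last exact: FAH.
    apply: ge0_le_integral => //.
    + exact: measurableI.
    + by move=> w _; rewrite le_min tau0 lee_fin ler0n.
    + exact: mmin.
    + by apply: measurable_funTS; exact: mtaun.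
    + by move=> w _; rewrite ge_min lexx.
  have -> : \int[P]_(w in A `&` ~` H) Order.min (N r w)%:E k%:R%:E =
      \int[P]_(w in A `&` ~` H) k%:R%:E.
    apply: eq_integral => w /set_mem[_ /= /negP]; rewrite -leNgt => h.
    by rewrite min_r// lee_fin.
  apply: ge0_le_integral => //.
  - by apply: measurableI => //; exact: measurableC.
  - by move=> w _; rewrite le_min tau0 lee_fin ler0n.
  - exact: mmin.
  - by move=> w _; rewrite ge_min lexx orbT.
(* At a fixed level [k] dominated convergence applies to both sides of [trunc_le]; monotone
   convergence in [k] then removes the truncation. *)
have trunc (k : nat) : \int[P]_(w in A) Order.min (tau t w) k%:R%:E <=
    \int[P]_(w in A) (V t w)%:E.
  apply: (@le_trans _ _ (\int[P]_(w in A) Order.min (V t w)%:E k%:R%:E)); last first.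
    apply: ge0_le_integral => //.
    - by move=> w _; rewrite le_min !lee_fin V0 ler0n.
    - apply: measurable_mine => //.
      exact/measurable_EFinP/measurable_funTS.
    - exact/measurable_EFinP/measurable_funTS.
    - by move=> w _; rewrite ge_min lexx.
  have c1 : \int[P]_(w in A) Order.min (tau (dyadic_above n t) w) k%:R%:E @[n --> \oo]
      --> \int[P]_(w in A) Order.min (tau t w) k%:R%:E.
    apply: (@dominated_cvg _ _ _ _ _ mA _ _ (fun=> k%:R%:E)) => //.
    - by move=> n; apply: measurable_mine => //; exact: measurable_funTS.
    - by move=> w _; exact/min_cvg/tau_cvg.
    - by move=> n w _; exact: min_bd.
  have c2 : \int[P]_(w in A) Order.min (N (dyadic_above n t) w)%:E k%:R%:E @[n --> \oo]
      --> \int[P]_(w in A) Order.min (V t w)%:E k%:R%:E.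
    apply: (@dominated_cvg _ _ _ _ _ mA _ _ (fun=> k%:R%:E)) => //.
    - by move=> n; apply: measurable_mine => //; exact/measurable_EFinP/measurable_funTS.
    - by move=> w _; apply: min_cvg; apply: cvg_EFin; [near=> n|exact: NV].
    - by move=> n w _; apply: min_bd; rewrite lee_fin.
  rewrite -(cvg_lim _ c1)// -(cvg_lim _ c2)//.
  apply: lee_lim; [by apply/cvg_ex; eexists; exact: c1|by apply/cvg_ex; eexists; exact: c2|].
  by near=> n; exact: trunc_le.
have c : \int[P]_(w in A) Order.min (tau t w) k%:R%:E @[k --> \oo] -->
    \int[P]_(w in A) tau t w.
  have pc w : Order.min (tau t w) k%:R%:E @[k --> \oo] --> tau t w.
    have := tau0 t w; case: (tau t w) => [x _| _ |//].
      apply: (@cvg_trans _ (x%:E @[k --> \oo])); last exact: cvg_cst.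
      apply: near_eq_cvg; near=> k; rewrite min_l// lee_fin.
      by near: k; exact: nbhs_infty_ger.
    apply/cvgeyPge => y; near=> k; rewrite min_r ?leey// lee_fin.
    by near: k; exact: nbhs_infty_ger.
  rewrite [X in _ --> X](_ : _ = \int[P]_(w in A)
      limn (fun k => Order.min (tau t w) k%:R%:E)); last first.
    by apply: eq_integral => w _; rewrite (cvg_lim _ (pc w)).
  apply: cvg_monotone_convergence => //.
  - move=> k; apply: measurable_mine => //; exact/measurable_funTS/mtau.
  - by move=> k w _; rewrite le_min tau0 lee_fin ler0n.
  - move=> w _ j k jk; rewrite le_min ge_min lexx/= ge_min; apply/orP; right.
    by rewrite lee_fin ler_nat.
rewrite -(cvg_lim _ c)//; apply: lime_le; first by apply/cvg_ex; eexists; exact: c.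
by near=> k; exact: trunc.
Unshelve. all: by end_near. Qed.

End regularization.

(** * Progressive measurability and potentials *)

Section progressive.
Context {d : measure_display} {Omega : measurableType d} {R : realType}.
Variables (P : probability Omega R) (F : R -> set (set Omega)).
Hypothesis sF : standing_filtration P F.
Implicit Types (X U W : process Omega R).

Let FT t := g_sigma_algebraType (F t).

Lemma set_itvccP (a b : R) : [set s | a <= s <= b] = `[a, b]%classic.
Proof. by apply/seteqP; split => s /=; rewrite in_itv. Qed.

Lemma set_itvcyP (a : R) : [set s | a <= s] = `[a, +oo[%classic.
Proof. by apply/seteqP; split => s /=; rewrite in_itv/= andbT. Qed.

Lemma measurable_itvcc (a b : R) : measurable [set s | a <= s <= b].
Proof. by rewrite set_itvccP; exact: measurable_itv. Qed.

Lemma measurable_itvcy (a : R) : measurable [set s | a <= s].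
Proof. by rewrite set_itvcyP; exact: measurable_itv. Qed.

(** The type puts [F t] on the second factor: the progressive condition at [t] becomes plain
    measurability on [strip t], with all its closure properties. *)
Definition strip t : set (R * FT t) := [set s | 0 <= s <= t] `*` setT.

Arguments strip : clear implicits.

Lemma measurable_strip t : measurable (strip t).
Proof. by apply: measurableX => //; exact: measurable_itvcc. Qed.

Definition strip_rectangles t : set (set (R * Omega)) :=
  [set Z | exists (A : set R) (G : set Omega),
     [/\ measurable A, A `<=` [set s | 0 <= s <= t], F t G & Z = A `*` G]].

Lemma strip_sigma_sub t (E : set (R * FT t)) : 0 <= t ->
  <<s strip t, strip_rectangles t >> E -> measurable E.
Proof.
move=> t0; have sFt := filtration_sigma sF t0.
suff : <<s strip t, strip_rectangles t >> `<=` (measurable : set (set (R * FT t))).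
  exact.
apply: smallest_sub; first split.
- exact: measurable0.
- by move=> A mA; apply: measurableD => //; exact: measurable_strip.
- by move=> A mA; exact: bigcupT_measurable.
- move=> _ [A [G [mA _ FG ->]]].
  by apply: measurableX => //; rewrite sub_measurableE.
Qed.

Lemma sub_strip_sigma t (E : set (R * FT t)) : 0 <= t -> measurable E ->
  <<s strip t, strip_rectangles t >> (strip t `&` E).
Proof.
move=> t0; have sFt := filtration_sigma sF t0.
rewrite measurable_prod_measurableType.
suff : <<s [set A `*` B | A in measurable & B in (measurable : set (set (FT t)))]>>
    `<=` [set E | <<s strip t, strip_rectangles t >> (strip t `&` E)] by exact.
apply: smallest_sub; first split.
- by rewrite /= setI0; exact: sigma_algebra0.
- move=> A /= hA; rewrite setTD.
  have := sigma_algebraCD hA; congr (<<s _, _ >> _).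
  by apply/seteqP; split => x [h1 h2]; split => //; [move=> h3; apply: h2|move=> [_ /h2]].
- by move=> A /= hA; rewrite setI_bigcupr; exact: sigma_algebra_bigcup.
move=> _ [A mA [B mB <-]]; apply: sub_sigma_algebra.
exists ([set s | 0 <= s <= t] `&` A), B; split.
- by apply: measurableI => //; exact: measurable_itvcc.
- by move=> s [].
- by rewrite -sub_measurableE.
- by rewrite /strip -setXI setTI.
Qed.

Lemma progressiveP X : progressive F X <->
  forall t, 0 <= t -> measurable_fun (strip t) (fun p : R * FT t => X p.1 p.2).
Proof.
split => h t t0.
  move=> _ B mB; apply: strip_sigma_sub => //.
  have := h t t0 B mB; congr (<<s _, _ >> _).
  by apply/seteqP; split => p /= [h1 h2]; split => //; case: h1.
move=> B mB.
have mE := h t t0 (@measurable_strip t) B mB.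
have := sub_strip_sigma t0 mE; congr (<<s _, _ >> _).
by apply/seteqP; split => p /=; [move=> [_ [[h1 _] h2]]|move=> [h1 h2]].
Qed.

Lemma progressive_adapted X : progressive F X -> adapted F X.
Proof.
move=> /progressiveP pX t t0 _ B mB.
have mE := pX t t0 (@measurable_strip t) B mB.
have := measurable_xsection t mE; congr measurable.
apply/seteqP; split => w; rewrite /xsection /= inE; first by move=> [].
by move=> [_ h]; split => //; split => //=; rewrite t0 lexx.
Qed.

Lemma progressive_joint X : progressive F X ->
  measurable_fun ([set s : R | 0 <= s] `*` setT) (fun p : R * Omega => X p.1 p.2).
Proof.
move=> /progressiveP pX.
pose D (n : nat) : set (R * Omega) := [set s | 0 <= s <= n%:R] `*` setT.
have mD n : measurable (D n) by apply: measurableX => //; exact: measurable_itvcc.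
have -> : [set s : R | 0 <= s] `*` [set: Omega] = \bigcup_n D n.
  apply/seteqP; split => [[s w] [/= s0 _]|[s w] [n _ [/= /andP[s0 _] _]]]; last by split.
  exists (Num.truncn s).+1 => //; split => //=; rewrite s0/=.
  by have /andP[_ /ltW] := truncn_itv s0.
apply/measurable_fun_bigcup => // n.
have n0 : 0 <= n%:R :> R by [].
have mid : measurable_fun (D n) (fun p : R * Omega => (p.1, p.2) : R * FT n%:R).
  apply: measurable_funTS; apply: measurable_fun_pair => //.
  apply: (@measurableT_comp _ _ _ _ _ _ (id : Omega -> FT n%:R)) => //.
    exact: (sub_measurable_id (filtration_sigma sF n0) (@filtration_sub _ _ _ _ _ sF _ n0)).
  exact: measurable_snd.
by apply: (measurable_comp (measurable_strip (t := n%:R)) _ (pX _ n0) mid) => _ [p hp <-].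
Qed.

Lemma dyadic_above_right_cvg (f : R -> R) (t : R) : 0 <= t ->
  f @ t^'+ --> f t -> f (dyadic_above n t) @[n --> \oo] --> f t.
Proof.
move=> t0 /cvg_at_rightP; apply; split => [n|].
  by have /andP[] := dyadic_above_itv n t0.
apply/cvgrPdist_le => e e0; near=> n.
have /andP[h1 h2] := dyadic_above_itv n t0.
rewrite distrC ger0_norm; last by rewrite subr_ge0 ltW.
rewrite lerBlDl; apply: (le_trans h2); rewrite lerD2l ltW//.
by near: n; exact: near_exp2V.
Unshelve. all: by end_near. Qed.

Lemma dyadic_above_decreasing n (t : R) : 0 <= t ->
  dyadic_above n.+1 t <= dyadic_above n t.
Proof.
move=> t0; have p2 := exp2_gt0 (R := R) n.
have x0 : (0 <= t * 2 ^+ n) by rewrite mulr_ge0// ltW.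
have -> : dyadic_above n t = (2 * (Num.truncn (t * 2 ^+ n)).+1)%:R / (2 * 2 ^+ n).
  by rewrite /dyadic_above natrM -mulf_div divff// mul1r.
rewrite /dyadic_above exprS ler_pM2r ?invr_gt0 ?mulr_gt0// ler_nat.
rewrite mulrCA truncn_lt_nat; last by rewrite mulr_ge0.
have /andP[_ h] := truncn_itv x0.
by rewrite natrM ltr_pM2l.
Qed.

Lemma cadlag_progressive X : cadlag X -> adapted F X -> progressive F X.
Proof.
move=> cX aX; apply/progressiveP => t t0.
(* Sampling just after the current time converges by right-continuity. The minimum with [t] keeps
   the sample [F t]-measurable, and makes it exact at time [t] itself. *)
pose f n (p : R * FT t) := X (Num.min t (dyadic_above n p.1)) p.2.
apply: (@measurable_fun_cvg _ _ _ _ f); last first.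
  move=> [s w] [/= /andP[s0 st] _]; rewrite /f /=.
  move: st; rewrite le_eqVlt => /predU1P[->|st].
    apply: (@cvg_trans _ (X t w @[n --> \oo])); last exact: cvg_cst.
    apply: near_eq_cvg; near=> n; rewrite min_l//.
    by have /andP[/ltW] := dyadic_above_itv n t0.
  have := dyadic_above_right_cvg s0 ((cX w).1 s s0).
  apply: cvg_trans; apply: near_eq_cvg; near=> n; rewrite min_r//.
  have /andP[_ h] := dyadic_above_itv n s0.
  apply: (le_trans h); rewrite -lerBrDl; apply: ltW; near: n.
  by apply: near_exp2V; rewrite subr_gt0.
move=> n.
pose D k : set (R * FT t) :=
  ([set s | 0 <= s <= t] `&` [set s | Num.truncn (s * 2 ^+ n) = k]) `*` setT.
have mt : measurable_fun [set s : R | 0 <= s] (fun s => Num.truncn (s * 2 ^+ n)).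
  move=> mY Y _.
  rewrite (_ : _ `&` _ = \bigcup_(k in Y) ([set s | 0 <= s] `&`
      `[k%:R / 2 ^+ n, k.+1%:R / 2 ^+ n[%classic)).
    apply: bigcup_measurable => k _.
    by apply: measurableI => //; exact: measurable_itv.
  have p2 := exp2_gt0 (R := R) n.
  apply/seteqP; split => [s [/= s0 Ys]|s [k Yk [/= s0]]].
    exists (Num.truncn (s * 2 ^+ n)) => //; split => //=.
    rewrite in_itv/= ler_pdivrMr// ltr_pdivlMr//.
    by apply: truncn_itv; rewrite mulr_ge0// ltW.
  rewrite in_itv/= ler_pdivrMr// ltr_pdivlMr// => h; split => //.
  by rewrite /preimage/= (truncn_def h).
have mD k : measurable (D k).
  apply: measurableX => //.
  have -> : [set s : R | 0 <= s <= t] `&` [set s | Num.truncn (s * 2 ^+ n) = k] =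
      [set s | 0 <= s <= t] `&` ([set s | 0 <= s] `&`
        (fun s => Num.truncn (s * 2 ^+ n)) @^-1` [set k]).
    by apply/seteqP; split => s /= [/andP[s0 st]]; [|move=> [_]] => h;
      repeat split; rewrite ?s0.
  apply: measurableI; first exact: measurable_itvcc.
  by apply: mt => //; exact: measurable_itvcy.
have -> : strip t = \bigcup_k D k.
  apply/seteqP; split => [[s w] [/= h _]|[s w] [k _ [[/= h _] _]]]; last by split.
  by exists (Num.truncn (s * 2 ^+ n)).
apply/measurable_fun_bigcup => // k.
pose c := Num.min t (k.+1%:R / 2 ^+ n).
have c0 : 0 <= c by rewrite le_min t0 divr_ge0// ltW// exp2_gt0.
have ct : c <= t by rewrite ge_min lexx.
apply: (@eq_measurable_fun _ _ _ _ _ (fun p : R * FT t => X c p.2)).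
  by move=> [s w] /set_mem[[_ /= hk] _]; rewrite /c /f /dyadic_above /= hk.
apply: (@measurableT_comp _ _ _ _ _ _ (X c : FT t -> R)).
  exact: (measurable_fun_filtration_le sF c0 ct (aX c c0)).
exact: measurable_funTS.
Unshelve. all: by end_near. Qed.

End progressive.

(** * Tail integrals of nonnegative processes *)

Section tails.
Context {d : measure_display} {Omega : measurableType d} {R : realType}.
Variables (P : probability Omega R).
Implicit Types (U : process Omega R).
Local Open Scope ereal_scope.
Let mu := @lebesgue_measure R.

Definition nonneg_process U := forall t w, (0 <= t -> 0 <= U t w)%R.

Definition joint U :=
  measurable_fun ([set s : R | (0 <= s)%R] `*` setT) (fun p : R * Omega => U p.1 p.2).

(** Extension by 0 to all of [R * Omega], where Tonelli's theorem is applied. *)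
Let patched U t (p : R * Omega) : \bar R := if (t <= p.1)%R then (U p.1 p.2)%:E else 0.

Let patched_ge0 U t p : nonneg_process U -> (0 <= t)%R -> 0 <= patched U t p.
Proof.
by move=> U0 t0; rewrite /patched; case: ifP => // h; rewrite lee_fin U0// (le_trans t0 h).
Qed.

Lemma joint_restrict U t : joint U -> (0 <= t)%R ->
  measurable_fun ([set s : R | (t <= s)%R] `*` setT) (fun p : R * Omega => (U p.1 p.2)%:E).
Proof.
move=> jU t0; apply/measurable_EFinP; apply: measurable_funS jU.
  by apply: measurableX => //; exact: measurable_itvcy.
by move=> [s w] [/= ts _]; split => //=; exact: le_trans ts.
Qed.

Let patched_measurable U t : joint U -> (0 <= t)%R -> measurable_fun setT (patched U t).
Proof.
move=> jU t0; have mS : measurable ([set s : R | (t <= s)%R] `*` [set: Omega]).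
  by apply: measurableX => //; exact: measurable_itvcy.
have := (measurable_restrictT (fun p : R * Omega => (U p.1 p.2)%:E) mS).1 (joint_restrict jU t0).
apply: eq_measurable_fun => -[s w] _; rewrite /patched patchE /=.
case: leP => h; first by rewrite ifT// inE.
by rewrite ifF//; apply/negP; rewrite inE/= => -[/=]; rewrite leNgt h.
Qed.

Let tail_patched U t w : tail_int U t w = \int[mu]_s patched U t (s, w).
Proof.
rewrite /tail_int integral_mkcond; apply: eq_integral => s _.
rewrite patchE /patched /=; case: leP => h; first by rewrite ifT// inE.
by rewrite ifF//; apply/negP; rewrite inE/= leNgt h.
Qed.

Lemma tail_measurable U t : joint U -> nonneg_process U -> (0 <= t)%R ->
  measurable_fun setT (tail_int U t).
Proof.
move=> jU U0 t0; rewrite (_ : tail_int U t = fun w => \int[mu]_s patched U t (s, w)).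
  apply: (@measurable_fun_fubini_tonelli_G _ _ _ _ _ mu (patched U t)).
    exact: patched_measurable.
  by move=> p; exact: patched_ge0.
by apply/funext => w; exact: tail_patched.
Qed.

Lemma tail_tonelli U t (A : set Omega) : joint U -> nonneg_process U -> (0 <= t)%R ->
  measurable A -> \int[P]_(w in A) tail_int U t w =
  \int[mu]_(s in [set s | (t <= s)%R]) \int[P]_(w in A) (U s w)%:E.
Proof.
move=> jU U0 t0 mA.
pose g (p : R * Omega) := if p.2 \in A then patched U t p else 0.
have g0 p : 0 <= g p by rewrite /g; case: ifP => // _; exact: patched_ge0.
have mg : measurable_fun setT g.
  have mS : measurable ([set: R] `*` A) by exact: measurableX.
  have := (measurable_restrictT (patched U t) mS).1 (measurable_funTS (patched_measurable jU t0)).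
  apply: eq_measurable_fun => -[s w] _; rewrite /g patchE /=.
  have [Aw|Aw] := boolP (w \in A); first by rewrite ifT// inE; split => //=; exact: set_mem.
  rewrite ifF//; apply/negP; rewrite inE => -[_ /= h].
  by move: Aw; rewrite notin_setE; exact.
have := @fubini_tonelli _ _ _ _ _ mu P g mg g0 => h.
transitivity (\int[P]_w \int[mu]_s g (s, w)).
  rewrite integral_mkcond; apply: eq_integral => w _; rewrite patchE /g /=.
  case: ifP => Aw; first exact: tail_patched.
  by rewrite integral0.
rewrite -h [RHS]integral_mkcond; apply: eq_integral => s _; rewrite patchE /g /=.
case: ifPn => [|]; rewrite ?notin_setE ?inE/= => ts.
  rewrite [RHS]integral_mkcond; apply: eq_integral => w _; rewrite patchE.
  by case: ifP => // _; rewrite /patched/= ts.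
rewrite integral0_eq// => w _; case: ifP => // _.
by rewrite /patched/=; case: ifP => // h'; case: (ts h').
Qed.

Lemma path_measurable U t w : joint U -> (0 <= t)%R ->
  measurable_fun [set s : R | (t <= s)%R] (fun s => (U s w)%:E).
Proof.
move=> jU t0.
apply: (measurable_comp _ _ (joint_restrict jU t0) (g := fun s => (s, w))).
- by apply: measurableX => //; exact: measurable_itvcy.
- by move=> _ [s ts <-].
- by apply: measurable_funTS; apply: measurable_fun_pair => //; exact: measurable_cst.
Qed.

Lemma time_measurable U s : joint U -> (0 <= s)%R ->
  measurable_fun setT (fun w => (U s w)%:E).
Proof.
move=> jU s0.
apply: (measurable_comp _ _ (joint_restrict jU s0) (g := fun w => (s, w))).
- by apply: measurableX => //; exact: measurable_itvcy.
- by move=> _ [w _ <-]; split => /=.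
- by apply: measurable_fun_pair => //; exact: measurable_cst.
Qed.

Lemma tail_ge0 U t w : nonneg_process U -> (0 <= t)%R -> 0 <= tail_int U t w.
Proof.
by move=> U0 t0; apply: integral_ge0 => s /= ts; rewrite lee_fin U0// (le_trans t0 ts).
Qed.

Lemma tail_le U s t w : joint U -> nonneg_process U -> (0 <= s)%R -> (s <= t)%R ->
  tail_int U t w <= tail_int U s w.
Proof.
move=> jU U0 s0 st; apply: ge0_subset_integral.
- exact: measurable_itvcy.
- exact: measurable_itvcy.
- exact: path_measurable.
- by move=> r /= sr; rewrite lee_fin U0// (le_trans s0 sr).
- by move=> r /= tr; exact: le_trans tr.
Qed.

(** The half-lines starting at [dyadic_above n t] increase to []t, +oo[], which differs from [[t,
    +oo[] by one null point. *)
Lemma tail_cvg U t w : joint U -> nonneg_process U -> (0 <= t)%R ->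
  tail_int U (dyadic_above n t) w @[n --> \oo] --> tail_int U t w.
Proof.
move=> jU U0 t0.
have da_gt n : (t < dyadic_above n t)%R by have /andP[] := dyadic_above_itv n t0.
pose S n := [set s | (dyadic_above n t <= s)%R].
have -> : tail_int U t w = \int[mu]_(s in \bigcup_n S n) (U s w)%:E.
  rewrite /tail_int set_itvcyP -integral_itv_obnd_cbnd; last first.
    apply: measurable_funS (path_measurable w jU t0); first exact: measurable_itvcy.
    by move=> s /=; rewrite in_itv/= andbT; exact: ltW.
  congr (integral _ _ _); apply/seteqP; split => s /=; last first.
    by move=> [n _ /= h]; rewrite in_itv/= andbT; exact: lt_le_trans h.
  rewrite in_itv/= andbT => ts.
  have st0 : (0 < s - t)%R by rewrite subr_gt0.
  have [n /= hn] := filter_ex (near_exp2V st0); exists n => //=.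
  have /andP[_ h] := dyadic_above_itv n t0.
  by apply: (le_trans h); rewrite -lerBrDl ltW.
apply: ge0_nondecreasing_set_cvg_integral.
- apply/nondecreasing_seqP => n; apply/subsetPset => s /=; apply: le_trans.
  exact: dyadic_above_decreasing.
- by move=> n; exact: measurable_itvcy.
- by move=> n; apply: path_measurable => //; exact: (le_trans t0 (ltW (da_gt n))).
- move=> n s /= h; rewrite lee_fin U0// (le_trans t0)//.
  exact: (le_trans (ltW (da_gt n)) h).
Qed.

End tails.

(** * Potentials *)

Section potentials.
Context {d : measure_display} {Omega : measurableType d} {R : realType}.
Variables (P : probability Omega R) (F : R -> set (set Omega)).
Hypothesis sF : standing_filtration P F.
Implicit Types (U W : process Omega R).
Local Open Scope ereal_scope.

(* [W_t = E[int_t^oo U_s ds | F_t]] for all [t >= 0], for nonnegative [U]. *)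
Definition potential U W := [/\ cadlag W, progressive F W, nonneg_process W &
  forall t A, (0 <= t)%R -> F t A ->
    \int[P]_(w in A) (W t w)%:E = \int[P]_(w in A) tail_int U t w].

Lemma potential_exists U : joint U -> nonneg_process U ->
  \int[P]_w tail_int U 0 w < +oo -> exists W, potential U W.
Proof.
move=> jU U0 Ufin.
(* The regularization asks for nonnegativity at every real time, hence the value 0 before time 0. *)
pose tau t w := if (0 <= t)%R then tail_int U t w else 0.
have tauE t w : (0 <= t)%R -> tau t w = tail_int U t w by rewrite /tau => ->.
have h1 t : (0 <= t)%R -> measurable_fun setT (tau t).
  move=> t0; have := tail_measurable jU U0 t0; apply: eq_measurable_fun => w _.
  by rewrite tauE.
have h2 t w : 0 <= tau t w by rewrite /tau; case: ifP => // t0; exact: tail_ge0.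
have h3 s t w : (0 <= s)%R -> (s <= t)%R -> tau t w <= tau s w.
  by move=> s0 st; rewrite !tauE// ?(le_trans s0 st)//; exact: tail_le.
have h4 : \int[P]_w tau 0%R w < +oo by under eq_integral do rewrite tauE//.
have h5 t w : (0 <= t)%R -> tau (dyadic_above n t) w @[n --> \oo] --> tau t w.
  move=> t0; rewrite tauE//.
  rewrite (_ : (fun n => tau _ w) = (fun n => tail_int U (dyadic_above n t) w)).
    exact: tail_cvg.
  apply/funext => n; rewrite tauE//.
  by have /andP[/ltW h _] := dyadic_above_itv n t0; exact: le_trans h.
have [V [[aV V0 eV] cV]] := regularization sF h1 h2 h3 h4 h5.
exists V; split => //.
- exact: (cadlag_progressive sF).
- move=> t A t0 FA; rewrite eV//; apply: eq_integral => w _; exact: tauE.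
Qed.

End potentials.

(** * The convex function behind the comparison *)

Section power_inequality.
Context {R : realType}.
Variable th : R.
Hypothesis th1 : 1 < th.
Implicit Types (x y z u v : R).

Let th0 : 0 < th. Proof. exact: lt_trans th1. Qed.
Let p0 : 0 < th - 1. Proof. by rewrite subr_gt0. Qed.

Definition gap x y : R := Num.max (x - y) 0.
(** In the variables [x^th] and [y^th], the partial derivatives of [gap x y ^ th] are [slope1] and
    [- slope2]. Where the gap is positive the maximum is [x]; in general it keeps the denominator
    positive for [y > 0], so that [slope1] stays continuous at [x = 0]. *)
Definition slope1 x y : R := (gap x y / Num.max x y) `^ (th - 1).
Definition slope2 x y : R := (gap x y / y) `^ (th - 1).

Lemma gap_ge0 x y : 0 <= gap x y.
Proof. by rewrite le_max lexx orbT. Qed.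

Lemma gap_le x y : 0 <= x -> 0 <= y -> gap x y <= x.
Proof. by move=> x0 y0; rewrite ge_max x0 andbT gerBl. Qed.

Lemma slope_le0 x y : x <= y -> (slope1 x y = 0) * (slope2 x y = 0) * (gap x y = 0).
Proof.
move=> xy; have g0 : gap x y = 0 by rewrite /gap max_r// subr_le0.
by rewrite /slope1 /slope2 g0 !mul0r powR0// lt0r_neq0.
Qed.

Lemma slope_gt x y : y < x ->
  (slope1 x y = ((x - y) / x) `^ (th - 1)) *
  (slope2 x y = ((x - y) / y) `^ (th - 1)) * (gap x y = x - y).
Proof.
move=> yx; have g : gap x y = x - y by rewrite /gap max_l// subr_ge0 ltW.
by rewrite /slope1 /slope2 g max_l// ltW.
Qed.

Lemma powR_succ u : 0 <= u -> u `^ th = u `^ (th - 1) * u.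
Proof.
move=> u0; rewrite -[X in _ * X](powRr1 u0) -powRD; last by rewrite subrK gt_eqF.
by rewrite subrK.
Qed.

Lemma div_powR z u : 0 <= z -> 0 < u ->
  (z / u) `^ (th - 1) * u `^ (th - 1) = z `^ (th - 1).
Proof.
move=> z0 u0; rewrite -powRM ?divr_ge0//; last exact: ltW.
  by rewrite divfK// gt_eqF.
exact: ltW.
Qed.

Lemma slope1_ge0 x y : 0 <= slope1 x y. Proof. exact: powR_ge0. Qed.
Lemma slope2_ge0 x y : 0 <= slope2 x y. Proof. exact: powR_ge0. Qed.

(** This bound makes the weight [1 - a] of the comparison nonnegative. *)
Lemma slope1_le1 x y : 0 <= x -> 0 <= y -> slope1 x y <= 1.
Proof.
move=> x0 y0; have [xy|yx] := leP x y; first by rewrite slope_le0.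
have xp : 0 < x by exact: le_lt_trans yx.
have -> : 1 = 1 `^ (th - 1) :> R by rewrite powR1.
rewrite slope_gt//; apply: ge0_ler_powR; rewrite ?nnegrE//.
- exact: ltW.
- by rewrite divr_ge0// subr_ge0 ltW.
- by rewrite ler_pdivrMr// mul1r gerBl.
Qed.

Lemma slope_euler x y : 0 <= x -> 0 < y ->
  gap x y `^ th + slope2 x y * y `^ th = slope1 x y * x `^ th.
Proof.
move=> x0 y0; have [xy|yx] := leP x y.
  by rewrite !slope_le0// !mul0r powR0 ?addr0// lt0r_neq0.
have xp : 0 < x by exact: lt_trans yx.
have z0 : 0 <= x - y by rewrite subr_ge0 ltW.
rewrite !slope_gt// !powR_succ ?(ltW y0)// !mulrA !div_powR//.
by rewrite -mulrDr subrK.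
Qed.

(** Both sides equal [gap x y ^ (th - 1)]. For roots [x], [y] of two solutions, [x ^ (th - 1)] and
    [y ^ (th - 1)] are the powers with exponent rho in their drifts. *)
Lemma slope_drift x y : 0 <= x -> 0 < y ->
  slope1 x y * x `^ (th - 1) = slope2 x y * y `^ (th - 1).
Proof.
move=> x0 y0; have [xy|yx] := leP x y; first by rewrite !slope_le0// !mul0r.
have xp : 0 < x by exact: lt_trans yx.
have z0 : 0 <= x - y by rewrite subr_ge0 ltW.
by rewrite !slope_gt// !div_powR.
Qed.

(* Convexity of [(v, u) |-> gap (v `^ th^-1) (u `^ th^-1) `^ th], together with
   its homogeneity, in terms of the tangent plane at [(x `^ th, y `^ th)]. *)
Lemma slope_tangent x y u v : 0 <= x -> 0 < y -> 0 <= u -> 0 <= v ->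
  slope1 x y * u `^ th <= slope2 x y * v `^ th + gap u v `^ th.
Proof.
move=> x0 y0 u0 v0; have [xy|yx] := leP x y.
  by have [[-> ->] _] := slope_le0 xy; rewrite !mul0r add0r powR_ge0.
have xp : 0 < x by exact: lt_trans yx.
have z0 : 0 < x - y by rewrite subr_gt0.
set w := gap u v; have w0 : 0 <= w := gap_ge0 u v.
rewrite !slope_gt//; set z := x - y in z0 *.
(* By definition of the gap [u <= v + w], so it is enough to bound the power of [v + w]. *)
have ut : u `^ th <= (v + w) `^ th.
  apply: ge0_ler_powR; rewrite ?nnegrE ?addr_ge0//; first exact: ltW.
  by rewrite -lerBlDl le_max lexx.
apply: (@le_trans _ _ ((z / x) `^ (th - 1) * (v + w) `^ th)).
  by rewrite ler_wpM2l// powR_ge0.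
have tle : 0 <= y / x <= 1.
  by rewrite divr_ge0 ?(ltW y0)//= ler_pdivrMr// mul1r ltW.
have /andP[t0 t1] := tle.
have pt a : 0 <= a -> a \in (`[0, +oo[%classic : set R).
  by move=> a0; rewrite inE/= in_itv/= a0.
have xy0 : 0 <= x / y by rewrite divr_ge0// ltW.
have zx0 : 0 <= z / x by rewrite divr_ge0// ltW.
have v'0 : 0 <= v * (x / y) by rewrite mulr_ge0// divr_ge0// ltW.
have w'0 : 0 <= w * (x / z) by rewrite mulr_ge0// divr_ge0// ltW.
(* The weights [y / x] and [z / x] sum to 1, and the two points are scaled so that their combination
   is [v + w]; they coincide when [v] and [w] are proportional to [y] and [z], the case of
   tangency. *)
have := @convex_powR R th (ltW th1) (Itv01 t0 t1) _ _ (pt _ v'0) (pt _ w'0).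
rewrite [X in X `^ th <= _]convRE [X in _ <= X]convRE /= /unstable.onem.
have -> : y / x * (v * (x / y)) + (1 - y / x) * (w * (x / z)) = v + w.
  by rewrite /z; field; rewrite !gt_eqF.
move=> h; apply: (@le_trans _ _ ((z / x) `^ (th - 1) *
    (y / x * (v * (x / y)) `^ th + (1 - y / x) * (w * (x / z)) `^ th))).
  by rewrite ler_wpM2l// powR_ge0.
rewrite le_eqVlt; apply/orP; left; apply/eqP; rewrite mulrDr; congr (_ + _).
  rewrite (powRM _ v0 xy0) (powR_succ xy0).
  have -> : (z / y) `^ (th - 1) = (z / x) `^ (th - 1) * (x / y) `^ (th - 1).
    by rewrite -(powRM _ zx0 xy0); congr (_ `^ _); field; rewrite !gt_eqF.
  have -> : (z / x) `^ (th - 1) * (y / x * (v `^ th * ((x / y) `^ (th - 1) * (x / y)))) =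
     (z / x) `^ (th - 1) * (x / y) `^ (th - 1) * v `^ th * (y / x * (x / y)) by ring.
  have -> : y / x * (x / y) = 1 by field; rewrite !gt_eqF.
  by rewrite mulr1.
have -> : 1 - y / x = z / x by rewrite /z; field; rewrite gt_eqF.
rewrite (mulrA ((z / x) `^ (th - 1)) (z / x)) -(powR_succ zx0) -(powRM _ zx0 w'0); congr (_ `^ _).
by field; rewrite !gt_eqF.
Qed.

Lemma cvg_powR (u : R^nat) (l p : R) : 0 < p -> (forall n, 0 <= u n) ->
  u n @[n --> \oo] --> l -> u n `^ p @[n --> \oo] --> l `^ p.
Proof.
move=> pp u0 ul.
have l0 : 0 <= l.
  apply: (@closed_cvg _ _ _ _ u [set x | 0 <= x] _ _ _ ul); first exact: closed_ge.
  by near=> n; exact: u0.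
(* At [l = 0] the power may fail to be derivable; there [u n < e ^ (1 / p)] gives [u n ^ p < e]
   directly. *)
move: l0; rewrite le_eqVlt => /predU1P[l0|l0].
  rewrite -l0 powR0 ?gt_eqF//; apply/cvgrPdist_lt => e e0; near=> n.
  rewrite sub0r normrN ger0_norm ?powR_ge0//.
  rewrite -[X in _ < X](powRr1 (ltW e0)) -(@mulVf _ p) ?gt_eqF// powRrM.
  apply: gt0_ltr_powR => //; rewrite ?nnegrE ?powR_ge0//.
  have : `|l - u n| < e `^ p^-1.
    near: n; move/cvgrPdist_lt : ul; apply; exact: powR_gt0.
  by rewrite -l0 sub0r normrN ger0_norm.
apply: (@cvg_comp _ _ _ u (fun a : R => a `^ p) \oo (nbhs l) (nbhs (l `^ p)) ul).
have : derivable (fun a : R => a `^ p) l 1.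
  by apply: derivable_powR; rewrite in_itv/= l0.
by move/derivable1_diffP/differentiable_continuous.
Unshelve. all: by end_near. Qed.

Lemma cvg_gap (u v : R^nat) x y : u n @[n --> \oo] --> x -> v n @[n --> \oo] --> y ->
  gap (u n) (v n) @[n --> \oo] --> gap x y.
Proof.
move=> ux vy; apply: (@continuous2_cvg _ _ _ _ _ _ _ _ Order.max).
- exact: (@max_continuous _ R (x - y, 0)).
- exact: cvgB.
- exact: cvg_cst.
Qed.

Lemma cvg_slope (u v : R^nat) x y : 0 < y ->
  (forall n, 0 <= u n) -> (forall n, 0 <= v n) ->
  u n @[n --> \oo] --> x -> v n @[n --> \oo] --> y ->
  slope1 (u n) (v n) @[n --> \oo] --> slope1 x y /\
  slope2 (u n) (v n) @[n --> \oo] --> slope2 x y.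
Proof.
move=> y0 u0 v0 ux vy; have gc := cvg_gap ux vy.
split; apply: cvg_powR => //.
- by move=> n; rewrite divr_ge0 ?gap_ge0// le_max u0.
- apply: cvgM => //; apply: cvgV; first by rewrite gt_eqF// lt_max y0 orbT.
  apply: (@continuous2_cvg _ _ _ _ _ _ _ _ Order.max) => //.
  exact: (@max_continuous _ R (x, y)).
- by move=> n; rewrite divr_ge0 ?gap_ge0.
- by apply: cvgM => //; apply: cvgV => //; rewrite gt_eqF.
Qed.

End power_inequality.

(** * Jumps of paths with left limits *)

Section left_limits.
Context {R : realType}.
Variable f : R -> R.
Hypothesis fl : forall t, 0 < t -> cvg (f @ t^'-).

Definition left_discontinuity : set R := [set t | 0 < t /\ ~ (f @ t^'- --> f t)].

Let tagged (c : bool * (rat * rat)) : set R :=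
  [set t | ratr c.2.2 < t /\
    if c.1 then ratr c.2.1 < f t /\ forall u, ratr c.2.2 < u -> u < t -> f u < ratr c.2.1
    else f t < ratr c.2.1 /\ forall u, ratr c.2.2 < u -> u < t -> ratr c.2.1 < f u].

(* Each [t] at which the path jumps is the only element of [tagged (b, (q, r))] for
   some rational level [q] crossed by the jump and some rational [r] before [t]. *)
Lemma countable_left_discontinuity : countable left_discontinuity.
Proof.
apply: (@sub_countable _ _ _ (\bigcup_(c in [set: bool * (rat * rat)]) tagged c)).
  apply: subset_card_le => t [t0 nc].
  have /cvg_ex[l cl] := fl t0.
  have lf : l != f t by apply/eqP => h; apply: nc; rewrite -h.
  have key (B : set R) : (\forall u \near t^'-, B (f u)) ->
      exists r : rat, ratr r < t /\ forall u, ratr r < u -> u < t -> B (f u).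
    move=> [e /= e0 he]; have te : t - e < t by lra.
    have [r] := rat_in_itvoo te; rewrite in_itv/= => /andP[er rt].
    exists r; split => // u ru ut; apply: he => //=.
    by rewrite ltr_norml; apply/andP; split; lra.
  move: lf => /lt_total/orP[lf|fl'].
    have [q] := rat_in_itvoo lf; rewrite in_itv/= => /andP[lq qf].
    have [r [rt hr]] : exists r : rat, ratr r < t /\
        forall u, ratr r < u -> u < t -> f u < ratr q.
      by apply: (key [set z | z < ratr q]); exact: (cl _ (lt_nbhsl lq)).
    by exists (true, (q, r)).
  have [q] := rat_in_itvoo fl'; rewrite in_itv/= => /andP[fq ql].
  have [r [rt hr]] : exists r : rat, ratr r < t /\
      forall u, ratr r < u -> u < t -> ratr q < f u.
    by apply: (key [set z | ratr q < z]); exact: (cl _ (lt_nbhsr ql)).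
  by exists (false, (q, r)).
apply: bigcup_countable; first exact: countableP.
move=> [b [q r]] _.
have sub t u : tagged (b, (q, r)) t -> tagged (b, (q, r)) u -> ~ t < u.
  by case: b => -[/= rt [qt ht]] [/= ru [qu hu]] tu; have := hu _ rt tu;
    rewrite ltNge ltW.
have [[t ht]|/nonemptyPn->] := pselect (tagged (b, (q, r)) !=set0); last exact: countable0.
apply: (@sub_countable _ _ _ [set t]); last exact: countable1.
apply: subset_card_le => u hu; apply/eqP/negPn/negP => /lt_total/orP[ut|tu].
  exact: (sub _ _ hu ht).
exact: (sub _ _ ht hu).
Qed.

Lemma left_discontinuity_negligible :
  (@lebesgue_measure R).-negligible left_discontinuity.
Proof.
exists left_discontinuity; split => //.
  by apply: (countable_measurable _ countable_left_discontinuity) => t; exact: measurable_set1.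
exact: countable_lebesgue_measure0 countable_left_discontinuity.
Qed.

(** Terms equal to [t] are allowed, as happens for the last grid points before [t]; they are
    harmless because the left limit is the value [f t]. *)
Lemma cvg_left_sequence (u : R^nat) t : 0 < t -> ~ left_discontinuity t ->
  (forall n, u n <= t) -> u n @[n --> \oo] --> t -> f (u n) @[n --> \oo] --> f t.
Proof.
move=> t0 nd ut uc.
have fc : f @ t^'- --> f t by apply: contrapT => h; apply: nd; split.
apply: (cvg_comp _ _ _ (cvg_at_left_within fc)).
move=> A [e /= e0 he]; move/cvgrPdist_lt : uc => /(_ _ e0); apply: filterS => n hn.
by apply: he => //=.
Qed.

End left_limits.

Section slope_measurable.
Context {d : measure_display} {T : measurableType d} {R : realType}.
Variables (th : R) (D : set T).
Implicit Types f g : T -> R.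

Lemma measurable_fun_powR f p : measurable_fun D f -> measurable_fun D (fun w => f w `^ p).
Proof. exact: (measurableT_comp (measurable_powR p)). Qed.

Lemma measurable_fun_div f g : (forall w, 0 <= g w) -> measurable_fun D f ->
  measurable_fun D g -> measurable_fun D (fun w => f w / g w).
Proof.
move=> g0 mf mg; apply: measurable_funM => //.
(* For nonnegative [g] the inverse is the power -1, and powers are measurable. *)
rewrite (_ : (fun w => (g w)^-1) = fun w => g w `^ (-1)).
  exact: measurable_fun_powR.
by apply/funext => w; rewrite powR_inv1.
Qed.

Lemma measurable_gap f g : measurable_fun D f -> measurable_fun D g ->
  measurable_fun D (fun w => gap (f w) (g w)).
Proof.
move=> mf mg; apply: (measurable_maxr (f := fun w => f w - g w) (g := cst 0)) => //.
exact: measurable_funB.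
Qed.

Lemma measurable_slope1 f g : (forall w, 0 <= f w) ->
  measurable_fun D f -> measurable_fun D g ->
  measurable_fun D (fun w => slope1 th (f w) (g w)).
Proof.
move=> f0 mf mg; apply: measurable_fun_powR; apply: measurable_fun_div.
- by move=> w; rewrite le_max f0.
- exact: measurable_gap.
- exact: measurable_maxr.
Qed.

Lemma measurable_slope2 f g : (forall w, 0 <= g w) ->
  measurable_fun D f -> measurable_fun D g ->
  measurable_fun D (fun w => slope2 th (f w) (g w)).
Proof.
move=> f0 mf mg; apply: measurable_fun_powR; apply: measurable_fun_div => //.
exact: measurable_gap.
Qed.

End slope_measurable.

(** * Integrals over time segments and dynamics of potentials *)

Section segments.
Context {d : measure_display} {Omega : measurableType d} {R : realType}.
Variables (P : probability Omega R) (F : R -> set (set Omega)).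
Hypothesis sF : standing_filtration P F.
Implicit Types (U W : process Omega R).
Local Open Scope ereal_scope.
Let mu := @lebesgue_measure R.

Definition segment_int U t t' w := \int[mu]_(s in `[t, t'[%classic) (U s w)%:E.

(** Setting [U] to 0 from [t'] on turns a segment integral into a tail integral. *)
Let cut U (t' : R) : process Omega R := fun s w => if (s < t')%R then U s w else 0%R.

Lemma segment_measurable U t t' : joint U -> nonneg_process U -> (0 <= t)%R ->
  measurable_fun setT (segment_int U t t').
Proof.
move=> jU U0 t0.
have jc : joint (cut U t').
  have mS : measurable ([set s : R | (0 <= s)%R] `*` [set: Omega]).
    by apply: measurableX => //; exact: measurable_itvcy.
  apply: measurable_fun_if => //.
    by apply: measurable_funTS; apply: measurable_fun_ltr => //; exact: measurable_fst.
  by apply: measurable_funS jU.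
have c0 : nonneg_process (cut U t').
  by move=> s w s0; rewrite /cut; case: ifP => // _; exact: U0.
have := tail_measurable jc c0 t0; apply: eq_measurable_fun => w _.
rewrite /segment_int /tail_int set_itvcyP [LHS]integral_mkcond [RHS]integral_mkcond.
apply: eq_integral => s _; rewrite !patchE /cut.
have [st'|st'] := ltP s t'.
  congr (if _ then _ else _); apply/idP/idP; rewrite !inE/= !in_itv/= ?andbT.
    by move=> ->.
  by move=> /andP[].
rewrite [RHS]ifF; first by case: ifP.
by apply/negP; rewrite inE/= in_itv/= ltNge st' andbF.
Qed.

Lemma itv_measurable U t (i : interval R) w : joint U -> (0 <= t)%R ->
  (forall s, s \in i -> (t <= s)%R) ->
  measurable_fun [set` i] (fun s => (U s w)%:E).
Proof.
move=> jU t0 it; apply: measurable_funS (path_measurable w jU t0).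
  exact: measurable_itvcy.
by move=> s /= /it.
Qed.

Lemma segment_ge0 U t t' w : nonneg_process U -> (0 <= t)%R -> 0 <= segment_int U t t' w.
Proof.
move=> U0 t0; apply: integral_ge0 => s /=; rewrite in_itv/= => /andP[ts _].
by rewrite lee_fin U0// (le_trans t0).
Qed.

Lemma tail_segment U t t' w : joint U -> nonneg_process U -> (0 <= t)%R -> (t <= t')%R ->
  tail_int U t w = segment_int U t t' w + tail_int U t' w.
Proof.
move=> jU U0 t0 tt'; rewrite /tail_int /segment_int !set_itvcyP.
rewrite (@itv_bndbnd_setU _ _ (BLeft t) (BLeft t') +oo%O)// ?bnd_simp//.
rewrite ge0_integral_setU//.
- rewrite -itv_bndbnd_setU// ?bnd_simp//; apply: (itv_measurable _ jU t0) => s.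
  by rewrite in_itv/= andbT.
- rewrite -itv_bndbnd_setU// ?bnd_simp// => s /=; rewrite in_itv/= andbT => ts.
  by rewrite lee_fin U0// (le_trans t0).
- apply/disj_setPS => s [/=]; rewrite !in_itv/= andbT => /andP[_ h1] h2.
  by move: h1; rewrite ltNge h2.
Qed.

Lemma segment_cat U t1 t2 t3 w : joint U -> nonneg_process U -> (0 <= t1)%R ->
  (t1 <= t2)%R -> (t2 <= t3)%R ->
  segment_int U t1 t3 w = segment_int U t1 t2 w + segment_int U t2 t3 w.
Proof.
move=> jU U0 t0 t12 t23; rewrite /segment_int.
rewrite (@itv_bndbnd_setU _ _ (BLeft t1) (BLeft t2) (BLeft t3)) ?bnd_simp//.
rewrite ge0_integral_setU//.
- rewrite -itv_bndbnd_setU ?bnd_simp//; apply: (itv_measurable _ jU t0) => s.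
  by rewrite in_itv/= => /andP[].
- rewrite -itv_bndbnd_setU ?bnd_simp// => s /=; rewrite in_itv/= => /andP[ts _].
  by rewrite lee_fin U0// (le_trans t0).
- apply/disj_setPS => s [/=]; rewrite !in_itv/= => /andP[_ h1] /andP[h2 _].
  by move: h1; rewrite ltNge h2.
Qed.

Lemma segment_le_tail U t t' w : joint U -> nonneg_process U -> (0 <= t)%R ->
  (t <= t')%R -> segment_int U t t' w <= tail_int U t w.
Proof.
move=> jU U0 t0 tt'; rewrite (tail_segment w jU U0 t0 tt') leeDl//.
by apply: tail_ge0 => //; exact: le_trans tt'.
Qed.

(** Tonelli for the indicator [B] of [W <= 0]: its expectation is 0 at each time, so its time
    integral is 0 almost surely. *)
Lemma ae_ae_positive W : joint W -> (forall t, (0 <= t)%R -> {ae P, forall w, (0 < W t w)%R}) ->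
  {ae P, forall w, {ae mu, forall s, (0 <= s)%R -> (0 < W s w)%R}}.
Proof.
move=> jW W0.
pose B : process Omega R := fun s w => if (W s w <= 0)%R then 1%R else 0%R.
have mS : measurable ([set s : R | (0 <= s)%R] `*` [set: Omega]).
  by apply: measurableX => //; exact: measurable_itvcy.
have jB : joint B.
  by apply: measurable_fun_if => //; exact: measurable_fun_ler.
have B0 : nonneg_process B by move=> s w _; rewrite /B; case: ifP.
have mt := tail_measurable jB B0 (lexx 0%R).
have t0 w := tail_ge0 w B0 (lexx 0%R).
have : \int[P]_w `|tail_int B 0%R w| = 0.
  under eq_integral do rewrite gee0_abs//.
  rewrite (tail_tonelli P jB B0 (lexx 0%R) measurableT).
  apply: integral0_eq => s /= s0; rewrite -(integral0 P setT).
  apply: ge0_ae_eq_integral => //.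
  - exact: time_measurable.
  - by move=> w _; rewrite lee_fin B0.
  - by apply: filterS (W0 s s0) => w Ww _; rewrite /B leNgt Ww.
move/(ae_eq_integral_abs P measurableT mt); apply: filterS => w /(_ I) /= tw.
have mp := path_measurable w jB (lexx 0%R).
have : \int[mu]_(s in [set s | (0 <= s)%R]) `|(B s w)%:E| = 0.
  rewrite -[RHS]tw; apply: eq_integral => s /set_mem /= s0.
  by rewrite /= ger0_norm// B0.
move/(ae_eq_integral_abs mu (@measurable_itvcy R 0%R) mp); apply: filterS => s h s0.
have := h s0; rewrite /B ltNge; case: ifP => // _ [] /eqP.
by rewrite oner_eq0.
Qed.

(** By Tonelli the expectation is the mass of [[t + n, +oo[] for the finite measure with density
    [psi], and these half-lines decrease to the empty set. *)
Lemma tail_vanish U : joint U -> nonneg_process U -> \int[P]_w tail_int U 0%R w < +oo ->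
  forall t, (0 <= t)%R ->
  \int[P]_w tail_int U (t + n%:R)%R w @[n --> \oo] --> 0.
Proof.
move=> jU U0 Ufin t t0.
pose psi (s : R) : \bar R := if (0 <= s)%R then \int[P]_w (U s w)%:E else 0.
have psi0 s : 0 <= psi s.
  by rewrite /psi; case: ifP => // s0; apply: integral_ge0 => w _; rewrite lee_fin U0.
pose g (p : R * Omega) := if (0 <= p.1)%R then (U p.1 p.2)%:E else 0.
have mS : measurable ([set s : R | (0 <= s)%R] `*` [set: Omega]).
  by apply: measurableX => //; exact: measurable_itvcy.
have mg : measurable_fun setT g.
  have := (measurable_restrictT (fun p : R * Omega => (U p.1 p.2)%:E) mS).1
    (joint_restrict jU (lexx 0%R)).
  apply: eq_measurable_fun => -[s w] _; rewrite /g patchE /=.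
  case: ifPn => [|]; rewrite ?notin_setE ?inE/= => h.
    by case: h => /= ->.
  by case: ifP => // h'; case: h; split.
have g0 p : 0 <= g p by rewrite /g; case: ifP => // h; rewrite lee_fin U0.
have mpsi : measurable_fun setT psi.
  have := @measurable_fun_fubini_tonelli_F _ _ _ _ _ P g mg g0.
  apply: eq_measurable_fun => s _; rewrite /fubini_F /psi /g /=.
  by case: ifP => // _; rewrite integral0.
have tailE r : (0 <= r)%R -> \int[P]_w tail_int U r w = \int[mu]_(s in [set s | (r <= s)%R]) psi s.
  move=> r0; rewrite (tail_tonelli P jU U0 r0 measurableT).
  by apply: eq_integral => s /set_mem /= rs; rewrite /psi (le_trans r0 rs).
have psifin : \int[mu]_s psi s < +oo.
  rewrite tailE// in Ufin.
  have -> : \int[mu]_s psi s = \int[mu]_(s in [set s | (0 <= s)%R]) psi s; last by [].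
  rewrite [RHS]integral_mkcond; apply: eq_integral => s _; rewrite patchE /psi.
  case: ifPn => h; first by rewrite ifT// inE.
  by case: ifP => // /set_mem /= h'; rewrite h' in h.
have [nu nuE] := @density_measure _ (measurableTypeR R) R mu psi mpsi psi0 psifin.
pose S (n : nat) := [set s : R | (t + n%:R <= s)%R].
have mSn n : measurable (S n) by exact: measurable_itvcy.
have -> : 0 = nu (\bigcap_n S n).
  rewrite (_ : \bigcap_n _ = set0) ?measure0//; apply/seteqP; split => // s hs.
  have ts : (t <= s)%R by have := hs 0%N I; rewrite /S/= addr0.
  have st0 : (0 <= s - t)%R by rewrite subr_ge0.
  have := hs (Num.truncn (s - t)).+1 I; rewrite /S/= -lerBrDl leNgt.
  by have /andP[_ ->] := truncn_itv st0.
rewrite (_ : (fun n => _) = nu \o S).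
  apply: nonincreasing_cvg_mu => //.
  - rewrite ltey_eq; apply/orP; left; apply: fin_num_measure; exact: mSn.
  - exact: bigcapT_measurable.
  - move=> n m nm; apply/subsetPset => s; apply: le_trans.
    by rewrite lerD2l ler_nat.
by apply/funext => n /=; rewrite nuE tailE// addr_ge0.
Qed.

(** [W t] agrees almost surely with the conditional expectation built by [condexp_exists], from
    which weights can be taken out. *)
Lemma potential_weight U W t (H : Omega -> R) : joint U -> nonneg_process U ->
  \int[P]_w tail_int U 0%R w < +oo -> potential P F U W -> (0 <= t)%R ->
  measurable_fun setT (H : g_sigma_algebraType (F t) -> R) -> (forall w, 0 <= H w)%R ->
  \int[P]_w ((H w)%:E * (W t w)%:E) = \int[P]_w ((H w)%:E * tail_int U t w).
Proof.
move=> jU U0 Ufin [cW pW W0 eW] t0 mH H0.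
have sFt := filtration_sigma sF t0; have FMt := @filtration_sub _ _ _ _ _ sF _ t0.
have tfin : \int[P]_w tail_int U t w < +oo.
  apply: le_lt_trans Ufin; apply: ge0_le_integral => //.
  - by move=> w _; exact: tail_ge0.
  - exact: tail_measurable.
  - exact: tail_measurable.
  - by move=> w _; exact: tail_le.
have [Y [mY Y0 YE YH]] := condexp_exists sFt FMt (mu := P) (tail_measurable jU U0 t0)
  (fun w => tail_ge0 w U0 t0) tfin.
have FT : F t setT.
  exact: (filtration_ae sF t0 (aeW P (fun=> I))).
have mW := progressive_adapted sF pW t0.
have W0t w : (0 <= W t w)%R by exact: W0.
rewrite -YH//.
have WY : {ae P, forall w, (W t w <= Y w)%R}.
  apply: (condexp_le sFt FMt mW mY) => //; rewrite ?eW ?YE//.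
  by move=> A FA; rewrite eW// YE.
have YW : {ae P, forall w, (Y w <= W t w)%R}.
  apply: (condexp_le sFt FMt mY mW) => //; rewrite ?eW ?YE//.
  by move=> A FA; rewrite eW// YE.
have mHT := measurable_fun_filtration sF t0 mH.
have mYT := measurable_fun_filtration sF t0 mY.
have mWT := measurable_fun_filtration sF t0 mW.
apply: ge0_ae_eq_integral => //.
- by apply: emeasurable_funM; exact/measurable_EFinP.
- by apply: emeasurable_funM; exact/measurable_EFinP.
- by move=> w _; rewrite mule_ge0 ?lee_fin.
- by move=> w _; rewrite mule_ge0 ?lee_fin.
- by apply: filterS2 WY YW => w h1 h2 _; congr (_ * _%:E); apply: le_anti; rewrite h1.
Qed.

(** One step of the dynamics against a weight known at time [t]; in the form of a sum it makes sense
    for infinite expectations too. *)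
Lemma potential_split U W t t' (H : Omega -> R) : joint U -> nonneg_process U ->
  \int[P]_w tail_int U 0%R w < +oo -> potential P F U W -> (0 <= t)%R -> (t <= t')%R ->
  measurable_fun setT (H : g_sigma_algebraType (F t) -> R) -> (forall w, 0 <= H w)%R ->
  \int[P]_w ((H w)%:E * (W t w)%:E) =
  \int[P]_w ((H w)%:E * segment_int U t t' w) + \int[P]_w ((H w)%:E * (W t' w)%:E).
Proof.
move=> jU U0 Ufin pW t0 tt' mH H0; have t'0 := le_trans t0 tt'.
have mH' := measurable_fun_filtration_le sF t0 tt' mH.
have mHT := measurable_fun_filtration sF t0 mH.
rewrite (potential_weight jU U0 Ufin pW t0 mH H0).
rewrite (potential_weight jU U0 Ufin pW t'0 mH' H0).
rewrite -ge0_integralD//.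
- by apply: eq_integral => w _; rewrite (tail_segment w jU U0 t0 tt') ge0_muleDr//;
    [exact: segment_ge0|exact: tail_ge0].
- by move=> w _; rewrite mule_ge0 ?lee_fin//; exact: segment_ge0.
- by apply: emeasurable_funM; [exact/measurable_EFinP|exact: segment_measurable].
- by move=> w _; rewrite mule_ge0 ?lee_fin//; exact: tail_ge0.
- by apply: emeasurable_funM; [exact/measurable_EFinP|exact: tail_measurable].
Qed.

End segments.

(** * Comparison of potentials *)

Section comparison_core.
Context {d : measure_display} {Omega : measurableType d} {R : realType}.
Variables (P : probability Omega R) (F : R -> set (set Omega)).
Hypothesis sF : standing_filtration P F.
Variables Y V UY UV a b N : process Omega R.
Hypotheses (jUY : joint UY) (jUV : joint UV).
Hypotheses (UY0 : nonneg_process UY) (UV0 : nonneg_process UV).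
Hypotheses (pY : potential P F UY Y) (pV : potential P F UV V).
Local Open Scope ereal_scope.
Hypotheses (Yfin : \int[P]_w tail_int UY 0%R w < +oo)
  (Vfin : \int[P]_w tail_int UV 0%R w < +oo).
Hypotheses (a0 : forall t w, (0 <= a t w)%R) (a1 : forall t w, (a t w <= 1)%R)
  (b0 : forall t w, (0 <= b t w)%R) (N0 : forall t w, (0 <= N t w)%R).
Hypotheses (ma : adapted F a) (mb : adapted F b) (mN : adapted F N).
Hypothesis N_le : forall t w, (0 <= t)%R -> (N t w <= Y t w)%R.
Hypothesis V0 : forall t, (0 <= t)%R -> {ae P, forall w, (0 < V t w)%R}.
(* [N_t = n(Y_t, V_t)] for a convex 1-homogeneous function [n], whose gradient at
   [(Y_t, V_t)] is [(a_t, - b_t)]; Euler's identity and the tangent inequality. *)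
Hypothesis euler_ae : forall t, (0 <= t)%R ->
  {ae P, forall w, (N t w + b t w * V t w = a t w * Y t w)%R}.
Hypothesis tangent_ae : forall t t', (0 <= t)%R -> (0 <= t')%R ->
  {ae P, forall w, (a t w * Y t' w <= b t w * V t' w + N t' w)%R}.
Hypothesis drift : forall t w, (0 <= t)%R -> (0 < V t w)%R ->
  (a t w * UY t w = b t w * UV t w)%R.
Hypothesis gradient_cvg : forall t w (u : R^nat), (0 <= t)%R -> (0 < V t w)%R ->
  (forall n, 0 <= u n)%R ->
  Y (u n) w @[n --> \oo] --> Y t w -> V (u n) w @[n --> \oo] --> V t w ->
  a (u n) w @[n --> \oo] --> a t w /\ b (u n) w @[n --> \oo] --> b t w.

Let Yge0 : nonneg_process Y. Proof. by case: pY. Qed.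
Let Vge0 : nonneg_process V. Proof. by case: pV. Qed.

Let mYT t : (0 <= t)%R -> measurable_fun setT (Y t).
Proof.
by move=> t0; case: pY => _ /(progressive_adapted sF)/(_ t t0)/(measurable_fun_filtration sF t0).
Qed.

Let mVT t : (0 <= t)%R -> measurable_fun setT (V t).
Proof.
by move=> t0; case: pV => _ /(progressive_adapted sF)/(_ t t0)/(measurable_fun_filtration sF t0).
Qed.

Let maT t : (0 <= t)%R -> measurable_fun setT (a t).
Proof. by move=> t0; exact: (measurable_fun_filtration sF t0 (ma t0)). Qed.

Let mbT t : (0 <= t)%R -> measurable_fun setT (b t).
Proof. by move=> t0; exact: (measurable_fun_filtration sF t0 (mb t0)). Qed.

Let mNT t : (0 <= t)%R -> measurable_fun setT (N t).
Proof. by move=> t0; exact: (measurable_fun_filtration sF t0 (mN t0)). Qed.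

Let EY t : (0 <= t)%R -> \int[P]_w (Y t w)%:E = \int[P]_w tail_int UY t w.
Proof.
move=> t0; have [_ _ _ eY] := pY; apply: eY => //.
exact: (filtration_ae sF t0 (aeW P (fun=> I))).
Qed.

Let EY_fin t : (0 <= t)%R -> \int[P]_w (Y t w)%:E < +oo.
Proof.
move=> t0; rewrite (EY t0).
apply: le_lt_trans Yfin.
apply: (@ge0_le_integral _ _ _ P setT measurableT (tail_int UY t) (tail_int UY 0%R)).
- by move=> w _; exact: tail_ge0.
- exact: (tail_measurable jUY UY0 t0).
- exact: (tail_measurable jUY UY0 (lexx 0%R)).
- by move=> w _; exact: (tail_le w jUY UY0 (lexx 0%R) t0).
Qed.

Let fin_of (f : Omega -> R) t : (0 <= t)%R -> measurable_fun setT f ->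
  (forall w, 0 <= f w <= Y t w)%R -> \int[P]_w (f w)%:E \is a fin_num.
Proof.
move=> t0 mf f01; rewrite ge0_fin_numE; last first.
  by apply: integral_ge0 => w _; rewrite lee_fin; have /andP[] := f01 w.
apply: le_lt_trans (EY_fin t0); apply: ge0_le_integral => //.
- by move=> w _; rewrite lee_fin; have /andP[] := f01 w.
- exact/measurable_EFinP.
- by apply/measurable_EFinP; exact: mYT.
- by move=> w _; rewrite lee_fin; have /andP[] := f01 w.
Qed.

Let EN_fin t : (0 <= t)%R -> \int[P]_w (N t w)%:E \is a fin_num.
Proof. by move=> t0; apply: (fin_of t0) => [|w]; [exact: mNT|rewrite N0 N_le]. Qed.

(** [B] stands for the expectation of [b V] at the later time, which has to be finite to cancel;
    [T2] is the [1 - a] part of the segment of [UY], added to both sides. *)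
Let balance (A S B T1 T2 M : \bar R) : B \is a fin_num ->
  A + (S + B) <= T1 + (B + M) -> A + (T2 + S) <= M + (T1 + T2).
Proof.
move=> fB; rewrite addeA (addeC B) addeA leeD2rE// => h.
by rewrite (addeC T2) addeA [leRHS]addeA (addeC M) leeD2r.
Qed.

(** Euler's identity at [t], the dynamics of both potentials and the tangent inequality at [t']
    leave [a] times the segment of [UY] on the right and [b] times that of [UV] on the left. Adding
    [1 - a] times the segment of [UY] to both sides prepares a nonnegative integrand for Fatou. *)
Let step t t' : (0 <= t)%R -> (t <= t')%R ->
  \int[P]_w (N t w)%:E + \int[P]_w ((1 - a t w)%:E * segment_int UY t t' w +
    (b t w)%:E * segment_int UV t t' w) <=
  \int[P]_w (N t' w)%:E + \int[P]_w segment_int UY t t' w.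
Proof.
move=> t0 tt'; have t'0 := le_trans t0 tt'.
have sY0 w : 0 <= segment_int UY t t' w by exact: segment_ge0.
have sV0 w : 0 <= segment_int UV t t' w by exact: segment_ge0.
have msY := segment_measurable t' jUY UY0 t0.
have msV := segment_measurable t' jUV UV0 t0.
have e_a : \int[P]_w ((a t w)%:E * (Y t w)%:E) =
    \int[P]_w ((a t w)%:E * segment_int UY t t' w) + \int[P]_w ((a t w)%:E * (Y t' w)%:E).
  exact: (potential_split sF jUY UY0 Yfin pY t0 tt' (ma t0) (a0 t)).
have e_b : \int[P]_w ((b t w)%:E * (V t w)%:E) =
    \int[P]_w ((b t w)%:E * segment_int UV t t' w) + \int[P]_w ((b t w)%:E * (V t' w)%:E).
  exact: (potential_split sF jUV UV0 Vfin pV t0 tt' (mb t0) (b0 t)).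
have mY := mYT t0; have mV := mVT t0; have mY' := mYT t'0; have mV' := mVT t'0.
have m1a : measurable_fun setT (fun w => (1 - a t w)%:E).
  by apply/measurable_EFinP; apply: measurable_funB; [exact: measurable_cst|exact: maT].
have mEa : measurable_fun setT (fun w => (a t w)%:E).
  by apply/measurable_EFinP; exact: maT.
have mEb : measurable_fun setT (fun w => (b t w)%:E).
  by apply/measurable_EFinP; exact: mbT.
have a1' w : (0 <= 1 - a t w)%R by rewrite subr_ge0.
have euler : \int[P]_w (N t w)%:E + \int[P]_w ((b t w)%:E * (V t w)%:E) =
    \int[P]_w ((a t w)%:E * (Y t w)%:E).
  rewrite -ge0_integralD//; first last.
  - by apply: emeasurable_funM => //; exact/measurable_EFinP.
  - by move=> w _; rewrite mule_ge0 ?lee_fin ?Vge0.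
  - by apply/measurable_EFinP; exact: mNT.
  - by move=> w _; rewrite lee_fin.
  apply: ge0_ae_eq_integral => //.
  - apply: emeasurable_funD; first by apply/measurable_EFinP; exact: mNT.
    by apply: emeasurable_funM => //; exact/measurable_EFinP.
  - by apply: emeasurable_funM => //; exact/measurable_EFinP.
  - by move=> w _; rewrite adde_ge0 ?mule_ge0 ?lee_fin ?Vge0.
  - by move=> w _; rewrite mule_ge0 ?lee_fin ?Yge0.
  - apply: filterS (euler_ae t0) => w h _.
    by rewrite -!EFinM -EFinD h.
have tangent : \int[P]_w ((a t w)%:E * (Y t' w)%:E) <=
    \int[P]_w ((b t w)%:E * (V t' w)%:E) + \int[P]_w (N t' w)%:E.
  rewrite -ge0_integralD//; first last.
  - by apply/measurable_EFinP; exact: mNT.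
  - by move=> w _; rewrite lee_fin.
  - by apply: emeasurable_funM => //; exact/measurable_EFinP.
  - by move=> w _; rewrite mule_ge0 ?lee_fin ?Vge0.
  apply: ae_ge0_le_integral => //.
  - by move=> w _; rewrite mule_ge0 ?lee_fin ?Yge0.
  - by apply: emeasurable_funM => //; exact/measurable_EFinP.
  - by move=> w _; rewrite adde_ge0 ?mule_ge0 ?lee_fin ?Vge0.
  - apply: emeasurable_funD; last by apply/measurable_EFinP; exact: mNT.
    by apply: emeasurable_funM => //; exact/measurable_EFinP.
  - apply: filterS (tangent_ae t0 t'0) => w h _.
    by rewrite -!EFinM -EFinD lee_fin.
have aY_fin : \int[P]_w ((a t w)%:E * (Y t w)%:E) \is a fin_num.
  under eq_integral do rewrite -EFinM.
  apply: (fin_of t0); first by apply: measurable_funM => //; exact: maT.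
  move=> w; rewrite mulr_ge0 ?Yge0//=.
  by rewrite ler_piMl ?Yge0.
(* [b] is unbounded; finiteness comes from Euler's identity, since the expectation of [b V]
   decreases from [t] to [t'] and at [t] it is at most that of [a Y]. *)
have bV'_fin : \int[P]_w ((b t w)%:E * (V t' w)%:E) \is a fin_num.
  rewrite ge0_fin_numE; last first.
    by apply: integral_ge0 => w _; rewrite mule_ge0 ?lee_fin ?Vge0.
  have : \int[P]_w ((a t w)%:E * (Y t w)%:E) < +oo by rewrite ltey_eq aY_fin.
  apply: le_lt_trans; rewrite -euler e_b addeA leeDr// adde_ge0//.
    by apply: integral_ge0 => w _; rewrite lee_fin.
  by apply: integral_ge0 => w _; rewrite mule_ge0 ?lee_fin.
rewrite ge0_integralD//; first last.
- exact: emeasurable_funM.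
- by move=> w _; rewrite mule_ge0 ?lee_fin.
- exact: emeasurable_funM.
- by move=> w _; rewrite mule_ge0 ?lee_fin// subr_ge0.
have -> : \int[P]_w segment_int UY t t' w =
    \int[P]_w ((a t w)%:E * segment_int UY t t' w) +
    \int[P]_w ((1 - a t w)%:E * segment_int UY t t' w).
  rewrite -ge0_integralD//; first last.
  - exact: emeasurable_funM.
  - by move=> w _; rewrite mule_ge0 ?lee_fin// subr_ge0.
  - exact: emeasurable_funM.
  - by move=> w _; rewrite mule_ge0 ?lee_fin.
  apply: eq_integral => w _; rewrite -ge0_muleDl ?lee_fin// ?subr_ge0//.
  by rewrite -EFinD addrC subrK mul1e.
apply: (@balance _ _ _ _ _ _ bV'_fin).
by rewrite -e_b euler e_a leeD2l.
Qed.

Section grid.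
Variables (t0 : R) (n : nat).
Hypothesis t00 : (0 <= t0)%R.

Definition grid_time m : R := (t0 + m%:R / n.+1%:R)%R.

Definition grid_floor (s : R) : R := grid_time (Num.truncn ((s - t0) * n.+1%:R)).

Lemma grid_time_ge m : (t0 <= grid_time m)%R.
Proof. by rewrite lerDl divr_ge0. Qed.

Lemma grid_timeS m : (grid_time m <= grid_time m.+1)%R.
Proof. by rewrite lerD2l ler_pM2r ?invr_gt0// ler_nat. Qed.

Lemma grid_floorE m s : (s \in `[grid_time m, grid_time m.+1[)%R -> grid_floor s = grid_time m.
Proof.
rewrite in_itv/= => /andP[h1 h2]; rewrite /grid_floor; congr grid_time.
apply: truncn_def.
by rewrite -ler_pdivrMr// -ltr_pdivlMr// lerBrDl ltrBlDl; apply/andP; split.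
Qed.

Lemma grid_floor_itv s : (t0 <= s)%R -> (s - n.+1%:R^-1 <= grid_floor s <= s)%R.
Proof.
move=> ts; have h : (0 <= (s - t0) * n.+1%:R)%R by rewrite mulr_ge0// subr_ge0.
have /andP[h1 h2] := truncn_itv h.
rewrite /grid_floor /grid_time; apply/andP; split; last first.
  by rewrite -lerBrDl ler_pdivrMr.
rewrite lerBlDr -addrA -lerBlDl -{2}(div1r n.+1%:R) -mulrDl ler_pdivlMr//.
by rewrite natr1 ltW.
Qed.

(** The integrand with the gradient frozen at the last grid time before [s]. *)
Let g s w : R := ((1 - a (grid_floor s) w) * UY s w + b (grid_floor s) w * UV s w)%R.

Let gE m s w : (s \in `[grid_time m, grid_time m.+1[)%R ->
  (g s w)%:E = (1 - a (grid_time m) w)%:E * (UY s w)%:E + (b (grid_time m) w)%:E * (UV s w)%:E.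
Proof. by move=> h; rewrite /g (grid_floorE h) EFinD !EFinM. Qed.

Let mu := @lebesgue_measure R.

Let piece_measurable m w :
  measurable_fun `[grid_time m, grid_time m.+1[%classic (fun s => (g s w)%:E).
Proof.
have tm0 := le_trans t00 (grid_time_ge m).
have mU U : joint U -> measurable_fun `[grid_time m, grid_time m.+1[%classic (fun s => (U s w)%:E).
  by move=> jU; apply: (itv_measurable _ jU tm0) => s; rewrite in_itv/= => /andP[].
apply: (eq_measurable_fun (fun s => (1 - a (grid_time m) w)%:E * (UY s w)%:E +
    (b (grid_time m) w)%:E * (UV s w)%:E)).
  by move=> s /set_mem/= h; rewrite (gE _ h).
by apply: emeasurable_funD; apply: emeasurable_funM => //; exact: mU.
Qed.

Let piece_int m w : \int[mu]_(s in `[grid_time m, grid_time m.+1[%classic) (g s w)%:E =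
  (1 - a (grid_time m) w)%:E * segment_int UY (grid_time m) (grid_time m.+1) w +
  (b (grid_time m) w)%:E * segment_int UV (grid_time m) (grid_time m.+1) w.
Proof.
have tm0 := le_trans t00 (grid_time_ge m).
have mU U : joint U -> measurable_fun `[grid_time m, grid_time m.+1[%classic (fun s => (U s w)%:E).
  by move=> jU; apply: (itv_measurable _ jU tm0) => s; rewrite in_itv/= => /andP[].
have U0 U s : nonneg_process U -> `[grid_time m, grid_time m.+1[%classic s -> 0 <= (U s w)%:E.
  move=> U0; rewrite /= in_itv/= => /andP[h _].
  by rewrite lee_fin U0// (le_trans tm0).
have a1' : (0 <= 1 - a (grid_time m) w)%R by rewrite subr_ge0.
transitivity (\int[mu]_(s in `[grid_time m, grid_time m.+1[%classic)
   ((1 - a (grid_time m) w)%:E * (UY s w)%:E + (b (grid_time m) w)%:E * (UV s w)%:E)).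
  by apply: eq_integral => s /set_mem/= h; rewrite (gE _ h).
rewrite ge0_integralD//.
- rewrite !ge0_integralZl_EFin//.
  + by move=> s; exact: U0.
  + exact: mU.
  + by move=> s; exact: U0.
  + exact: mU.
- by move=> s h; rewrite mule_ge0 ?lee_fin//; exact: U0 h.
- by apply: emeasurable_funM => //; exact: mU.
- by move=> s h; rewrite mule_ge0 ?lee_fin//; exact: U0 h.
- by apply: emeasurable_funM => //; exact: mU.
Qed.

Let g0 s w : (t0 <= s)%R -> (0 <= g s w)%R.
Proof.
move=> ts; have s0 := le_trans t00 ts.
by rewrite addr_ge0// mulr_ge0 ?subr_ge0//; [exact: UY0|exact: UV0].
Qed.

Lemma grid_inequality m :
  [/\ forall w, measurable_fun `[t0, grid_time m[%classic (fun s => (g s w)%:E),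
      measurable_fun setT (fun w => \int[mu]_(s in `[t0, grid_time m[%classic) (g s w)%:E) &
      \int[P]_w (N t0 w)%:E + \int[P]_w \int[mu]_(s in `[t0, grid_time m[%classic) (g s w)%:E <=
      \int[P]_w (N (grid_time m) w)%:E + \int[P]_w segment_int UY t0 (grid_time m) w].
Proof.
elim: m => [|m [mg mG IH]].
  have e0 : `[t0, grid_time 0[%classic = set0 :> set R.
    by rewrite /grid_time mul0r addr0 set_itvco0.
  have s0 w : segment_int UY t0 (grid_time 0) w = 0.
    by rewrite /segment_int e0 integral_set0.
  split.
  - by move=> w; rewrite e0; exact: measurable_fun_set0.
  - apply: (eq_measurable_fun (cst 0)) => // w _.
    by rewrite e0 integral_set0.
  - have -> : \int[P]_w \int[mu]_(s in `[t0, grid_time 0[%classic) (g s w)%:E = 0.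
      by apply: integral0_eq => w _; rewrite e0 integral_set0.
    have -> : grid_time 0 = t0 by rewrite /grid_time mul0r addr0.
    by rewrite adde0 leeDl//; apply: integral_ge0 => w _; exact: segment_ge0.
have tm := grid_time_ge m; have tm0 := le_trans t00 tm; have tmS := grid_timeS m.
have itvE : `[t0, grid_time m.+1[%classic = `[t0, grid_time m[%classic `|`
    `[grid_time m, grid_time m.+1[%classic.
  by rewrite -itv_bndbnd_setU ?bnd_simp.
have mgS w : measurable_fun `[t0, grid_time m.+1[%classic (fun s => (g s w)%:E).
  rewrite itvE; apply: (measurable_funU _ (measurable_itv _) (measurable_itv _)).2.
  by split; [exact: mg|exact: piece_measurable].
have GE w : \int[mu]_(s in `[t0, grid_time m.+1[%classic) (g s w)%:E =
    \int[mu]_(s in `[t0, grid_time m[%classic) (g s w)%:E +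
    \int[mu]_(s in `[grid_time m, grid_time m.+1[%classic) (g s w)%:E.
  rewrite itvE ge0_integral_setU//.
  - by rewrite -itvE; exact: mgS.
  - rewrite -itvE => s /=; rewrite in_itv/= => /andP[h _].
    by rewrite lee_fin g0.
  - apply/disj_setPS => s [/=]; rewrite !in_itv/= => /andP[_ h1] /andP[h2 _].
    by move: h1; rewrite ltNge h2.
have mpiece : measurable_fun setT (fun w =>
    \int[mu]_(s in `[grid_time m, grid_time m.+1[%classic) (g s w)%:E).
  apply: (eq_measurable_fun (fun w => (1 - a (grid_time m) w)%:E *
      segment_int UY (grid_time m) (grid_time m.+1) w +
      (b (grid_time m) w)%:E * segment_int UV (grid_time m) (grid_time m.+1) w)).
    by move=> w _; rewrite piece_int.
  apply: emeasurable_funD; apply: emeasurable_funM.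
  - apply/measurable_EFinP; apply: measurable_funB => //; exact: maT.
  - exact: segment_measurable.
  - by apply/measurable_EFinP; exact: mbT.
  - exact: segment_measurable.
split; first exact: mgS.
  apply: (eq_measurable_fun (fun w => \int[mu]_(s in `[t0, grid_time m[%classic) (g s w)%:E +
    \int[mu]_(s in `[grid_time m, grid_time m.+1[%classic) (g s w)%:E)).
    by move=> w _; rewrite GE.
  exact: emeasurable_funD.
have -> : \int[P]_w \int[mu]_(s in `[t0, grid_time m.+1[%classic) (g s w)%:E =
    \int[P]_w (\int[mu]_(s in `[t0, grid_time m[%classic) (g s w)%:E +
    \int[mu]_(s in `[grid_time m, grid_time m.+1[%classic) (g s w)%:E).
  by apply: eq_integral => w _; exact: GE.
have A0 w : 0 <= \int[mu]_(s in `[t0, grid_time m[%classic) (g s w)%:E.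
  apply: integral_ge0 => s /=; rewrite in_itv/= => /andP[h _].
  by rewrite lee_fin; exact: g0.
have B0 w : 0 <= \int[mu]_(s in `[grid_time m, grid_time m.+1[%classic) (g s w)%:E.
  apply: integral_ge0 => s /=; rewrite in_itv/= => /andP[h _].
  by rewrite lee_fin; apply: g0; exact: le_trans h.
rewrite (@ge0_integralD _ _ _ P setT measurableT _ _ (fun w _ => A0 w) mG (fun w _ => B0 w) mpiece).
have segE : \int[P]_w segment_int UY t0 (grid_time m.+1) w =
    \int[P]_w segment_int UY t0 (grid_time m) w +
    \int[P]_w segment_int UY (grid_time m) (grid_time m.+1) w.
  rewrite -ge0_integralD//.
  - by apply: eq_integral => w _; exact: segment_cat.
  - by move=> w _; exact: segment_ge0.
  - exact: segment_measurable.
  - by move=> w _; exact: segment_ge0.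
  - exact: segment_measurable.
have := step tm0 tmS.
rewrite (_ : \int[P]_w ((1 - a (grid_time m) w)%:E * _ + _) =
  \int[P]_w \int[mu]_(s in `[grid_time m, grid_time m.+1[%classic) (g s w)%:E); last first.
  by apply: eq_integral => w _; rewrite piece_int.
rewrite segE => st; rewrite addeA.
apply: le_trans (leeD2r _ IH) _.
by rewrite addeAC [leRHS]addeA [leRHS]addeAC leeD2r.
Qed.

End grid.

Let mu := @lebesgue_measure R.

Let grid_fun t0 n s w : R := ((1 - a (grid_floor t0 n s) w) * UY s w +
  b (grid_floor t0 n s) w * UV s w)%R.

(** The grid times tend to [s] from the left; where neither path jumps the limit is
    [(1 - a) UY + b UV], which is [UY] by [drift]. *)
Let grid_cvg t0 s w : (0 <= t0)%R -> (t0 <= s)%R -> (0 < s)%R -> (0 < V s w)%R ->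
  ~ left_discontinuity (Y ^~ w) s -> ~ left_discontinuity (V ^~ w) s ->
  (grid_fun t0 n s w)%:E @[n --> \oo] --> (UY s w)%:E.
Proof.
move=> t00 ts s0 Vs dY dV.
suff main : grid_fun t0 n s w @[n --> \oo] --> UY s w.
  by apply: cvg_EFin; [near=> n|exact: main].
have fl n := grid_floor_itv n ts.
have fc : grid_floor t0 n s @[n --> \oo] --> s.
  apply/cvgrPdist_le => e e0; near=> n; have /andP[h1 h2] := fl n.
  rewrite ger0_norm ?subr_ge0// lerBlDr addrC -lerBlDr; apply: le_trans h1.
  rewrite lerD2l lerN2; apply: ltW; near: n.
  exact: (near_infty_natSinv_lt (PosNum e0)).
have [cY _ _ _] := pY; have [cV _ _ _] := pV.
have fY := cvg_left_sequence s0 dY (fun n => (andP (fl n)).2) fc.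
have fV := cvg_left_sequence s0 dV (fun n => (andP (fl n)).2) fc.
have f0 n : (0 <= grid_floor t0 n s)%R by apply: (le_trans t00); exact: grid_time_ge.
have [ca cb] := gradient_cvg (ltW s0) Vs f0 fY fV.
have -> : UY s w = ((1 - a s w) * UY s w + b s w * UV s w)%R.
  by rewrite -drift// 1?ltW// -mulrDl subrK mul1r.
by apply: cvgD; apply: cvgMl; [apply: cvgB => //; exact: cvg_cst|].
Unshelve. all: by end_near. Qed.

(** As the mesh tends to 0, Fatou in time and then on [Omega] leaves the expected segment of [UY] on
    both sides, where it is finite and cancels. *)
Let unit_step t : (0 <= t)%R -> \int[P]_w (N t w)%:E <= \int[P]_w (N (t + 1)%R w)%:E.
Proof.
move=> t0.
have gtE n : grid_time t n n.+1 = (t + 1)%R by rewrite /grid_time divff.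
pose G n w := \int[mu]_(s in `[t, (t + 1)%R[%classic) (grid_fun t n s w)%:E.
have gi n : [/\ forall w, measurable_fun `[t, (t + 1)%R[%classic (fun s => (grid_fun t n s w)%:E),
      measurable_fun setT (G n) &
      \int[P]_w (N t w)%:E + \int[P]_w G n w <=
      \int[P]_w (N (t + 1)%R w)%:E + \int[P]_w segment_int UY t (t + 1)%R w].
  by have := grid_inequality n t0 n.+1; rewrite gtE.
have t10 : (0 <= t + 1)%R by rewrite addr_ge0.
have tt1 : (t <= t + 1)%R by rewrite lerDl.
have g0 n s w : (t <= s)%R -> (0 <= grid_fun t n s w)%R.
  move=> ts; have s0 := le_trans t0 ts.
  by rewrite addr_ge0// mulr_ge0 ?subr_ge0//; [exact: UY0|exact: UV0].
have G0 n w : 0 <= G n w.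
  apply: integral_ge0 => s /=; rewrite in_itv/= => /andP[h _].
  by rewrite lee_fin g0.
have msY := segment_measurable (t + 1)%R jUY UY0 t0.
have sY0 w : 0 <= segment_int UY t (t + 1)%R w by exact: segment_ge0.
have segfin : \int[P]_w segment_int UY t (t + 1)%R w \is a fin_num.
  rewrite ge0_fin_numE; last exact: integral_ge0.
  apply: le_lt_trans (EY_fin t0); rewrite (EY t0).
  apply: (@ge0_le_integral _ _ _ P setT measurableT (segment_int UY t (t + 1)%R) (tail_int UY t)).
  - by move=> w _; exact: sY0.
  - exact: msY.
  - exact: (tail_measurable jUY UY0 t0).
  - by move=> w _; exact: (segment_le_tail w jUY UY0 t0 tt1).
have jV : joint V by case: pV => _ /(progressive_joint sF).
have [cY _ _ _] := pY; have [cV _ _ _] := pV.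
have pathwise : {ae P, forall w, segment_int UY t (t + 1)%R w <= limn_einf (G ^~ w)}.
  apply: filterS (ae_ae_positive jV V0) => w aV.
  have mg n : measurable_fun `[t, (t + 1)%R[%classic (fun s => (grid_fun t n s w)%:E).
    by have [mgn _ _] := gi n; exact: mgn.
  have Dt s : `[t, (t + 1)%R[%classic s -> (t <= s)%R by rewrite /= in_itv/= => /andP[].
  have nn n s : `[t, (t + 1)%R[%classic s -> 0 <= (grid_fun t n s w)%:E.
    by move=> /Dt ts; rewrite lee_fin g0.
  have fat := @fatou _ _ _ mu _ (measurable_itv _) _ mg nn.
  apply: le_trans fat; apply: ae_ge0_le_integral => //.
  - by move=> s /Dt ts; rewrite lee_fin UY0// (le_trans t0).
  - by apply: (itv_measurable _ jUY t0) => s; rewrite in_itv/= => /andP[].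
  - by move=> s /Dt ts; apply: limn_einf_ge; near=> n; rewrite lee_fin g0.
  - exact: measurable_fun_limn_einf.
  pose leb : {measure set (measurableTypeR R) -> \bar R} := @lebesgue_measure R.
  have aV' : {ae leb, forall s, (0 <= s)%R -> (0 < V s w)%R} := aV.
  have nz : leb.-negligible [set 0%R : R].
    exists [set 0%R]; split => //; exact: lebesgue_measure_set1.
  have dY : {ae leb, forall s, ~ left_discontinuity (Y ^~ w) s}.
    apply: negligibleS (left_discontinuity_negligible (cY w).2).
    by move=> s /contrapT.
  have dV : {ae leb, forall s, ~ left_discontinuity (V ^~ w) s}.
    apply: negligibleS (left_discontinuity_negligible (cV w).2).
    by move=> s /contrapT.
  have sn : {ae leb, forall s : R, s != 0%R}.
    by apply: negligibleS nz => s /negP; rewrite negbK => /eqP.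
  have FF : Filter (nbhs (almost_everywhere leb)) by exact: ae_filter_ringOfSetsType.
  (* The excluded times are the jumps of [Y] and [V], the time 0 and the zeros of [V]; together they
     are negligible. *)
  apply: filterS2 (filterI dY dV) (filterI sn aV') => s [h1 h2] [h3 h4] /Dt ts.
  have s0 : (0 < s)%R by rewrite lt0r h3 (le_trans t0 ts).
  have c := grid_cvg t0 ts s0 (h4 (ltW s0)) h1 h2.
  by rewrite (cvg_limn_einf_sup c).1.
have mG n : measurable_fun setT (G n) by have [] := gi n.
have bound : \int[P]_w (N t w)%:E + \int[P]_w segment_int UY t (t + 1)%R w <=
    \int[P]_w (N (t + 1)%R w)%:E + \int[P]_w segment_int UY t (t + 1)%R w.
  rewrite -leeBrDl ?EN_fin//.
  apply: (@le_trans _ _ (\int[P]_w limn_einf (G ^~ w))).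
    apply: ae_ge0_le_integral => //.
    - by move=> w _; apply: limn_einf_ge; near=> n; exact: G0.
    - exact: measurable_fun_limn_einf.
    - by apply: filterS pathwise => w h _.
  apply: le_trans (fatou P measurableT mG (fun n w _ => G0 n w)) _.
  rewrite limn_einf_lim; apply: lime_le; first exact: is_cvg_einfs.
  near=> n; apply: (@le_trans _ _ (\int[P]_w G n w)).
    by apply: ereal_inf_lbound; exists n => /=.
  by rewrite leeBrDl ?EN_fin//; have [_ _] := gi n.
by move: bound; rewrite leeD2rE.
Unshelve. all: by end_near. Qed.

Lemma comparison_core t : (0 <= t)%R -> {ae P, forall w, N t w = 0%R}.
Proof.
move=> t0.
have up n : \int[P]_w (N t w)%:E <= \int[P]_w (N (t + n%:R)%R w)%:E.
  elim: n => [|n IH]; first by rewrite addr0.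
  apply: (le_trans IH); rewrite -natr1 addrA; apply: unit_step.
  by rewrite addr_ge0.
have c := tail_vanish jUY UY0 Yfin t0.
have EN0 : \int[P]_w (N t w)%:E <= 0.
  rewrite -(cvg_lim _ c)//; apply: lime_ge; first by apply/cvg_ex; eexists; exact: c.
  near=> n; have tn0 : (0 <= t + n%:R)%R by rewrite addr_ge0.
  apply: (le_trans (up n)); rewrite -(EY tn0); apply: ge0_le_integral => //.
  - by move=> w _; rewrite lee_fin.
  - by apply/measurable_EFinP; exact: mNT.
  - by apply/measurable_EFinP; exact: mYT.
  - by move=> w _; rewrite lee_fin N_le.
have mE : measurable_fun setT (fun w => (N t w)%:E).
  by apply/measurable_EFinP; exact: mNT.
have : \int[P]_w `|(N t w)%:E| = 0.
  apply: le_anti; apply/andP; split; last by apply: integral_ge0.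
  apply: le_trans EN0; rewrite le_eqVlt; apply/orP; left; apply/eqP.
  by apply: eq_integral => w _; rewrite gee0_abs// lee_fin.
move/(ae_eq_integral_abs P measurableT mE); apply: filterS => w /(_ I) /= h.
by case: h.
Unshelve. all: by end_near. Qed.

End comparison_core.

(** * The power aggregator and the comparison of its solutions *)

Section aggregator.
Context {d : measure_display} {Omega : measurableType d} {R : realType}.
Variables (P : probability Omega R) (F : R -> set (set Omega)).
Hypothesis sF : standing_filtration P F.
Variables (th : R) (c : process Omega R).
Hypotheses (th1 : 1 < th) (jc : joint c) (c0 : nonneg_process c).
Implicit Types (U W Y V : process Omega R).

Let th0 : 0 < th. Proof. exact: lt_trans th1. Qed.

(** This is [(1 - R) f_EZ] as a function of [W = (1 - R) V], with [C^(1 - S)] in the place of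
    [c]. *)
Definition aggregator W : process Omega R :=
  fun t w => th * c t w * W t w `^ ((th - 1) / th).

Lemma aggregator_joint W : joint W -> joint (aggregator W).
Proof.
move=> jW; apply: measurable_funM; first by apply: measurable_funM.
exact: measurable_fun_powR.
Qed.

Lemma aggregator_nonneg W : nonneg_process (aggregator W).
Proof. by move=> t w t0; rewrite !mulr_ge0 ?powR_ge0 ?c0// ltW. Qed.

Lemma aggregator_le W Y t w : 0 <= t -> 0 <= W t w -> W t w <= Y t w ->
  aggregator W t w <= aggregator Y t w.
Proof.
move=> t0 W0 WY; apply: ler_wpM2l; first by rewrite mulr_ge0 ?c0// ltW.
apply: ge0_ler_powR; rewrite ?nnegrE//; last exact: le_trans WY.
by rewrite divr_ge0 ?subr_ge0// ltW.
Qed.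

Local Open Scope ereal_scope.

Definition recursive_solution W := potential P F (aggregator W) W /\
  \int[P]_w tail_int (aggregator W) 0%R w < +oo.

Lemma solution_joint W : recursive_solution W -> joint W.
Proof. by move=> [[_ pW _ _] _]; exact: (progressive_joint sF). Qed.

Let root W t w : R := (W t w `^ th^-1)%R.

Let root_ge0 W t w : (0 <= root W t w)%R. Proof. exact: powR_ge0. Qed.

Let root_pow W t w : (0 <= W t w)%R -> (root W t w `^ th = W t w)%R.
Proof. by move=> W0; rewrite /root -powRrM mulVf ?powRr1// gt_eqF. Qed.

Let root_gt0 W t w : (0 < W t w)%R -> (0 < root W t w)%R.
Proof. exact: powR_gt0. Qed.

Let aggregatorE W t w : (aggregator W t w = th * c t w * root W t w `^ (th - 1))%R.
Proof. by rewrite /aggregator /root -powRrM (mulrC (th^-1)%R). Qed.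

Let mroot W : recursive_solution W -> adapted F (root W).
Proof.
move=> [[_ pW _ _] _] t t0; apply: measurable_fun_powR.
exact: (progressive_adapted sF pW t0).
Qed.

Lemma comparison Y V : recursive_solution Y -> recursive_solution V ->
  (forall t, (0 <= t)%R -> {ae P, forall w, (0 < V t w)%R}) ->
  forall t, (0 <= t)%R -> {ae P, forall w, (Y t w <= V t w)%R}.
Proof.
move=> hY hV V0 t t0; have [pY Yfin] := hY; have [pV Vfin] := hV.
have [cY _ Yge0 _] := pY; have [cV _ Vge0 _] := pV.
pose a t w := slope1 th (root Y t w) (root V t w).
pose b t w := slope2 th (root Y t w) (root V t w).
pose N t w := (gap (root Y t w) (root V t w) `^ th)%R.
have jUY := aggregator_joint (solution_joint hY).
have jUV := aggregator_joint (solution_joint hV).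
have ma : adapted F a.
  by move=> r r0; apply: measurable_slope1 => //; [exact: (mroot hY r0)|exact: (mroot hV r0)].
have mb : adapted F b.
  by move=> r r0; apply: measurable_slope2 => //; [exact: (mroot hY r0)|exact: (mroot hV r0)].
have mN : adapted F N.
  move=> r r0; apply: measurable_fun_powR.
  by apply: measurable_gap; [exact: (mroot hY r0)|exact: (mroot hV r0)].
have N_le r w : (0 <= r)%R -> (N r w <= Y r w)%R.
  move=> r0; rewrite -[leRHS](root_pow (Yge0 r w r0)); apply: ge0_ler_powR.
  - exact: ltW.
  - by rewrite nnegrE gap_ge0.
  - by rewrite nnegrE.
  - exact: gap_le.
have euler r : (0 <= r)%R -> {ae P, forall w, (N r w + b r w * V r w = a r w * Y r w)%R}.
  move=> r0; apply: filterS (V0 r r0) => w Vw.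
  have := slope_euler th1 (root_ge0 Y r w) (root_gt0 Vw).
  by rewrite (root_pow (Yge0 r w r0)) (root_pow (Vge0 r w r0)).
have tangent r r' : (0 <= r)%R -> (0 <= r')%R ->
    {ae P, forall w, (a r w * Y r' w <= b r w * V r' w + N r' w)%R}.
  move=> r0 r'0; apply: filterS (V0 r r0) => w Vw.
  have := slope_tangent th1 (root_ge0 Y r w) (root_gt0 Vw) (root_ge0 Y r' w) (root_ge0 V r' w).
  by rewrite (root_pow (Yge0 r' w r'0)) (root_pow (Vge0 r' w r'0)).
have drift r w : (0 <= r)%R -> (0 < V r w)%R ->
    (a r w * aggregator Y r w = b r w * aggregator V r w)%R.
  move=> r0 Vw; have e := slope_drift th1 (root_ge0 Y r w) (root_gt0 Vw).
  rewrite (aggregatorE Y r w) (aggregatorE V r w).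
  rewrite (mulrCA (a r w) (th * c r w)%R) (mulrCA (b r w) (th * c r w)%R).
  by rewrite /a /b e.
have gradient r w (u : R^nat) : (0 <= r)%R -> (0 < V r w)%R -> (forall n, 0 <= u n)%R ->
    Y (u n) w @[n --> \oo] --> Y r w -> V (u n) w @[n --> \oo] --> V r w ->
    a (u n) w @[n --> \oo] --> a r w /\ b (u n) w @[n --> \oo] --> b r w.
  move=> r0 Vw u0 uY uV; have thV : (0 < th^-1)%R by rewrite invr_gt0.
  apply: (cvg_slope th1 (root_gt0 Vw)) => //.
  - by apply: cvg_powR => // n; exact: Yge0.
  - by apply: cvg_powR => // n; exact: Vge0.
have := comparison_core sF jUY jUV (aggregator_nonneg Y) (aggregator_nonneg V) pY pV Yfin Vfin
  (a := a) (b := b) (N := N) (fun _ _ => slope1_ge0 _ _ _)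
  (fun r w => slope1_le1 th1 (root_ge0 Y r w) (root_ge0 V r w)) (fun _ _ => slope2_ge0 _ _ _)
  (fun _ _ => powR_ge0 _ _) ma mb mN N_le V0 euler tangent drift gradient t0.
apply: filterS => w Nw.
rewrite -(root_pow (Yge0 t w t0)) -(root_pow (Vge0 t w t0)).
apply: ge0_ler_powR; rewrite ?nnegrE//; first exact: ltW.
have /eqP := Nw; rewrite powR_eq0 => /andP[/eqP g _].
by rewrite -subr_le0 -g le_max lexx.
Qed.

End aggregator.

(** * Scaling and almost sure order of potentials *)

Section almost_sure_order.
Context {d : measure_display} {Omega : measurableType d} {R : realType}.
Variables (P : probability Omega R) (F : R -> set (set Omega)).
Hypothesis sF : standing_filtration P F.
Implicit Types (U W Y V : process Omega R).

Lemma cadlag_scale k W : cadlag W -> cadlag (fun t w => k * W t w).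
Proof.
move=> cW w; split => t t0.
  by apply: cvgMr; exact: (cW w).1.
by apply: is_cvgMr; exact: (cW w).2.
Qed.

(** The order holds almost surely at all dyadic times together, and right-continuity extends it to
    every time. *)
Lemma cadlag_ae_le Y V : cadlag Y -> cadlag V ->
  (forall t, 0 <= t -> {ae P, forall w, Y t w <= V t w}) ->
  {ae P, forall w, forall t, 0 <= t -> Y t w <= V t w}.
Proof.
move=> cY cV YV.
have : {ae P, forall w, forall ni : nat * nat,
    Y (ni.2%:R / 2 ^+ ni.1) w <= V (ni.2%:R / 2 ^+ ni.1) w}.
  apply: ae_forall_countable => -[n i]; apply: YV.
  by rewrite divr_ge0// ltW// exp2_gt0.
apply: filterS => w h t t0.
have cy := dyadic_above_right_cvg t0 ((cY w).1 t t0).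
have cv := dyadic_above_right_cvg t0 ((cV w).1 t t0).
rewrite -(cvg_lim _ cy)// -(cvg_lim _ cv)//.
apply: ler_lim; [by apply/cvg_ex; eexists; exact: cy|by apply/cvg_ex; eexists; exact: cv|].
near=> n; have [m [i ->]] := dyadic_dyadic_above n t.
exact: (h (m, i)).
Unshelve. all: by end_near. Qed.

Lemma progressive_scale k W : progressive F W -> progressive F (fun t w => k * W t w).
Proof.
move=> /(progressiveP sF) h; apply/(progressiveP sF) => t t0.
by apply: measurable_funM => //; exact: h.
Qed.

Local Open Scope ereal_scope.

(** The sign of [m] is free because the factor [(1 - R)^-1] may be negative. *)
Lemma ge0_integralZ_EFin d' (T : measurableType d') (mu : {measure set T -> \bar R})
    (D : set T) (f : T -> \bar R) (m : R) :
  measurable D -> measurable_fun D f -> (forall x, D x -> 0 <= f x) ->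
  \int[mu]_(x in D) (m%:E * f x) = m%:E * \int[mu]_(x in D) f x.
Proof.
move=> mD mf f0; have [m0|m0] := leP 0%R m; first by rewrite ge0_integralZl_EFin.
have nm0 : (0 <= - m)%R by rewrite oppr_ge0 ltW.
have e x : m%:E * x = - ((- m)%:E * x) by rewrite EFinN mulNe oppeK.
under eq_integral do rewrite e.
rewrite integral_ge0N; first by rewrite ge0_integralZl_EFin// -e.
by move=> x Dx; rewrite mule_ge0 ?f0.
Qed.

Lemma tail_scale k U t w : joint U -> nonneg_process U -> (0 <= t)%R ->
  tail_int (fun t w => k * U t w)%R t w = k%:E * tail_int U t w.
Proof.
move=> jU U0 t0; rewrite /tail_int; under eq_integral do rewrite EFinM.
apply: ge0_integralZ_EFin; first exact: measurable_itvcy.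
  exact: (path_measurable w jU t0).
by move=> s /= ts; rewrite lee_fin U0// (le_trans t0).
Qed.

Lemma joint_scale k U : joint U -> joint (fun t w => k * U t w)%R.
Proof. by move=> jU; apply: measurable_funM. Qed.

Lemma potential_scale k U W : joint U -> nonneg_process U -> (0 <= k)%R ->
  potential P F U W -> potential P F (fun t w => k * U t w)%R (fun t w => k * W t w)%R.
Proof.
move=> jU U0 k0 [cW pW W0 eW]; split.
- exact: cadlag_scale.
- exact: progressive_scale.
- by move=> t w t0; rewrite mulr_ge0// W0.
move=> t A t0 FA.
have mA : measurable A by exact: (filtration_sub sF t0 FA).
have mW := measurable_fun_filtration sF t0 (progressive_adapted sF pW t0).
under eq_integral do rewrite EFinM.
rewrite ge0_integralZl_EFin//; last 2 first.
- by move=> w _; rewrite lee_fin W0.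
- exact/measurable_EFinP/measurable_funTS.
rewrite eW// -ge0_integralZl_EFin//.
- by apply: eq_integral => w _; rewrite tail_scale.
- by move=> w _; exact: tail_ge0.
- by apply: measurable_funTS; exact: tail_measurable.
Qed.

(** Tonelli brings the expectation inside the time integral, so the null set where the order fails
    may depend on the time. *)
Lemma tail_expect_le U V t A : joint U -> joint V -> nonneg_process U -> nonneg_process V ->
  (0 <= t)%R -> measurable A ->
  (forall s, (0 <= s)%R -> {ae P, forall w, (U s w <= V s w)%R}) ->
  \int[P]_(w in A) tail_int U t w <= \int[P]_(w in A) tail_int V t w.
Proof.
move=> jU jV U0 V0 t0 mA UV.
rewrite (tail_tonelli P jU U0 t0 mA) (tail_tonelli P jV V0 t0 mA).
have mE W : joint W -> nonneg_process W ->
  measurable_fun [set s | (t <= s)%R] (fun s => \int[P]_(w in A) (W s w)%:E).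
  move=> jW W0.
  pose g (p : R * Omega) := if (t <= p.1)%R && (p.2 \in A) then (W p.1 p.2)%:E else 0.
  have mS : measurable ([set s : R | (t <= s)%R] `*` A).
    by apply: measurableX => //; exact: measurable_itvcy.
  have gS (p : R * Omega) : (p \in [set s : R | (t <= s)%R] `*` A) = (t <= p.1)%R && (p.2 \in A).
    by apply/idP/andP; rewrite !inE => -[].
  have mg : measurable_fun setT g.
    have mSS : measurable_fun ([set s : R | (t <= s)%R] `*` A) (fun p : R * Omega => (W p.1 p.2)%:E).
      apply: measurable_funS (joint_restrict jW t0).
        by apply: measurableX => //; exact: measurable_itvcy.
      by move=> p [].
    have := (measurable_restrictT (fun p : R * Omega => (W p.1 p.2)%:E) mS).1 mSS.
    by apply: eq_measurable_fun => p _; rewrite /g patchE gS.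
  have g0 p : 0 <= g p.
    by rewrite /g; case: ifP => // /andP[h _]; rewrite lee_fin W0// (le_trans t0).
  have := measurable_funTS (D := [set s : R | (t <= s)%R])
    (@measurable_fun_fubini_tonelli_F _ _ _ _ _ P g mg g0).
  apply: eq_measurable_fun => s /set_mem /= ts; rewrite /fubini_F /g /= ts/=.
  rewrite [RHS]integral_mkcond; apply: eq_integral => w _.
  by rewrite patchE.
apply: ge0_le_integral.
- exact: measurable_itvcy.
- move=> s /= ts; apply: integral_ge0 => w _.
  by rewrite lee_fin U0// (le_trans t0 ts).
- exact: mE.
- exact: mE.
move=> s /= ts; have s0 := le_trans t0 ts.
apply: ae_ge0_le_integral => //.
- by move=> w _; rewrite lee_fin U0.
- by apply: measurable_funTS; exact: time_measurable.
- by move=> w _; rewrite lee_fin V0.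
- by apply: measurable_funTS; exact: time_measurable.
- by apply: filterS (UV s s0) => w h _; rewrite lee_fin.
Qed.

Lemma expect_tail_fin U t : joint U -> nonneg_process U ->
  \int[P]_w tail_int U 0%R w < +oo -> (0 <= t)%R -> \int[P]_w tail_int U t w < +oo.
Proof.
move=> jU U0 Ufin t0; apply: le_lt_trans Ufin.
apply: (@ge0_le_integral _ _ _ P setT measurableT (tail_int U t) (tail_int U 0%R)).
- by move=> w _; exact: tail_ge0.
- exact: (tail_measurable jU U0 t0).
- exact: (tail_measurable jU U0 (lexx 0%R)).
- by move=> w _; exact: (tail_le w jU U0 (lexx 0%R) t0).
Qed.

Lemma adapted_le (Y V : Omega -> R) t : (0 <= t)%R ->
  measurable_fun setT (Y : g_sigma_algebraType (F t) -> R) ->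
  measurable_fun setT (V : g_sigma_algebraType (F t) -> R) ->
  (forall w, 0 <= Y w)%R -> (forall w, 0 <= V w)%R ->
  \int[P]_w (Y w)%:E < +oo -> \int[P]_w (V w)%:E < +oo ->
  (forall A, F t A -> \int[P]_(w in A) (Y w)%:E <= \int[P]_(w in A) (V w)%:E) ->
  {ae P, forall w, (Y w <= V w)%R}.
Proof.
by move=> t0; apply: condexp_le; [exact: (filtration_sigma sF t0)|exact: (@filtration_sub _ _ _ _ _ sF _ t0)].
Qed.

Lemma potential_expect_fin U W t : joint U -> nonneg_process U -> potential P F U W ->
  \int[P]_w tail_int U 0%R w < +oo -> (0 <= t)%R -> \int[P]_w (W t w)%:E < +oo.
Proof.
move=> jU U0 [_ _ _ eW] Ufin t0; rewrite (eW t setT t0); first exact: expect_tail_fin.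
exact: (filtration_ae sF t0 (aeW P (fun=> I))).
Qed.

Lemma potential_le U W V Y : joint U -> joint V -> nonneg_process U -> nonneg_process V ->
  potential P F U W -> potential P F V Y -> \int[P]_w tail_int V 0%R w < +oo ->
  (forall t, (0 <= t)%R -> {ae P, forall w, (U t w <= V t w)%R}) ->
  forall t, (0 <= t)%R -> {ae P, forall w, (W t w <= Y t w)%R}.
Proof.
move=> jU jV U0 V0 pW pY Vfin UV t t0.
have [_ prW W0 eW] := pW; have [_ prY Y0 eY] := pY.
have Ufin : \int[P]_w tail_int U 0%R w < +oo.
  by apply: le_lt_trans Vfin; exact: tail_expect_le.
apply: (adapted_le t0 (progressive_adapted sF prW t0) (progressive_adapted sF prY t0)).
- by move=> w; exact: W0.
- by move=> w; exact: Y0.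
- exact: (potential_expect_fin jU U0 pW).
- exact: (potential_expect_fin jV V0 pY).
move=> A FA; rewrite eW// eY//; apply: tail_expect_le => //.
exact: (filtration_sub sF t0 FA).
Qed.

End almost_sure_order.

(** * Monotone iteration *)

Section monotone_integral.
Context {d : measure_display} {T : measurableType d} {R : realType}.
Local Open Scope ereal_scope.

Lemma cvg_monotone_integral (mu : {measure set T -> \bar R}) (D : set T)
    (g : (T -> \bar R)^nat) (f : T -> \bar R) :
  measurable D -> (forall n, measurable_fun D (g n)) ->
  (forall n x, D x -> 0 <= g n x) ->
  (forall x, D x -> nondecreasing_seq (g ^~ x)) ->
  (forall x, D x -> g n x @[n --> \oo] --> f x) ->
  \int[mu]_(x in D) g n x @[n --> \oo] --> \int[mu]_(x in D) f x.
Proof.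
move=> mD mg g0 gS gf.
rewrite [X in _ --> X](_ : _ = \int[mu]_(x in D) limn (g ^~ x)).
  exact: cvg_monotone_convergence.
by apply: eq_integral => x /set_mem Dx; rewrite (cvg_lim _ (gf x Dx)).
Qed.

End monotone_integral.

Section monotone_iteration.
Context {d : measure_display} {Omega : measurableType d} {R : realType}.
Variables (P : probability Omega R) (F : R -> set (set Omega)).
Hypothesis sF : standing_filtration P F.
Variables (agg : process Omega R -> process Omega R) (lower upper : process Omega R).
Implicit Types (W : process Omega R).

Definition admissible W := progressive F W /\
  forall t w, 0 <= t -> lower t w <= W t w <= upper t w.

Hypotheses (progressive_lower : progressive F lower) (progressive_upper : progressive F upper).
Hypothesis lower_ge0 : nonneg_process lower.
Hypothesis lower_le_upper : forall t w, 0 <= t -> lower t w <= upper t w.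
Hypothesis agg_joint : forall W, joint W -> joint (agg W).
Hypothesis agg_nonneg : forall W, nonneg_process (agg W).
Hypothesis agg_le : forall W W' t w, 0 <= t -> 0 <= W t w -> W t w <= W' t w ->
  agg W t w <= agg W' t w.
Hypothesis agg_cvg : forall (u : nat -> process Omega R) W t w, 0 <= t ->
  (forall n, 0 <= u n t w) -> 0 <= W t w ->
  u n t w @[n --> \oo] --> W t w -> agg (u n) t w @[n --> \oo] --> agg W t w.
Hypothesis agg_fin : forall W, admissible W -> (\int[P]_w tail_int (agg W) 0 w < +oo)%E.
Hypothesis potential_bounds : forall W W', admissible W -> potential P F (agg W) W' ->
  forall t, 0 <= t -> {ae P, forall w, lower t w <= W' t w <= upper t w}.

Lemma adm_ge0 W t w : admissible W -> 0 <= t -> 0 <= W t w.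
Proof.
move=> [_ h] t0; have /andP[+ _] := h t w t0; apply: le_trans.
exact: lower_ge0.
Qed.

Lemma adm_joint W : admissible W -> joint W.
Proof. by move=> [pW _]; exact: (progressive_joint sF pW). Qed.

Let aggJ W (aW : admissible W) : joint (agg W) := agg_joint (adm_joint aW).

Local Open Scope ereal_scope.

Variable Phi : process Omega R -> process Omega R.
Hypothesis PhiP : forall W, admissible W -> potential P F (agg W) (Phi W).

Let Phi_bounds W t : admissible W -> (0 <= t)%R ->
  {ae P, forall w, (lower t w <= Phi W t w <= upper t w)%R}.
Proof. by move=> aW; exact: (potential_bounds aW (PhiP aW)). Qed.

(** Along the iteration [Phi W] dominates [W] and obeys the bounds only almost surely at each time.
    Clamping makes the sequence increasing and bounded on every path, and changes nothing almost
    surely by [iterate_next]. *)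
Definition next W : process Omega R :=
  fun t w => Num.min (upper t w) (Num.max (W t w) (Phi W t w)).

Lemma next_admissible W : admissible W -> admissible (next W).
Proof.
move=> aW; have [_ pPhi _ _] := PhiP aW; have [pW bW] := aW.
split.
  apply/(progressiveP sF) => t t0; apply: measurable_minr.
    exact: ((progressiveP sF _).1 progressive_upper t t0).
  apply: measurable_maxr; first exact: ((progressiveP sF W).1 pW t t0).
  exact: ((progressiveP sF _).1 pPhi t t0).
move=> t w t0; have /andP[b1 b2] := bW t w t0.
rewrite le_min ge_min le_max; apply/andP; split; last by rewrite lexx.
by apply/andP; split; [exact: lower_le_upper|rewrite b1].
Qed.

Lemma next_ge W t w : admissible W -> (0 <= t)%R -> (W t w <= next W t w)%R.
Proof.
move=> [_ bW] t0; have /andP[_ b2] := bW t w t0.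
by rewrite le_min le_max lexx b2.
Qed.

Definition iterate n : process Omega R := iter n next lower.

Lemma iterate_admissible n : admissible (iterate n).
Proof.
elim: n => [|n IH]; last exact: next_admissible.
split=> // t w t0; apply/andP; split; first exact: lexx.
exact: lower_le_upper.
Qed.

Lemma iterate_le n t w : (0 <= t)%R -> (iterate n t w <= iterate n.+1 t w)%R.
Proof. by move=> t0; exact: next_ge (iterate_admissible n) t0. Qed.

(** Both clamps are inactive once [iterate n <= Phi (iterate n)]. This holds first by the lower
    bound, and monotonicity of [agg] propagates it. *)
Lemma iterate_next n t : (0 <= t)%R ->
  {ae P, forall w, iterate n.+1 t w = Phi (iterate n) t w}.
Proof.
move=> t0.
suff h : {ae P, forall w, (iterate n t w <= Phi (iterate n) t w)%R}.
  apply: filterS2 h (Phi_bounds (iterate_admissible n) t0) => w h /andP[_ h2].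
  by rewrite [LHS]/= /next max_r// min_r.
elim: n t t0 => [|n IH] t t0.
  by apply: filterS (Phi_bounds (iterate_admissible 0) t0) => w /andP[].
have IHt := IH t t0.
have mono := potential_le sF (aggJ (iterate_admissible n))
  (aggJ (iterate_admissible n.+1)) (@agg_nonneg _) (@agg_nonneg _)
  (PhiP (iterate_admissible n)) (PhiP (iterate_admissible n.+1))
  (agg_fin (iterate_admissible n.+1))
  (fun s s0 => aeW P (fun w => agg_le s0 (adm_ge0 w (iterate_admissible n) s0)
     (iterate_le n w s0))) t0.
apply: filterS3 IHt mono (Phi_bounds (iterate_admissible n) t0) => w h1 h2 /andP[_ h3].
by rewrite [X in (X <= _)%R]/= /next max_r// min_r.
Qed.

Definition limit : process Omega R := fun t w => limn (fun n => iterate n t w).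

Lemma iterate_nd t w : (0 <= t)%R -> nondecreasing_seq (fun n => iterate n t w).
Proof. by move=> t0; apply/nondecreasing_seqP => n; exact: iterate_le. Qed.

Lemma iterate_cvg t w : (0 <= t)%R -> iterate n t w @[n --> \oo] --> limit t w.
Proof.
move=> t0; apply: nondecreasing_is_cvgn; first exact: iterate_nd.
exists (upper t w) => _ [n _ <-].
by have [_ h] := iterate_admissible n; have /andP[] := h t w t0.
Qed.

Lemma limit_admissible : admissible limit.
Proof.
split.
  apply/(progressiveP sF) => t t0.
  apply: (@measurable_fun_cvg _ _ _ _ (fun n (p : R * g_sigma_algebraType (F t)) =>
      iterate n p.1 p.2)).
    by move=> n; have [h _] := iterate_admissible n; exact: ((progressiveP sF _).1 h t t0).
  by move=> [s w] [/= /andP[s0 _] _]; exact: iterate_cvg.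
move=> t w t0; have c := @iterate_cvg t w t0.
have b n : (lower t w <= iterate n t w <= upper t w)%R.
  by have [_ h] := iterate_admissible n; exact: h.
apply/andP; split.
  apply: limr_ge; first by apply/cvg_ex; eexists; exact: c.
  by near=> n; have /andP[] := b n.
apply: limr_le; first by apply/cvg_ex; eexists; exact: c.
by near=> n; have /andP[] := b n.
Unshelve. all: by end_near. Qed.

Lemma agg_iterate_cvg t w : (0 <= t)%R ->
  (agg (iterate n) t w)%:E @[n --> \oo] --> (agg limit t w)%:E.
Proof.
move=> t0; suff main : agg (iterate n) t w @[n --> \oo] --> agg limit t w.
  by apply: cvg_EFin; [near=> n|exact: main].
apply: agg_cvg => //; last exact: iterate_cvg.
  by move=> n; exact: adm_ge0 (iterate_admissible n) t0.
exact: adm_ge0 limit_admissible t0.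
Unshelve. all: by end_near. Qed.

Lemma agg_iterate_nd t w : (0 <= t)%R ->
  nondecreasing_seq (fun n => (agg (iterate n) t w)%:E).
Proof.
move=> t0 n m nm; rewrite lee_fin; apply: agg_le => //.
  exact: adm_ge0 (iterate_admissible n) t0.
exact: iterate_nd.
Qed.

Lemma tail_iterate_nd t w : (0 <= t)%R ->
  nondecreasing_seq (fun n => tail_int (agg (iterate n)) t w).
Proof.
move=> t0 n m nm; apply: ge0_le_integral.
- exact: measurable_itvcy.
- by move=> s /= ts; rewrite lee_fin agg_nonneg// (le_trans t0).
- exact: (path_measurable w (aggJ (iterate_admissible n)) t0).
- exact: (path_measurable w (aggJ (iterate_admissible m)) t0).
- by move=> s /= ts; exact: (agg_iterate_nd w (le_trans t0 ts) nm).
Qed.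

Lemma tail_iterate_cvg t w : (0 <= t)%R ->
  tail_int (agg (iterate n)) t w @[n --> \oo] --> tail_int (agg limit) t w.
Proof.
move=> t0; apply: cvg_monotone_integral.
- exact: measurable_itvcy.
- move=> n; exact: (path_measurable w (aggJ (iterate_admissible n)) t0).
- by move=> n s /= ts; rewrite lee_fin agg_nonneg// (le_trans t0).
- by move=> s /= ts; exact: (agg_iterate_nd w (le_trans t0 ts)).
- by move=> s /= ts; exact: (@agg_iterate_cvg s w (le_trans t0 ts)).
Qed.

Lemma adm_measurable W t : admissible W -> (0 <= t)%R -> measurable_fun setT (W t).
Proof.
by move=> [pW _] t0; exact: (measurable_fun_filtration sF t0 (progressive_adapted sF pW t0)).
Qed.

(** Monotone convergence on both sides of the recursion [iterate n.+1 = Phi (iterate n)]. *)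
Lemma limit_integral t A : (0 <= t)%R -> F t A ->
  \int[P]_(w in A) (Phi limit t w)%:E = \int[P]_(w in A) (limit t w)%:E.
Proof.
move=> t0 FA; have mA : measurable A by exact: (filtration_sub sF t0 FA).
have [_ _ _ eL] := PhiP limit_admissible; rewrite eL//.
have c1 : \int[P]_(w in A) tail_int (agg (iterate n)) t w @[n --> \oo] -->
    \int[P]_(w in A) tail_int (agg limit) t w.
  apply: cvg_monotone_integral => //.
  - move=> n; apply: measurable_funTS.
    exact: (tail_measurable (aggJ (iterate_admissible n)) (@agg_nonneg _) t0).
  - by move=> n w _; exact: (tail_ge0 w (@agg_nonneg _) t0).
  - by move=> w _; exact: tail_iterate_nd.
  - by move=> w _; exact: tail_iterate_cvg.
have c2 : \int[P]_(w in A) (iterate n t w)%:E @[n --> \oo] -->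
    \int[P]_(w in A) (limit t w)%:E.
  apply: cvg_monotone_integral => //.
  - move=> n; apply/measurable_EFinP/measurable_funTS.
    exact: adm_measurable (iterate_admissible n) t0.
  - by move=> n w _; rewrite lee_fin; exact: adm_ge0 (iterate_admissible n) t0.
  - by move=> w _ n m nm; rewrite lee_fin; exact: iterate_nd.
  - by move=> w _; apply: cvg_EFin; [near=> n|exact: iterate_cvg].
have c3 : \int[P]_(w in A) (iterate n.+1 t w)%:E @[n --> \oo] -->
    \int[P]_(w in A) (limit t w)%:E.
  by rewrite (cvg_shiftS (fun n => \int[P]_(w in A) (iterate n t w)%:E)).
suff e : (fun n => \int[P]_(w in A) tail_int (agg (iterate n)) t w) =
    (fun n => \int[P]_(w in A) (iterate n.+1 t w)%:E).
  by move: c1; rewrite e => c1; exact: (cvg_unique _ c1 c3).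
apply/funext => n.
have [_ pPhi Phi0 e] := PhiP (iterate_admissible n); rewrite -e//.
apply: ge0_ae_eq_integral => //.
- apply/measurable_EFinP/measurable_funTS.
  exact: (measurable_fun_filtration sF t0 (progressive_adapted sF pPhi t0)).
- by apply/measurable_EFinP/measurable_funTS; exact: adm_measurable (iterate_admissible n.+1) t0.
- by move=> w _; rewrite lee_fin Phi0.
- by move=> w _; rewrite lee_fin; exact: adm_ge0 (iterate_admissible n.+1) t0.
- by apply: filterS (iterate_next n t0) => w -> _.
Unshelve. all: by end_near. Qed.

Lemma Phi_limit t : (0 <= t)%R -> {ae P, forall w, Phi limit t w = limit t w}.
Proof.
move=> t0; have pL := PhiP limit_admissible; have [_ pPhi Phi0 _] := pL.
have FT : F t setT by exact: (filtration_ae sF t0 (aeW P (fun=> I))).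
have Pfin : \int[P]_w (Phi limit t w)%:E < +oo.
  exact: (potential_expect_fin sF (aggJ limit_admissible) (@agg_nonneg _)
    pL (agg_fin limit_admissible) t0).
have Lfin : \int[P]_w (limit t w)%:E < +oo by rewrite -limit_integral.
have [pl _] := limit_admissible.
have h1 : {ae P, forall w, (Phi limit t w <= limit t w)%R}.
  apply: (adapted_le sF t0 (progressive_adapted sF pPhi t0) (progressive_adapted sF pl t0)) => //.
  - by move=> w; exact: Phi0.
  - by move=> w; exact: adm_ge0 limit_admissible t0.
  - by move=> A FA; rewrite limit_integral.
have h2 : {ae P, forall w, (limit t w <= Phi limit t w)%R}.
  apply: (adapted_le sF t0 (progressive_adapted sF pl t0) (progressive_adapted sF pPhi t0)) => //.
  - by move=> w; exact: adm_ge0 limit_admissible t0.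
  - by move=> w; exact: Phi0.
  - by move=> A FA; rewrite limit_integral.
by apply: filterS2 h1 h2 => w h1 h2; apply: le_anti; rewrite h1 h2.
Qed.

(** The pointwise [limit] comes without path regularity. [Phi limit] is a cadlag modification of it,
    and exchanging the two inside [agg] leaves the expected tails unchanged. *)
Lemma iteration_fixpoint :
  [/\ potential P F (agg (Phi limit)) (Phi limit),
     \int[P]_w tail_int (agg (Phi limit)) 0%R w < +oo &
     forall t, (0 <= t)%R ->
       {ae P, forall w, (lower t w <= Phi limit t w <= upper t w)%R}].
Proof.
have pL := PhiP limit_admissible; have [cP pP P0 eP] := pL.
have jP : joint (Phi limit) by exact: (progressive_joint sF pP).
have jA := agg_joint jP; have jL := aggJ limit_admissible.
have aggE s : (0 <= s)%R -> {ae P, forall w, agg (Phi limit) s w = agg limit s w}.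
  move=> s0; apply: filterS (Phi_limit s0) => w h; apply: le_anti.
  have L0 := adm_ge0 w limit_admissible s0.
  by rewrite !agg_le ?h.
have tE t A : (0 <= t)%R -> measurable A ->
    \int[P]_(w in A) tail_int (agg (Phi limit)) t w = \int[P]_(w in A) tail_int (agg limit) t w.
  move=> t0 mA; apply: le_anti; apply/andP; split.
    apply: tail_expect_le => //.
    by move=> s s0; apply: filterS (aggE s s0) => w ->.
  apply: tail_expect_le => //.
  by move=> s s0; apply: filterS (aggE s s0) => w ->.
split; last by move=> t t0; exact: Phi_bounds limit_admissible t0.
  split=> // t A t0 FA; rewrite (eP t A t0 FA); apply/esym/(tE t A t0).
  exact: (filtration_sub sF t0 FA).
by rewrite tE//; exact: agg_fin limit_admissible.
Qed.

End monotone_iteration.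

(** * Constants of the lower and upper bounds *)

Section crra_const.
Context {R : realType}.
Variable th : R.
Hypothesis th1 : 1 < th.
Let rho := (th - 1) / th.

Let th0 : 0 < th. Proof. exact: lt_trans th1. Qed.
Let rho0 : 0 < rho. Proof. by rewrite divr_gt0// subr_gt0. Qed.

(* The fixed point of [m |-> th * (m / q) `^ rho]. *)
Definition crra_const (q : R) : R := (th * q `^ (- rho)) `^ th.

Lemma crra_const_gt0 q : 0 < q -> 0 < crra_const q.
Proof. by move=> q0; rewrite powR_gt0// mulr_gt0// powR_gt0. Qed.

Lemma crra_constE q : 0 < q -> th * (crra_const q / q) `^ rho = crra_const q.
Proof.
move=> q0; have B0 : 0 <= th * q `^ (- rho) by rewrite mulr_ge0 ?powR_ge0// ltW.
rewrite powRM ?powR_ge0 ?invr_ge0 ?(ltW q0)//.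
rewrite -[q^-1]powR_inv1 ?(ltW q0)// -powRrM mulN1r /crra_const -powRrM.
have -> : th * rho = th - 1 by rewrite /rho mulrC divfK// gt_eqF.
by rewrite [RHS]powR_succ// mulrCA.
Qed.

(** Read [x] as [X] and [x / q] as [J]: if [X = q J], the aggregator sends the multiple
    [crra_const q] of [J] to the same multiple of [X], whose potential is the process one started
    from. *)
Lemma crra_const_fixed x q : 0 < x -> 0 < q ->
  th * x `^ th^-1 * (crra_const q * (x / q)) `^ rho = crra_const q * x.
Proof.
move=> x0 q0; have -> : crra_const q * (x / q) = crra_const q / q * x by rewrite mulrCA mulrC.
have cq0 := crra_const_gt0 q0.
rewrite powRM; last 2 first.
- by rewrite divr_ge0// ltW.
- exact: ltW.
have xE : x `^ th^-1 * x `^ rho = x.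
  rewrite -powRD; last by rewrite (gt_eqF x0) implybT.
  by rewrite /rho mulrBl divff ?gt_eqF// mul1r addrC subrK powRr1// ltW.
rewrite -[RHS](congr1 (fun z => z * x) (crra_constE q0)) -[in RHS]xE.
by rewrite mulrACA mulrA.
Qed.

Lemma crra_const_le k K : 0 < k -> k <= K -> crra_const K <= crra_const k.
Proof.
move=> k0 kK; have K0 : 0 < K := lt_le_trans k0 kK.
apply: ge0_ler_powR; rewrite ?nnegrE; [exact: ltW|..].
- by rewrite mulr_ge0 ?powR_ge0// ltW.
- by rewrite mulr_ge0 ?powR_ge0// ltW.
rewrite ler_pM2l// !powRN lef_pV2 ?posrE ?powR_gt0//.
by apply: ge0_ler_powR; rewrite ?nnegrE//; exact: ltW.
Qed.

End crra_const.

(** * Existence of a solution between two multiples of J *)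

Section existence.
Context {d : measure_display} {Omega : measurableType d} {R : realType}.
Variables (P : probability Omega R) (F : R -> set (set Omega)).
Hypothesis sF : standing_filtration P F.
Variables (th : R) (X J : process Omega R) (k K lo hi : R).
Hypothesis th1 : 1 < th.
Hypotheses (pX : progressive F X) (X0 : forall t w, 0 <= t -> 0 < X t w).
Hypothesis Xfin : (\int[P]_w tail_int X 0 w < +oo)%E.
Hypothesis pJ : potential P F X J.
Hypotheses (k0 : 0 < k) (kK : k <= K).
Hypothesis hk : forall t, 0 <= t -> {ae P, forall w, k * J t w <= X t w}.
Hypothesis hK : forall t, 0 <= t -> {ae P, forall w, X t w <= K * J t w}.
Hypotheses (lo0 : 0 < lo) (hi0 : 0 < hi) (lohi : lo <= hi).
Hypothesis lo_fixed : forall x, 0 < x ->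
  th * x `^ th^-1 * (lo * (x / K)) `^ ((th - 1) / th) = lo * x.
Hypothesis hi_fixed : forall x, 0 < x ->
  th * x `^ th^-1 * (hi * (x / k)) `^ ((th - 1) / th) = hi * x.
Implicit Types (W : process Omega R).

Definition root_process : process Omega R := fun t w => X t w `^ th^-1.

Let th0 : 0 < th. Proof. exact: lt_trans th1. Qed.
Let K0 : 0 < K. Proof. exact: lt_le_trans kK. Qed.
Let rho0 : 0 < (th - 1) / th.
Proof. by rewrite divr_gt0// subr_gt0. Qed.
Let jX : joint X. Proof. exact: (progressive_joint sF pX). Qed.
Let Xge0 : nonneg_process X. Proof. by move=> t w t0; exact/ltW/X0. Qed.
Let Jge0 : nonneg_process J. Proof. by case: pJ. Qed.

Lemma root_process_joint : joint root_process.
Proof. exact: measurable_fun_powR. Qed.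

Lemma root_process_nonneg : nonneg_process root_process.
Proof. by move=> t w _; exact: powR_ge0. Qed.

Let agg := aggregator th root_process.
Let lower : process Omega R := fun t w => lo * J t w.
Let upper : process Omega R := fun t w => hi * J t w.

Let lower_nonneg : nonneg_process lower.
Proof. by move=> t w t0; exact: (mulr_ge0 (ltW lo0) (Jge0 w t0)). Qed.

(** As the aggregator increases with [W], the inequalities [X / K <= J <= X / k] reduce both bounds
    to the fixed-point identities. *)
Let agg_bounds W t : admissible F lower upper W -> 0 <= t ->
  {ae P, forall w, lo * X t w <= agg W t w <= hi * X t w}.
Proof.
move=> aW t0; have [_ bW] := aW.
apply: filterS2 (hk t0) (hK t0) => w h1 h2.
have /andP[b1 b2] := bW t w t0; have x0 := X0 w t0.
have W0 : 0 <= W t w by apply: le_trans b1; exact: lower_nonneg.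
have c0 : 0 <= th * X t w `^ th^-1 by exact: (mulr_ge0 (ltW th0) (powR_ge0 _ _)).
have mono y z : 0 <= y -> y <= z -> y `^ ((th - 1) / th) <= z `^ ((th - 1) / th).
  move=> y0 yz; apply: (ge0_ler_powR (ltW rho0)) => //; rewrite nnegrE//.
  exact: le_trans yz.
apply/andP; split.
  rewrite -(lo_fixed x0); apply: (ler_wpM2l c0); apply: mono.
    exact: (mulr_ge0 (ltW lo0) (divr_ge0 (ltW x0) (ltW K0))).
  apply: le_trans b1; apply: (ler_wpM2l (ltW lo0)).
  by rewrite ler_pdivrMr// mulrC.
rewrite -(hi_fixed x0); apply: (ler_wpM2l c0); apply: mono => //.
apply: (le_trans b2); apply: (ler_wpM2l (ltW hi0)).
by rewrite ler_pdivlMr// mulrC.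
Qed.

Local Open Scope ereal_scope.

Let scaleX_fin m : (0 <= m)%R ->
  \int[P]_w tail_int (fun t w => m * X t w)%R 0%R w < +oo.
Proof.
move=> m0; under eq_integral do rewrite (tail_scale m _ jX Xge0 (lexx 0%R)).
rewrite ge0_integralZl_EFin//.
- by rewrite lte_mul_pinfty.
- by move=> w _; exact: (tail_ge0 w Xge0 (lexx 0%R)).
- exact: (tail_measurable jX Xge0 (lexx 0%R)).
Qed.

Let scaleX_nonneg m : (0 <= m)%R -> nonneg_process (fun t w => m * X t w)%R.
Proof. by move=> m0 t w t0; rewrite mulr_ge0// Xge0. Qed.

Let aggJ W : joint W -> joint (agg W).
Proof. exact: (aggregator_joint th root_process_joint). Qed.

Let agg_nonneg W : nonneg_process (agg W).
Proof. exact: (aggregator_nonneg th1 root_process_nonneg). Qed.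

Let admJ W : admissible F lower upper W -> joint W.
Proof. by move=> [pW _]; exact: (progressive_joint sF pW). Qed.

Let agg_lower W s : admissible F lower upper W -> (0 <= s)%R ->
  {ae P, forall w, (lo * X s w <= agg W s w)%R}.
Proof. by move=> aW s0; apply: filterS (agg_bounds aW s0) => w /andP[]. Qed.

Let agg_upper W s : admissible F lower upper W -> (0 <= s)%R ->
  {ae P, forall w, (agg W s w <= hi * X s w)%R}.
Proof. by move=> aW s0; apply: filterS (agg_bounds aW s0) => w /andP[]. Qed.

Let agg_fin W : admissible F lower upper W -> \int[P]_w tail_int (agg W) 0%R w < +oo.
Proof.
move=> aW; apply: le_lt_trans (scaleX_fin (ltW hi0)).
apply: (tail_expect_le (aggJ (admJ aW)) (joint_scale hi jX) (@agg_nonneg W)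
  (scaleX_nonneg (ltW hi0)) (lexx 0%R) measurableT).
by move=> s s0; exact: agg_upper aW s0.
Qed.

Let agg_cvg (u : nat -> process Omega R) W t w : (0 <= t)%R ->
  (forall n, (0 <= u n t w)%R) -> (0 <= W t w)%R ->
  u n t w @[n --> \oo] --> W t w -> agg (u n) t w @[n --> \oo] --> agg W t w.
Proof. by move=> t0 u0 W0 uW; apply: cvgMr; exact: (cvg_powR rho0). Qed.

Let agg_potential_bounds W W' : admissible F lower upper W -> potential P F (agg W) W' ->
  forall t, (0 <= t)%R -> {ae P, forall w, (lower t w <= W' t w <= upper t w)%R}.
Proof.
move=> aW pW' t t0.
have h1 := potential_le sF (joint_scale lo jX) (aggJ (admJ aW))
  (scaleX_nonneg (ltW lo0)) (@agg_nonneg W) (potential_scale sF jX Xge0 (ltW lo0) pJ)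
  pW' (agg_fin aW) (fun s s0 => agg_lower aW s0) t0.
have h2 := potential_le sF (aggJ (admJ aW)) (joint_scale hi jX)
  (@agg_nonneg W) (scaleX_nonneg (ltW hi0)) pW'
  (potential_scale sF jX Xge0 (ltW hi0) pJ) (scaleX_fin (ltW hi0))
  (fun s s0 => agg_upper aW s0) t0.
by apply: filterS2 h1 h2 => w h1 h2; apply/andP; split.
Qed.

Lemma bounded_solution_exists : exists2 V : process Omega R,
  recursive_solution P F th root_process V &
  forall t, (0 <= t)%R -> {ae P, forall w, (lo * J t w <= V t w <= hi * J t w)%R}.
Proof.
have h W : exists W', admissible F lower upper W -> potential P F (agg W) W'.
  (* Off the admissible processes the claim is vacuous and [W] is a dummy witness; this gives a
     total [Phi]. *)
  have [aW|naW] := pselect (admissible F lower upper W); last by exists W => aW; case: naW.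
  have [W' hW'] := potential_exists sF (aggJ (admJ aW)) (@agg_nonneg W) (agg_fin aW).
  by exists W'.
have [Phi PhiP] := choice h.
have [_ prJ _ _] := pJ.
have prl : progressive F lower by exact: (progressive_scale sF lo prJ).
have pru : progressive F upper by exact: (progressive_scale sF hi prJ).
have lu t w : (0 <= t)%R -> (lower t w <= upper t w)%R.
  by move=> t0; exact: (ler_wpM2r (Jge0 w t0) lohi).
have agg_mono W W' t w : (0 <= t)%R -> (0 <= W t w)%R -> (W t w <= W' t w)%R ->
    (agg W t w <= agg W' t w)%R by exact: (aggregator_le th1 root_process_nonneg).
have [pV Vfin bV] := iteration_fixpoint sF prl pru lower_nonneg lu aggJ agg_nonneg
  agg_mono agg_cvg agg_fin agg_potential_bounds PhiP.
by exists (Phi (limit lower upper Phi)) => //; split.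
Qed.

End existence.

(** * From versions of J to potentials *)

Section translation.
Context {d : measure_display} {Omega : measurableType d} {R : realType}.
Variables (P : probability Omega R) (F : R -> set (set Omega)).
Hypothesis sF : standing_filtration P F.
Implicit Types (U V W J : process Omega R).
Local Open Scope ereal_scope.

Lemma G_measurable_filtration J t : (0 <= t)%R ->
  G_measurable (F t) (fun w => (J t w)%:E) <->
  measurable_fun setT (J t : g_sigma_algebraType (F t) -> R).
Proof.
move=> t0; split => h.
  move=> _ B mB; rewrite setTI sub_measurableE; last exact: (filtration_sigma sF t0).
  have -> : J t @^-1` B = (fun w => (J t w)%:E) @^-1` (EFin @` B).
    apply/seteqP; split => w /=; first by exists (J t w).
    by move=> [x Bx [<-]].
  apply: h; exact: measurable_image_EFin.
move=> B mB; rewrite -(sub_measurableE (filtration_sigma sF t0)).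
have /measurable_EFinP h' := h.
by have := h' measurableT B mB; rewrite setTI.
Qed.

(** A potential is nonnegative everywhere, [J] only almost surely; the absolute value repairs this
    and preserves regularity and integrals. *)
Lemma J_potential X J : progressive F X -> nonneg_process X ->
  is_J P F X J -> (forall t, (0 <= t)%R -> {ae P, forall w, (0 <= J t w)%R}) ->
  potential P F X (fun t w => `|J t w|%R).
Proof.
move=> pX X0 [cJ hJ] J0.
have aJ : adapted F J.
  by move=> t t0; have [mJ _ _] := hJ t t0; exact/(G_measurable_filtration _ t0).
have cJ' : cadlag (fun t w => `|J t w|%R).
  move=> w; split => t t0; first by apply: cvg_norm; exact: (cJ w).1.
  have /cvg_ex[l hl] := (cJ w).2 t t0.
  by apply/cvg_ex; exists `|l|%R; exact: cvg_norm.
have aJ' : adapted F (fun t w => `|J t w|%R).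
  by move=> t t0; apply: measurableT_comp; [exact: normr_measurable|exact: aJ].
split=> //; first exact: (cadlag_progressive sF).
move=> t A t0 FA; have mA := filtration_sub sF t0 FA.
have [_ _ <-//] := hJ t t0.
have mJ := measurable_fun_filtration sF t0 (aJ t t0).
apply: ae_eq_integral => //.
- by apply/measurable_EFinP/measurable_funTS; apply: measurableT_comp.
- exact/measurable_EFinP/measurable_funTS.
- by apply: filterS (J0 t t0) => w h _; rewrite ger0_norm.
Qed.

(** A CRRA-order solution brings its own version [J']. Integration over the sets of [F t] gives
    [|J| <= max(J', 0)] almost surely, so the positivity of [J] passes to [J']. *)
Lemma J_gt0 X J J' : progressive F X -> nonneg_process X ->
  \int[P]_w tail_int X 0%R w < +oo ->
  is_J P F X J -> is_J P F X J' ->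
  (forall t, (0 <= t)%R -> {ae P, forall w, (0 < J t w)%R}) ->
  forall t, (0 <= t)%R -> {ae P, forall w, (0 < J' t w)%R}.
Proof.
move=> pX X0 Xfin hJ hJ' Jpos t t0.
have jX := progressive_joint sF pX.
have Jge0 s : (0 <= s)%R -> {ae P, forall w, (0 <= J s w)%R}.
  by move=> s0; apply: filterS (Jpos s s0) => w /ltW.
have pJ := J_potential pX X0 hJ Jge0; have [_ pJ1 _ eJ] := pJ.
have [_ /(_ t t0)[mJ' alt eJ']] := hJ'.
have aJ' := (G_measurable_filtration J' t0).1 mJ'.
have mJ'T := measurable_fun_filtration sF t0 aJ'.
have FT : F t setT by exact: (filtration_ae sF t0 (aeW P (fun=> I))).
have tfin : \int[P]_w tail_int X t w < +oo by exact: expect_tail_fin.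
(* Both alternatives of [cexp_version] lead to integrability, the second because the expected tail
   is finite. *)
have iJ' : P.-integrable setT (fun w => (J' t w)%:E).
  case: alt => [[_ //]|[_ J'0]].
  apply/integrableP; split; first exact/measurable_EFinP.
  under eq_integral => w _ do rewrite gee0_abs//.
  by rewrite eJ'.
suff h : {ae P, forall w, (`|J t w| <= Num.max (J' t w) 0)%R}.
  apply: filterS2 h (Jpos t t0) => w + J0.
  by rewrite gtr0_norm// le_max => /orP[|]; [exact: lt_le_trans|rewrite leNgt J0].
have iM : P.-integrable setT (fun w => (Num.max (J' t w) 0)%:E).
  apply: (le_integrable _ _ _ iJ') => //.
    by apply/measurable_EFinP; apply: measurable_maxr.
  move=> w _; rewrite !abse_EFin lee_fin.
  by case: (leP (J' t w) 0%R) => _; rewrite ?normr0.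
apply: (adapted_le sF t0 (progressive_adapted sF pJ1 t0)) => //.
- by apply: measurable_maxr.
- by move=> w; rewrite le_max lexx orbT.
- exact: (potential_expect_fin sF jX X0 pJ Xfin t0).
- have /integrableP[_] := iM; congr (_ < _); apply: eq_integral => w _.
  by rewrite gee0_abs// lee_fin le_max lexx orbT.
- move=> A FA; have mA := filtration_sub sF t0 FA.
  rewrite eJ// -eJ'//; apply: le_integral => //.
  + exact: integrableS iJ'.
  + exact: integrableS iM.
  + by move=> w _; rewrite lee_fin le_max lexx.
Qed.

End translation.

(** * Translation of the Epstein-Zin equation *)

Section epstein_zin.
Context {d : measure_display} {Omega : measurableType d} {R : realType}.
Variables (P : probability Omega R) (F : R -> set (set Omega)).
Hypothesis sF : standing_filtration P F.
Variables (Ra Sa : R) (C : process Omega R).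
Hypotheses (Ra1 : Ra != 1) (Sa1 : Sa != 1) (th1 : 1 < ez_theta Ra Sa).
Hypothesis pX : progressive F (powC Ra C).
Implicit Types (V W : process Omega R).

Let c := root_process (ez_theta Ra Sa) (powC Ra C).
Let a := 1 - Ra.
Let a0 : a != 0. Proof. by rewrite subr_eq0 eq_sym. Qed.
Let agg := aggregator (ez_theta Ra Sa) c.

Let jc : joint c.
Proof. exact: (root_process_joint sF _ pX). Qed.

Let c0 : nonneg_process c.
Proof. exact: root_process_nonneg. Qed.

Let aggN W : nonneg_process (agg W).
Proof. exact: (aggregator_nonneg th1 c0). Qed.

(** The exponents match because [(1 - R) / th = 1 - S], and the factors because
    [th / (1 - R) = 1 / (1 - S)]. *)
Lemma ez_aggregator V s w :
  ez_proc Ra Sa C V s w = a^-1 * agg (fun t w => a * V t w) s w.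
Proof.
have b0 : 1 - Sa != 0 by rewrite subr_eq0 eq_sym.
rewrite /ez_proc /f_EZ /agg /aggregator /c /root_process /powC -powRrM.
have -> : (1 - Ra) * (ez_theta Ra Sa)^-1 = 1 - Sa.
  by rewrite /ez_theta -/a; field; rewrite a0 b0.
rewrite -/(ez_rho Ra Sa) /ez_theta -/a; field.
by rewrite a0 b0.
Qed.

Let ez_fun V : ez_proc Ra Sa C V = fun s w => a^-1 * agg (fun t w => a * V t w) s w.
Proof. by apply/funext => s; apply/funext => w; exact: ez_aggregator. Qed.

Let unscale V : V = fun t w => a^-1 * (a * V t w).
Proof. by apply/funext => s; apply/funext => w; rewrite mulKf. Qed.

Local Open Scope ereal_scope.

(** Multiplication by [1 - R], of either sign, commutes with the integrals of the nonnegative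
    aggregator, so the two equations and the two integrability conditions correspond. *)
Lemma solutionP V : is_solution P Ra Sa F C V <->
  recursive_solution P F (ez_theta Ra Sa) c (fun t w => a * V t w)%R.
Proof.
set W := fun t w => (a * V t w)%R.
have joint_agg : progressive F W -> joint (agg W).
  by move=> pW; apply: (aggregator_joint _ jc); exact: (progressive_joint sF pW).
have absE : joint (agg W) ->
    \int[P]_w (\int[@lebesgue_measure R]_(s in [set s | (0 <= s)%R]) `|ez_proc Ra Sa C V s w|%:E) =
    `|a^-1|%:E * \int[P]_w tail_int (agg W) 0%R w.
  move=> jA; rewrite -ge0_integralZl_EFin//; last 2 first.
  - by move=> w _; exact: (tail_ge0 w (aggN W) (lexx 0%R)).
  - exact: (tail_measurable jA (aggN W) (lexx 0%R)).
  apply: eq_integral => w _; rewrite -(tail_scale _ w jA (aggN W) (lexx 0%R)).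
  apply: eq_integral => s /set_mem /= s0.
  by rewrite ez_aggregator normrM (ger0_norm (aggN W w s0)).
have tailE t w : joint (agg W) -> (0 <= t)%R ->
    tail_int (ez_proc Ra Sa C V) t w = (a^-1)%:E * tail_int (agg W) t w.
  by move=> jA t0; rewrite ez_fun; exact: (tail_scale _ w jA (aggN W) t0).
have int_tailE t A : joint (agg W) -> (0 <= t)%R -> measurable A ->
    \int[P]_(w in A) tail_int (ez_proc Ra Sa C V) t w =
    (a^-1)%:E * \int[P]_(w in A) tail_int (agg W) t w.
  move=> jA t0 mA; under eq_integral do rewrite (tailE _ _ jA t0).
  apply: ge0_integralZ_EFin => //.
    exact: (measurable_funTS (tail_measurable jA (aggN W) t0)).
  by move=> w _; exact: (tail_ge0 w (aggN W) t0).
have intVE t A : progressive F W -> nonneg_process W -> (0 <= t)%R -> measurable A ->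
    \int[P]_(w in A) (V t w)%:E = (a^-1)%:E * \int[P]_(w in A) (W t w)%:E.
  move=> pW W0 t0 mA; rewrite {1}(unscale V).
  under eq_integral do rewrite EFinM.
  apply: ge0_integralZ_EFin => //.
    apply/measurable_EFinP/measurable_funTS.
    exact: (measurable_fun_filtration sF t0 (progressive_adapted sF pW t0)).
  by move=> w _; rewrite lee_fin; exact: W0.
have cancel_a (x y : \bar R) : (a^-1)%:E * x = (a^-1)%:E * y -> x = y.
  move=> /(congr1 (fun z => a%:E * z)).
  by rewrite !muleA -!EFinM divff// !mul1e.
split.
  move=> [cV pV V0 finV hV].
  have pW : progressive F W by exact: (progressive_scale sF).
  have jA := joint_agg pW; split; last first.
    move: finV; rewrite (absE jA) => h.
    have : `|a|%:E * (`|a^-1|%:E * \int[P]_w tail_int (agg W) 0%R w) < +oo.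
      by apply: lte_mul_pinfty h.
    by rewrite muleA -EFinM -normrM divff// normr1 mul1e.
  split=> //; first exact: cadlag_scale.
  move=> t A t0 FA; have mA := filtration_sub sF t0 FA.
  by apply: cancel_a; rewrite -intVE// -int_tailE//; have [_ _] := hV t t0; apply.
move=> [[cW pW W0 eW] finW]; have jA := joint_agg pW.
have pV : progressive F V by rewrite (unscale V); exact: (progressive_scale sF).
split; [|exact: pV|exact: W0| |].
- by rewrite (unscale V); exact: cadlag_scale.
- by rewrite (absE jA); exact: lte_mul_pinfty.
move=> t t0.
have FT : F t setT by exact: (filtration_ae sF t0 (aeW P (fun=> I))).
have tfin : \int[P]_w tail_int (agg W) t w < +oo by exact: expect_tail_fin.
split.
- apply/(G_measurable_filtration sF V t0).
  exact: (progressive_adapted sF pV t0).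
(* [V] has the sign of [1 - R], so the integrable alternative of [cexp_version] is the one that
   covers both cases. *)
- left; split.
    rewrite (_ : tail_int _ t = fun w => (a^-1)%:E * tail_int (agg W) t w); last first.
      by apply/funext => w; exact: tailE.
    apply: integrableZl => //; apply/integrableP; split.
      exact: (tail_measurable jA (aggN W) t0).
    by under eq_integral => w _ do rewrite gee0_abs ?(tail_ge0 w (aggN W) t0)//.
  rewrite (_ : (fun w => _) = fun w => (a^-1)%:E * (W t w)%:E); last first.
    by apply/funext => w; rewrite -EFinM /W mulKf.
  apply: integrableZl => //; apply/integrableP; split.
    apply/measurable_EFinP.
    exact: (measurable_fun_filtration sF t0 (progressive_adapted sF pW t0)).
  by under eq_integral => w _ do rewrite gee0_abs ?lee_fin ?W0//; rewrite eW.
- move=> A FA; have mA := filtration_sub sF t0 FA.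
  by rewrite intVE// int_tailE// eW.
Qed.

Lemma solution_le Y V : is_solution P Ra Sa F C Y -> is_solution P Ra Sa F C V ->
  (forall t, (0 <= t)%R -> {ae P, forall w, (0 < a * V t w)%R}) ->
  {ae P, forall w, forall t, (0 <= t)%R -> (a * Y t w <= a * V t w)%R}.
Proof.
move=> sY sV V0; have rY := (solutionP Y).1 sY; have rV := (solutionP V).1 sV.
have [[cY _ _ _] _] := rY; have [[cV _ _ _] _] := rV.
by apply: (cadlag_ae_le cY cV) => t t0; exact: (comparison sF th1 jc c0 rY rV V0 t0).
Qed.

Lemma indistinguishable_le Y V :
  {ae P, forall w, forall t, (0 <= t)%R -> (a * Y t w <= a * V t w)%R} ->
  {ae P, forall w, forall t, (0 <= t)%R -> (a * V t w <= a * Y t w)%R} ->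
  indistinguishable P Y V.
Proof.
apply: filterS2 => w h1 h2 t t0; apply: (mulfI a0).
by apply: le_anti; rewrite h1// h2.
Qed.

End epstein_zin.

(** * Existence, uniqueness and coincidence of the three solutions *)

Theorem theorem4p6 (d : measure_display) (Omega : measurableType d)
  (R : realType) (P : probability Omega R) (F : R -> set (set Omega))
  (Ra Sa : R) (C : process Omega R) :
  standing_filtration P F ->
  0 < Ra -> Ra != 1 -> 0 < Sa -> Sa != 1 -> 1 < ez_theta Ra Sa ->
  P_plus F C ->
  SO_plus P F (powC Ra C) ->
  exists V : process Omega R,
    [/\ is_CRRA_order P Ra Sa F C V,
        is_extremal P Ra Sa F C V &
        is_proper P Ra Sa F C V] /\
    [/\ (forall Y, is_CRRA_order P Ra Sa F C Y -> indistinguishable P Y V),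
        (forall Y, is_extremal P Ra Sa F C Y -> indistinguishable P Y V)
      & (forall Y, is_proper P Ra Sa F C Y -> indistinguishable P Y V)].
Proof.
move=> sF _ Ra1 _ Sa1 th1 _ [nu [_ [[[pX X0] Xfin [k [K [k0 kK [J [hJ JX]]]]]] _]]].
set X := powC Ra C in pX X0 Xfin hJ JX.
have a0 : 1 - Ra != 0 by rewrite subr_eq0 eq_sym.
have Xge0 : nonneg_process X by move=> t w t0; exact/ltW/X0.
have K0 : 0 < K := lt_le_trans k0 kK.
have JXt t : 0 <= t -> {ae P, forall w, k * J t w <= X t w <= K * J t w}.
  by move=> t0; apply: filterS JX => w; apply.
(* [X] is strictly positive and at most [K J], which forces [J] to be positive. *)
have Jpos t : 0 <= t -> {ae P, forall w, 0 < J t w}.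
  move=> t0; apply: filterS (JXt t t0) => w /andP[_ h].
  by rewrite -(pmulr_rgt0 _ K0); exact: lt_le_trans (X0 t w t0) h.
have Jge0 t : 0 <= t -> {ae P, forall w, 0 <= J t w}.
  by move=> t0; apply: filterS (Jpos t t0) => w /ltW.
have hk t : 0 <= t -> {ae P, forall w, k * `|J t w| <= X t w}.
  by move=> t0; apply: filterS2 (JXt t t0) (Jge0 t t0) => w /andP[h _] J0; rewrite ger0_norm.
have hK t : 0 <= t -> {ae P, forall w, X t w <= K * `|J t w|}.
  by move=> t0; apply: filterS2 (JXt t t0) (Jge0 t t0) => w /andP[_ h] J0; rewrite ger0_norm.
(* [K] bounds [J] from below by [X / K] and so gives the lower multiple; [k] gives the upper one. *)
have [W rW bW] := bounded_solution_exists sF th1 pX X0 Xfin (J_potential sF pX Xge0 hJ Jge0)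
  k0 kK hk hK (crra_const_gt0 th1 K0) (crra_const_gt0 th1 k0) (crra_const_le th1 k0 kK)
  (fun x x0 => crra_const_fixed th1 x0 K0) (fun x x0 => crra_const_fixed th1 x0 k0).
set lo := crra_const _ K in bW; set hi := crra_const _ k in bW.
have lo0 : 0 < lo := crra_const_gt0 th1 K0.
have bWJ t : 0 <= t -> {ae P, forall w, lo * J t w <= W t w <= hi * J t w}.
  by move=> t0; apply: filterS2 (bW t t0) (Jge0 t t0) => w h J0; rewrite -[J t w]ger0_norm.
pose V : process Omega R := fun t w => (1 - Ra)^-1 * W t w.
have aV : (fun t w => (1 - Ra) * V t w) = W.
  by apply/funext => t; apply/funext => w; rewrite /V mulVKf.
have aVE t w : (1 - Ra) * V t w = W t w by rewrite -[in RHS]aV.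
have sV : is_solution P Ra Sa F C V.
  by apply/(solutionP sF Ra1 Sa1 th1 pX); rewrite aV.
have Vpos t : 0 <= t -> {ae P, forall w, 0 < (1 - Ra) * V t w}.
  move=> t0; apply: filterS2 (bWJ t t0) (Jpos t t0) => w /andP[h _] J0.
  by rewrite aVE; exact: lt_le_trans (mulr_gt0 lo0 J0) h.
have crraV : is_CRRA_order P Ra Sa F C V.
  split=> //; exists lo, hi; split; [exact: lo0|exact: crra_const_le|].
  exists J; split=> //; have [cJ _] := hJ; have [[cW _ _ _] _] := rW.
  have h1 : {ae P, forall w, forall t, 0 <= t -> lo * J t w <= W t w}.
    apply: (cadlag_ae_le (cadlag_scale lo cJ) cW) => t t0.
    by apply: filterS (bWJ t t0) => w /andP[].
  have h2 : {ae P, forall w, forall t, 0 <= t -> W t w <= hi * J t w}.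
    apply: (cadlag_ae_le cW (cadlag_scale hi cJ)) => t t0.
    by apply: filterS (bWJ t t0) => w /andP[].
  by apply: filterS2 h1 h2 => w h1 h2 t t0; rewrite aVE h1//= h2.
have le_V Y : is_solution P Ra Sa F C Y ->
    {ae P, forall w, forall t, 0 <= t -> (1 - Ra) * Y t w <= (1 - Ra) * V t w}.
  by move=> sY; exact: (solution_le sF Ra1 Sa1 th1 pX sY sV Vpos).
have uniq Y : is_solution P Ra Sa F C Y ->
    (forall t, 0 <= t -> {ae P, forall w, 0 < (1 - Ra) * Y t w}) -> indistinguishable P Y V.
  move=> sY Ypos; apply: (indistinguishable_le Ra1 (le_V Y sY)).
  exact: (solution_le sF Ra1 Sa1 th1 pX sV sY Ypos).
exists V; split; split=> //.
- by split=> // t t0 Jt _; apply: filterS (Vpos t t0).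
(* The lower bound by a multiple of its own [J'] makes [Y] positive. *)
- move=> Y [sY [l [h [l0 _ [J' [hJ' bY]]]]]]; apply: uniq => // t t0.
  have J'pos := J_gt0 sF pX Xge0 Xfin hJ hJ' Jpos t0.
  apply: filterS2 bY J'pos => w /(_ t t0)/andP[b _] J'0.
  exact: lt_le_trans (mulr_gt0 l0 J'0) b.
- move=> Y [sY maxY]; apply: (indistinguishable_le Ra1 (le_V Y sY)).
  exact: maxY.
- move=> Y [sY properY]; apply: uniq => // t t0.
  (* [J] is itself a version of the conditional expectation in the definition of properness, and its
     positivity makes [Y] positive. *)
  have [_ /(_ t t0) cJ] := hJ.
  by apply: filterS2 (properY t t0 _ cJ) (Jpos t t0) => w + J0; apply; rewrite lte_fin.
Qed.
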